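(* If the Exponential Time Hypothesis is true, deciding whether an additively separable hedonic game whose underlying graph has pathwidth $p$ admits a connected Nash Stable partition cannot be done in time $f(p)\cdot n^{o(p/\log p)}$ for any computable function $f$, where $n$ is the number of vertices, even if all weights are in $\{-1,1\}$.
   Context: An additively separable hedonic game (ASHG) is given by a directed graph $G=(V,E)$ and a weight function $w:V\times V\to\mathbb{Z}$ with $w(u,v)=0$ whenever $uv\notin E$ (weights in $\{-1,1\}$ refers to the weights of arcs). For $v\in V$ and $S\subseteq V$, the utility of $v$ in $S$ is $p_v(S)=\sum_{u\in S\setminus\{v\}} w(v,u)$. A partition $\pi$ of $V$ (whose classes are called coalitions) is Nash Stable if for every $v\in V$, with $S$ the class of $\pi$ containing $v$, we have $p_v(S)\ge 0$ and $p_v(S)\ge p_v(S')$ for every $S'\in\pi$. It is a connected Nash Stable partition if additionally every class of $\pi$ induces a connected subgraph of the underlying undirected graph of $G$. Pathwidth refers to the underlying undirected graph. The Exponential Time Hypothesis (ETH) states that there is $c>1$ such that 3-SAT on $n$ variables cannot be solved in time $c^n$. *)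

(* Defs.v *)
From Stdlib Require Import Reals.
From mathcomp Require Import all_boot all_order all_algebra.
Set Implicit Arguments. Unset Strict Implicit. Unset Printing Implicit Defensive.
Import Order.TTheory GRing.Theory Num.Theory.

Inductive sym := S0 | S1 | SB.
Inductive move := ML | MR | MS.

Record TM := mkTM {
  tm_nstates : nat;
  tm_delta : 'I_tm_nstates.+2 -> sym -> option ('I_tm_nstates.+2 * sym * move)
}.

Definition tm_start (M : TM) : 'I_(tm_nstates M).+2 := ord0.
Definition tm_acc (M : TM) : 'I_(tm_nstates M).+2 := @Ordinal (tm_nstates M).+2 1 isT.

(* configuration: state, tape left of head (nearest cell first),
   symbol under head, tape right of head; unwritten cells are blank *)
Record config (Q : nat) := Cfg {
  c_state : 'I_Q; c_left : seq sym; c_cur : sym; c_right : seq sym }.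

Definition step (M : TM) (c : config (tm_nstates M).+2)
  : option (config (tm_nstates M).+2) :=
  match @tm_delta M (c_state c) (c_cur c) with
  | None => None
  | Some (q, s, m) =>
      match m with
      | MS => Some (Cfg q (c_left c) s (c_right c))
      | ML => match c_left c with
              | [::] => Some (Cfg q [::] SB (s :: c_right c))
              | a :: l => Some (Cfg q l a (s :: c_right c))
              end
      | MR => match c_right c with
              | [::] => Some (Cfg q (s :: c_left c) SB [::])
              | a :: r => Some (Cfg q (s :: c_left c) a r)
              end
      end
  end.

Fixpoint run (M : TM) (t : nat) (c : config (tm_nstates M).+2)
  : option (config (tm_nstates M).+2) :=
  match t with
  | 0 => Some c
  | t'.+1 => match step c with None => None | Some c' => run t' c' end
  end.

Definition bsym (b : bool) : sym := if b then S1 else S0.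

Definition init (M : TM) (x : seq bool) : config (tm_nstates M).+2 :=
  Cfg (tm_start M) [::] (head SB (map bsym x)) (behead (map bsym x)).

Definition halts_in (M : TM) (x : seq bool) (t : nat) (c : config (tm_nstates M).+2) :=
  run t (init M x) = Some c /\ step c = None.
Arguments halts_in M x t c : clear implicits.

Definition decides_at (M : TM) (x : seq bool) (t : nat) (P : Prop) :=
  exists c, halts_in M x t c /\ (c_state c = tm_acc M <-> P).

Definition is_S1 (s : sym) : bool := if s is S1 then true else false.

(* M computes f : nat -> nat, input and output in unary (the output is the
   maximal block of 1s starting at the head position when M halts) *)
Definition computes (M : TM) (f : nat -> nat) :=
  forall k, exists t c, halts_in M (nseq k true) t c /\
    exists rest, c_cur c :: c_right c ++ [:: SB] = nseq (f k) S1 ++ rest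
                 /\ ~~ is_S1 (head SB rest).

Definition computable (f : nat -> nat) := exists M, computes M f.

Fixpoint enc_nats (s : seq nat) : seq bool :=
  match s with
  | [::] => [::]
  | k :: s' => nseq k true ++ false :: enc_nats s'
  end.

(* a literal is (variable index, polarity); a clause is a list of literals *)
Definition is3cnf (nv : nat) (cls : seq (seq (nat * bool))) :=
  all (fun C => (size C <= 3) && all (fun l => l.1 < nv) C) cls.

Definition satisfiable (cls : seq (seq (nat * bool))) :=
  exists a : nat -> bool, all (fun C => has (fun l => a l.1 == l.2) C) cls.

Definition enc_cnf (nv : nat) (cls : seq (seq (nat * bool))) : seq bool :=
  enc_nats (nv :: size cls ::
    flatten [seq size C :: flatten [seq [:: l.1; nat_of_bool l.2] | l <- C] | C <- cls]).

Definition ETH : Prop :=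
  exists c : R, Rlt R1 c /\
    forall (M : TM) (k : nat),
      ~ (forall nv cls, is3cnf nv cls ->
           exists t, Rle (INR t)
                         (Rmult (Rmult (INR k) (Rpower c (INR nv)))
                                (INR ((size (enc_cnf nv cls)).+1 ^ k)))
                     /\ decides_at M (enc_cnf nv cls) t (satisfiable cls)).

(* w u v is the weight of arc uv (0 iff uv is not an arc)              *)
Local Open Scope ring_scope.

Definition weights_pm1 n (w : 'I_n -> 'I_n -> int) :=
  forall u v, w u v = 0 \/ w u v = 1 \/ w u v = -1.

Definition adj n (w : 'I_n -> 'I_n -> int) (u v : 'I_n) : bool :=
  (u != v) && ((w u v != 0) || (w v u != 0)).

Definition utility n (w : 'I_n -> 'I_n -> int) (v : 'I_n) (S : {set 'I_n}) : int :=
  \sum_(u in S | u != v) w v u.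

Definition nash_stable n (w : 'I_n -> 'I_n -> int) (P : {set {set 'I_n}}) :=
  partition P [set: 'I_n] /\
  forall v, 0 <= utility w v (pblock P v) /\
            forall S, S \in P -> utility w v S <= utility w v (pblock P v).

Definition coalitions_connected n (w : 'I_n -> 'I_n -> int) (P : {set {set 'I_n}}) :=
  forall S, S \in P -> forall x y, x \in S -> y \in S ->
    connect [rel a b | (a \in S) && (b \in S) && adj w a b] x y.

Definition has_connected_NS n (w : 'I_n -> 'I_n -> int) :=
  exists P, nash_stable w P /\ coalitions_connected w P.

Definition path_decomposition n (w : 'I_n -> 'I_n -> int) (B : seq {set 'I_n}) :=
  (forall v, exists2 X, X \in B & v \in X) /\
  (forall u v, adj w u v -> exists2 X, X \in B & (u \in X) && (v \in X)) /\
  (forall v (i j k : nat), (i <= j <= k)%N ->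
     v \in nth set0 B i -> v \in nth set0 B k -> v \in nth set0 B j).

Definition pw_le n (w : 'I_n -> 'I_n -> int) (p : nat) :=
  exists B, path_decomposition w B /\ forall X, X \in B -> (#|X| <= p.+1)%N.

Definition is_pathwidth n (w : 'I_n -> 'I_n -> int) (p : nat) :=
  pw_le w p /\ forall q, (q < p)%N -> ~ pw_le w q.

Definition wcode (z : int) : nat := if z == 1 then 1%N else if z == -1 then 2%N else 0%N.

Definition enc_game n (w : 'I_n -> 'I_n -> int) : seq bool :=
  enc_nats (n :: [seq wcode (w i j) | i <- enum 'I_n, j <- enum 'I_n]).

Local Close Scope ring_scope.

Definition little_o_p_over_logp (g : nat -> R) :=
  forall eps, Rlt R0 eps -> exists N, forall p, N <= p ->
    Rle (Rabs (g p)) (Rmult eps (Rdiv (INR p) (ln (INR p)))).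

(* Main.v *)
(** Fix a large constant [k] and split the [nv] variables of a 3-CNF formula into [k]
    groups, so that an assignment of a group is a number below [X], about [2 ^ (nv / k)].
    The formula is turned into linear inequalities with coefficients in {-1, 0, 1} over 0/1
    variables: there are three copies of each group per clause (one per literal), each
    copy a unary counter made of [X] monotone 0/1 variables, and an inequality per
    pair of consecutive copies forces the counters of a group to agree.  For a unary
    counter, "the value lies in a given set" is a linear form with coefficients in
    {-1, 0, 1}, so each clause is one inequality.  Sweeping through the copies keeps only
    O(k) inequalities alive.

    In the game an inequality is a hub vertex whose arcs are its coefficients.  A gadget
    forces all hubs into the coalition of a root vertex and gives each hub an alternative
    of utility 1, so Nash stability of the hub is the inequality, the true variables
    being the free vertices that join the root.

    The game has pathwidth at most [6 k + 9] and [poly * X] vertices.  As [k] is constant, so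
    is the factor [f p], and an algorithm with exponent o(p) for the game, run after the
    reduction, decides the formula in time [c ^ nv * poly].  The reduction has time
    [poly * X ^ D] with [D] independent of [k], hence within [c ^ nv * poly] as well. *)

Require Import Defs.
From Stdlib Require Import Reals Lra Classical FunctionalExtensionality.
From mathcomp Require Import all_boot all_order all_algebra zify.
Set Implicit Arguments. Unset Strict Implicit. Unset Printing Implicit Defensive.
Import Order.TTheory GRing.Theory Num.Theory.

(** * Turing machines from structured tape programs *)

(** Two obstacles shape the development. [ETH] speaks of one-tape machines, so the reduction has to
    be such a machine, with a bound on its running time. It is written in a small language of stacks
    with compositional costs and compiled in two stages. Moreover [k] is chosen after [D], so that
    [D] is at most [k * ln c]; hence [k] is a value in a register, and the arithmetic programs are
    the same for all [k].

    On the combinatorial side, unit weights rule out binary place values, which is why counters are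
    unary. If [y i] says that the counter [c] exceeds [i], the sum of [(B i - B (i - 1)) * y i]
    telescopes to [B (c - 1)], so membership in any set [B] has coefficients in {-1, 0, 1}. The
    counter value 0 stands for no assignment and satisfies no literal, so counters need no lower
    bound. Equality of the copies of a counter takes one inequality per step rather than two,
    because the inequalities close up to a cycle; the price is that the [k] hubs closing the cycles,
    with their anchors, stay in every bag. *)

Definition tape := int -> sym.
Definition upd_tape (f : tape) (p : int) (s : sym) : tape :=
  fun z => if z == p then s else f z.
Definition move_pos (m : move) (p : int) : int :=
  match m with ML => (p - 1)%R | MR => (p + 1)%R | MS => p end.

Lemma upd_tape_id (f : tape) p : upd_tape f p (f p) = f.
Proof. by apply: functional_extensionality => z; rewrite /upd_tape; case: eqP => // ->. Qed.

Section Machines.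
Variable Q : Type.
Implicit Type d : Q -> sym -> option (Q * sym * move).

Definition fstep d (c : Q * tape * int) : option (Q * tape * int) :=
  let: (q, f, p) := c in
  if d q (f p) is Some (q', s, m) then Some (q', upd_tape f p s, move_pos m p) else None.

Fixpoint frun d (t : nat) c :=
  if t is t'.+1 then (if fstep d c is Some c' then frun d t' c' else None) else Some c.

Lemma frunS d t c :
  frun d t.+1 c = if fstep d c is Some c' then frun d t c' else None.
Proof. by []. Qed.

Lemma frun_add d t1 t2 c c' :
  frun d t1 c = Some c' -> frun d (t1 + t2) c = frun d t2 c'.
Proof.
elim: t1 c => [|t1 IH] c /=; first by case=> ->.
by case: fstep => // c1; apply: IH.
Qed.

End Machines.

(** Each combinator embeds the states of its parts and redefines only their halting transitions, so
    runs of the parts carry over unchanged. *)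
Lemma frun_embed (Q1 Q2 : Type) (j : Q1 -> Q2) d1 d2 :
  (forall q s q' s' m, d1 q s = Some (q', s', m) -> d2 (j q) s = Some (j q', s', m)) ->
  forall t q f p q' f' p', frun d1 t (q, f, p) = Some (q', f', p') ->
  frun d2 t (j q, f, p) = Some (j q', f', p').
Proof.
move=> emb; elim=> [|t IH] q f p q' f' p' /=; first by case=> -> -> ->.
case E: d1 => [[[q1 s] m]|] //; rewrite (emb _ _ _ _ _ E); exact: IH.
Qed.

(** Arbitrary finite state types let machines be composed by sums and options of states; numbering
    the states is postponed until a [TM] is needed. A machine halts when [md] returns [None]. *)
Record mach := Mach {
  mst : finType; m0 : mst; md : mst -> sym -> option (mst * sym * move) }.

Inductive tc :=
| Act of sym -> sym * move
| TSeq of tc & tc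
| While of sym -> bool & tc
| TIf of sym -> bool & tc & tc.

(** Times are exact machine steps. The extra successors are the transitions that pass control
    between parts without moving the head. *)
Inductive texec : tc -> tape * int -> tape * int -> nat -> Prop :=
| XAct g f p : texec (Act g) (f, p) (upd_tape f p (g (f p)).1, move_pos (g (f p)).2 p) 1
| XSeq a b x y z t1 t2 :
    texec a x y t1 -> texec b y z t2 -> texec (TSeq a b) x z (t1 + t2.+1)
| XWhileF (q : sym -> bool) a x : ~~ q (x.1 x.2) -> texec (While q a) x x 0
| XWhileT (q : sym -> bool) a x y z t1 t2 : q (x.1 x.2) -> texec a x y t1 ->
    texec (While q a) y z t2 -> texec (While q a) x z (t1 + t2.+1).+1
| XIfT (q : sym -> bool) a b x y t : q (x.1 x.2) -> texec a x y t -> texec (TIf q a b) x y t.+1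
| XIfF (q : sym -> bool) a b x y t : ~~ q (x.1 x.2) -> texec b x y t -> texec (TIf q a b) x y t.+1.

Section Combinators.

Definition mact g : mach :=
  @Mach bool false (fun q s => if q then None else Some (true, (g s).1, (g s).2)).

Definition mseq (a b : mach) : mach :=
  @Mach (mst a + mst b)%type (inl (m0 a)) (fun q s =>
    match q with
    | inl q => if md q s is Some (q', s', m) then Some (inl q', s', m)
               else Some (inr (m0 b), s, MS)
    | inr q => if md q s is Some (q', s', m) then Some (inr q', s', m) else None
    end).

Definition mwhile (t : sym -> bool) (a : mach) : mach :=
  @Mach (option (mst a)) None (fun q s =>
    match q with
    | None => if t s then Some (Some (m0 a), s, MS) else None
    | Some q => if md q s is Some (q', s', m) then Some (Some q', s', m)
                else Some (None, s, MS)
    end).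

Definition mif (t : sym -> bool) (a b : mach) : mach :=
  @Mach (option (mst a + mst b)) None (fun q s =>
    match q with
    | None => Some (Some (if t s then inl (m0 a) else inr (m0 b)), s, MS)
    | Some (inl q) => if md q s is Some (q', s', m) then Some (Some (inl q'), s', m) else None
    | Some (inr q) => if md q s is Some (q', s', m) then Some (Some (inr q'), s', m) else None
    end).

End Combinators.

Fixpoint tcompile (c : tc) : mach :=
  match c with
  | Act g => mact g
  | TSeq a b => mseq (tcompile a) (tcompile b)
  | While q a => mwhile q (tcompile a)
  | TIf q a b => mif q (tcompile a) (tcompile b)
  end.

Definition mach_run (a : mach) (x y : tape * int) t :=
  exists2 q, frun (@md a) t (m0 a, x.1, x.2) = Some (q, y.1, y.2) & md q (y.1 y.2) = None.

Lemma mseq_run a b x y z t1 t2 :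
  mach_run a x y t1 -> mach_run b y z t2 -> mach_run (mseq a b) x z (t1 + t2.+1).
Proof.
case=> q1 r1 h1 [q2 r2 h2].
exists (inr q2); last by rewrite /= h2.
have e1 := @frun_embed _ _ (inl : mst a -> mst (mseq a b)) _ (@md (mseq a b)) _ _ _ _ _ _ _ _ r1.
rewrite (frun_add _ (e1 _)); last by move=> q s q' s' m /= ->.
rewrite /= h1 upd_tape_id.
by apply: (@frun_embed _ _ (inr : mst b -> mst (mseq a b)) _ (@md (mseq a b)) _ _ _ _ _ _ _ _ r2) => q s q' s' m /= ->.
Qed.

Lemma tcompile_run c x y t : texec c x y t -> mach_run (tcompile c) x y t.
Proof.
elim=> {c x y t}.
- by move=> g f p; exists true.
- by move=> a b x y z t1 t2 _ r1 _ r2; apply: mseq_run r1 r2.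
- by move=> q a x nq; exists None; rewrite //= (negbTE nq).
- move=> q a x y z t1 t2 qx _ [q1 r1 h1] _ [q2 r2 h2].
  exists q2 => //; rewrite /= qx upd_tape_id.
  have e1 := @frun_embed _ _ (Some : mst (tcompile a) -> mst (tcompile (While q a))) _
    (@md (tcompile (While q a))) _ _ _ _ _ _ _ _ r1.
  rewrite (frun_add _ (e1 _)); last by move=> ????? /= ->.
  by rewrite /= h1 upd_tape_id.
- move=> q a b x y t qx _ [q1 r1 h1]; exists (Some (inl q1)); last by rewrite /= h1.
  rewrite /= qx upd_tape_id.
  by apply: (@frun_embed _ _ (fun u => Some (inl u) : mst (tcompile (TIf q a b))) _ (@md (tcompile (TIf q a b))) _ _ _ _ _ _ _ _ r1) => ????? /= ->.
- move=> q a b x y t qx _ [q1 r1 h1]; exists (Some (inr q1)); last by rewrite /= h1.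
  rewrite /= (negbTE qx) upd_tape_id.
  by apply: (@frun_embed _ _ (fun u => Some (inr u) : mst (tcompile (TIf q a b))) _ (@md (tcompile (TIf q a b))) _ _ _ _ _ _ _ _ r1) => ????? /= ->.
Qed.

(* A configuration only determines the tape up to translation, hence the offset p. *)
Definition represents n (c : config n) (q : 'I_n) (f : tape) (p : int) :=
  [/\ c_state c = q, c_cur c = f p,
      forall i : nat, nth SB (c_right c) i = f (p + 1 + i%:Z)%R &
      forall i : nat, nth SB (c_left c) i = f (p - 1 - i%:Z)%R].

Lemma represents_step (M : TM) (c : config (tm_nstates M).+2) q f p :
  represents c q f p ->
  match fstep (@tm_delta M) (q, f, p) with
  | Some (q', f', p') => exists2 c', step c = Some c' & represents c' q' f' p'
  | None => step c = None
  end.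
Proof.
case: c => st l cur r [/= -> -> hr hl]; rewrite /step /=.
case: tm_delta => [[[q' s] m]|] //=.
have updD z : z != p -> upd_tape f p s z = f z by rewrite /upd_tape => /negbTE ->.
have updE : upd_tape f p s p = s by rewrite /upd_tape eqxx.
case: m => /=.
- have l0 := hl 0; rewrite subr0 in l0.
  case: l hl l0 => [|a l] hl l0.
  + exists (Cfg q' [::] SB (s :: r)) => //; split=> //=.
    * by rewrite updD -?l0 //; lia.
    * case=> [|i] /=; first by rewrite addr0 subrK updE.
      rewrite hr updD; last by lia.
      by congr f; lia.
    * move=> i; rewrite updD; last by lia.
      have := hl i.+1; rewrite !nth_nil => ->.
      by congr f; lia.
  + exists (Cfg q' l a (s :: r)) => //; split=> //=.
    * by rewrite updD -?l0 //; lia.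
    * case=> [|i] /=; first by rewrite addr0 subrK updE.
      rewrite hr updD; last by lia.
      by congr f; lia.
    * move=> i; rewrite updD; last by lia.
      have := hl i.+1 => /= ->.
      by congr f; lia.
- have r0 := hr 0; rewrite addr0 in r0.
  case: r hr r0 => [|a r] hr r0.
  + exists (Cfg q' (s :: l) SB [::]) => //; split=> //=.
    * by rewrite updD -?r0 //; lia.
    * move=> i; rewrite updD; last by lia.
      have := hr i.+1; rewrite !nth_nil => ->.
      by congr f; lia.
    * case=> [|i] /=; first by rewrite subr0 addrK updE.
      rewrite hl updD; last by lia.
      by congr f; lia.
  + exists (Cfg q' (s :: l) a r) => //; split=> //=.
    * by rewrite updD -?r0 //; lia.
    * move=> i; rewrite updD; last by lia.
      have := hr i.+1 => /= ->.
      by congr f; lia.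
    * case=> [|i] /=; first by rewrite subr0 addrK updE.
      rewrite hl updD; last by lia.
      by congr f; lia.
- exists (Cfg q' l s r) => //; split=> //= i; rewrite updD ?hr ?hl //; lia.
Qed.

Lemma represents_run (M : TM) t (c : config (tm_nstates M).+2) q f p q' f' p' :
  represents c q f p -> frun (@tm_delta M) t (q, f, p) = Some (q', f', p') ->
  exists2 c', run t c = Some c' & represents c' q' f' p'.
Proof.
elim: t c q f p => [|t IH] c q f p rc; first by case=> <- <- <-; exists c.
have := represents_step rc; rewrite frunS.
case: fstep => [[[q1 f1] p1]|]; last by move=> _.
case=> c1 e1 rc1 r; rewrite [run _ _]/= e1; exact: IH rc1 r.
Qed.

Lemma represents_run_back (M : TM) t (c c' : config (tm_nstates M).+2) q f p :
  represents c q f p -> run t c = Some c' ->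
  exists q' f' p', frun (@tm_delta M) t (q, f, p) = Some (q', f', p') /\
    represents c' q' f' p'.
Proof.
elim: t c q f p => [|t IH] c q f p rc; first by case=> <-; exists q, f, p.
have := represents_step rc; rewrite [run _ _]/=.
have := frunS (@tm_delta M) t (q, f, p).
case: fstep => [[[q1 f1] p1]|] ->; last by move=> ->.
by case=> c1 -> rc1 r; apply: IH rc1 r.
Qed.

Definition input_tape (x : seq bool) (o : int) : tape :=
  fun z => if (o <= z)%R then nth SB (map bsym x) `|z - o|%N else SB.

Lemma represents_init (M : TM) x o :
  represents (init M x) (tm_start M) (input_tape x o) o.
Proof.
split=> //=.
- by rewrite /input_tape lexx subrr nth0.
- move=> i; rewrite nth_behead /input_tape ifT; last by lia.
  by congr nth; lia.
- by move=> i; rewrite nth_nil /input_tape ifF //; lia.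
Qed.

Section ToTM.
Variables (A : mach) (M : TM).
Let S : finType := (mst A + 'I_(tm_nstates M).+2)%type.
Let s0 : S := inl (m0 A).
Let s1 : S := inr (tm_acc M).
Let rest : seq S := [seq x <- enum S | (x != s0) && (x != s1)].
(** A [TM] starts in state 0 and accepts in state 1, so the start of [A] and the accepting state of
    [M] have to come first in the numbering. *)
Let L := [:: s0, s1 & rest].

Let d (q : S) (s : sym) : option (S * sym * move) :=
  match q with
  | inl q => if md q s is Some (q', s', m) then Some (inl q', s', m)
             else Some (inr (tm_start M), s, MS)
  | inr q => if @tm_delta M q s is Some (q', s', m) then Some (inr q', s', m) else None
  end.

Lemma mem_states x : x \in L.
Proof. by rewrite !inE mem_filter mem_enum andbT; case: eqP => //=; case: eqP. Qed.

Definition code (x : S) : 'I_(size rest).+2 :=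
  @Ordinal (size L) (index x L) (etrans (index_mem x L) (mem_states x)).
Definition decode (i : 'I_(size rest).+2) : S := nth s0 L i.

Lemma codeK : cancel code decode.
Proof. by move=> x; rewrite /decode /code nth_index // mem_states. Qed.

Definition then_tm : TM := @mkTM (size rest) (fun i s =>
  if d (decode i) s is Some (q, s', m) then Some (code q, s', m) else None).

Lemma code_start : code s0 = tm_start then_tm.
Proof. by apply: val_inj; rewrite /= eqxx. Qed.

Lemma code_acc : code s1 = tm_acc then_tm.
Proof. by apply: val_inj. Qed.

(** [M] is only understood on initial configurations, so [A] must leave nothing but [x'] on the tape
    and return to the origin [o]. One extra step enters the start state of [M]. *)
Lemma then_tm_decides (x x' : seq bool) o t1 t2 P :
  mach_run A (input_tape x o, o) (input_tape x' o, o) t1 ->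
  decides_at M x' t2 P -> decides_at then_tm x (t1 + t2.+1) P.
Proof.
case=> q1 /= r1 h1 [c [[r2 h2] accP]].
have [q [f [p [r2' rc]]]] := represents_run_back (represents_init M x' o) r2.
have rt : frun (@tm_delta then_tm) (t1 + t2.+1) (tm_start then_tm, input_tape x o, o)
          = Some (code (inr q), f, p).
  have e1 := @frun_embed _ _ (fun u : mst A => code (inl u)) (@md A) (@tm_delta then_tm).
  rewrite -code_start (frun_add _ (e1 _ _ _ _ _ _ _ _ r1)); last first.
    by move=> q0 s q' s' m e; rewrite /= codeK /= e.
  rewrite [frun _ _ _]/= codeK /= h1 upd_tape_id.
  have e2 := @frun_embed _ _ (fun u : 'I_(tm_nstates M).+2 => code (inr u)) (@tm_delta M) (@tm_delta then_tm).
  apply: e2 r2' => q0 s q' s' m e; by rewrite /= codeK /= e.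
have [c' r rc'] := represents_run (represents_init then_tm x o) rt.
exists c'; split; first split=> //.
  have := represents_step rc'; rewrite /= codeK /=.
  case: rc => _ ec _ _; move: h2; rewrite /step.
  have := represents_step (M := M) (c := c) (q := q) (f := f) (p := p).
  case: (represents_run_back (represents_init M x' o) r2) => ? [? [? [e rc2]]].
  move: e; rewrite r2' => -[-> -> ->].
  move=> /(_ rc2); rewrite /= /step.
  case: tm_delta => [[[q' s] m]|] //.
  by case=> c2 -> .
case: rc rc' => <- _ _ _ [-> _ _ _].
rewrite -code_acc -accP; split=> [/(can_inj codeK) [] // | -> //].
Qed.

End ToTM.

(** * Stack programs *)

Definition texecle c x y T := exists2 t, texec c x y t & t <= T.

Lemma texecle_seq a b x y z t1 t2 T :
  texecle a x y t1 -> texecle b y z t2 -> t1 + t2 < T -> texecle (TSeq a b) x z T.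
Proof.
case=> u1 e1 l1 [u2 e2 l2] lT; exists (u1 + u2.+1); first exact: XSeq e1 e2.
by lia.
Qed.

Lemma texecle_act g f p f' p' T :
  0 < T -> f' = upd_tape f p (g (f p)).1 -> p' = move_pos (g (f p)).2 p ->
  texecle (Act g) (f, p) (f', p') T.
Proof. by move=> T0 -> ->; exists 1 => //; constructor. Qed.

Definition dz (m : move) : int := match m with ML => -1 | MR => 1 | MS => 0 end%R.

Definition go1 m := Act (fun s => (s, m)).
Fixpoint go m n := if n is n'.+1 then TSeq (go1 m) (go m n') else go1 MS.

Lemma go1P m f p : texecle (go1 m) (f, p) (f, p + dz m)%R 1.
Proof.
apply: texecle_act => //=; first by rewrite upd_tape_id.
by case: m => //=; rewrite addr0.
Qed.

Lemma goP m n f p : texecle (go m n) (f, p) (f, p + dz m * n%:Z)%R (2 * n).+1.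
Proof.
elim: n p => [|n IH] p; first by have := go1P MS f p; rewrite mulr0.
rewrite (_ : p + _ = p + dz m + dz m * n%:Z)%R; last by rewrite intS mulrDr mulr1 addrA.
by apply: texecle_seq (go1P m f p) (IH _) _; lia.
Qed.

Lemma walkP (q : sym -> bool) m W n f p :
  (forall j : nat, j < n -> q (f (p + dz m * (W * j)%:Z)%R)) ->
  ~~ q (f (p + dz m * (W * n)%:Z)%R) ->
  texecle (While q (go m W)) (f, p) (f, p + dz m * (W * n)%:Z)%R (n * (2 * W + 3)).
Proof.
elim: n p => [|n IH] p hq nq.
  by rewrite muln0 mulr0 addr0 in nq *; exists 0 => //; apply: XWhileF.
have [t1 e1 l1] := goP m W f p.
have [|| t2 e2 l2] := IH (p + dz m * W%:Z)%R.
- move=> j jn; have := hq j.+1 jn; rewrite mulnS.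
  by rewrite PoszD mulrDr addrA.
- by move: nq; rewrite mulnS PoszD mulrDr addrA.
exists (t1 + t2.+1).+1; last by lia.
apply: XWhileT e1 _; first by have := hq 0 isT; rewrite muln0 mulr0 addr0.
by move: e2; rewrite -addrA -mulrDr -PoszD -mulnS.
Qed.

Definition store := nat -> seq bool.
Definition setst (st : store) i l : store := fun j => if j == i then l else st j.

Lemma setst_same st i l : setst st i l i = l.
Proof. by rewrite /setst eqxx. Qed.

Lemma setst_neq st i j l : j != i -> setst st i l j = st j.
Proof. by rewrite /setst => /negbTE ->. Qed.

(** The top of a stack is the end of its list. [Loop i c0 c1] pops stack [i] until it is empty and
    runs [c1] or [c0] according to each bit. Nothing else pops or tests, so reading a stack destroys
    it. *)
Inductive cmd :=
| Skip
| Push of nat & bool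
| CSeq of cmd & cmd
| Loop of nat & cmd & cmd.

Inductive exec : cmd -> store -> store -> nat -> Prop :=
| ESkip st : exec Skip st st 1
| EPush i b st : exec (Push i b) st (setst st i (rcons (st i) b)) 1
| ESeq c1 c2 st1 st2 st3 t1 t2 :
    exec c1 st1 st2 t1 -> exec c2 st2 st3 t2 -> exec (CSeq c1 c2) st1 st3 (t1 + t2 + 1)
| ELoopE i c0 c1 st : st i = [::] -> exec (Loop i c0 c1) st st 1
| ELoopS i c0 c1 st l b st1 st2 t1 t2 : st i = rcons l b ->
    exec (if b then c1 else c0) (setst st i l) st1 t1 ->
    exec (Loop i c0 c1) st1 st2 t2 -> exec (Loop i c0 c1) st st2 (t1 + t2 + 1).

Fixpoint cmd_below W c : bool :=
  match c with
  | Skip => true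
  | Push i _ => i < W
  | CSeq a b => cmd_below W a && cmd_below W b
  | Loop i a b => [&& i < W, cmd_below W a & cmd_below W b]
  end.

Lemma cmd_belowW W W' c : W <= W' -> cmd_below W c -> cmd_below W' c.
Proof.
move=> le; elim: c => [|i b|a IHa b IHb|i a IHa b IHb] //=.
- by move=> h; apply: leq_trans h le.
- by case/andP=> /IHa -> /IHb ->.
- by case/and3P=> h /IHa -> /IHb ->; rewrite (leq_trans h le).
Qed.

Lemma cmd_bounded c : exists W, cmd_below W c.
Proof.
elim: c => [|i b|a [W1 h1] b [W2 h2]|i a [W1 h1] b [W2 h2]].
- by exists 0.
- by exists i.+1 => /=.
- exists (maxn W1 W2) => /=.
  by rewrite (cmd_belowW _ h1) ?(cmd_belowW _ h2) ?leq_maxl ?leq_maxr.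
- exists (maxn i.+1 (maxn W1 W2)) => /=.
  by rewrite leq_maxl (cmd_belowW _ h1) ?(cmd_belowW _ h2) //; lia.
Qed.

Lemma exec_size c st st' t B : exec c st st' t ->
  (forall i, size (st i) <= B) -> forall i, size (st' i) <= B + t.
Proof.
move=> e; elim: e B => {c st st' t}.
- by move=> st B h i; apply: leq_trans (h i) (leq_addr _ _).
- move=> i b st B h j; rewrite /setst; case: eqP => _.
    by rewrite size_rcons addn1 ltnS.
  by apply: leq_trans (h j) (leq_addr _ _).
- move=> c1 c2 st1 st2 st3 t1 t2 _ IH1 _ IH2 B h i.
  have := IH2 _ (IH1 _ h) i; lia.
- by move=> i c0 c1 st _ B h j; apply: leq_trans (h j) (leq_addr _ _).
- move=> i c0 c1 st l b st1 st2 t1 t2 e _ IH1 _ IH2 B h j.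
  have h' : forall r, size (setst st i l r) <= B.
    move=> r; rewrite /setst; case: eqP => _ //.
    by have := h i; rewrite e size_rcons; lia.
  have := IH2 _ (IH1 _ h') j; lia.
Qed.

Definition blank (s : sym) := if s is SB then true else false.
Definition nonblank s := ~~ blank s.
Definition write s := Act (fun _ => (s, MS)).

Section Encoding.
Variable W : nat.

(* Position 0 carries the marker [S1].  Stack 0 occupies the positions from 2 on,
   stack [i] the positions [-(i + W * j)]; multiples of [-W] and position 1 stay
   blank. *)
Definition enc_store (st : store) : tape := fun z =>
  if z == 0%R then S1 else
  if (0 < z)%R then nth SB (SB :: map bsym (st 0)) `|z|.-1 else
  if `|z| %% W == 0 then SB else nth SB (map bsym (st (`|z| %% W))) (`|z| %/ W).

Definition cell (i j : nat) : int :=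
  if i == 0 then Posz (j + 2) else (- (Posz (i + W * j)))%R.

Lemma nonblank_bsym b : nonblank (bsym b).
Proof. by case: b. Qed.

Lemma nonblank_nth l j : nonblank (nth SB (map bsym l) j) = (j < size l).
Proof.
case: ltnP => h; last by rewrite nth_default ?size_map.
by rewrite (nth_map false) // nonblank_bsym.
Qed.

Lemma enc_cell st i j : i < W -> enc_store st (cell i j) = nth SB (map bsym (st i)) j.
Proof.
move=> iW; rewrite /enc_store /cell; case: (eqVneq i 0) => [->|i0].
  rewrite ifF; last by lia.
  rewrite ifT; last by lia.
  by rewrite (_ : `|_|.-1 = j.+1) //; lia.
rewrite ifF; last by lia.
rewrite ifF; last by lia.
rewrite (_ : `|(- (i + W * j)%:Z)%R| = j * W + i); last by lia.
rewrite modnMDl divnMDl; last by lia.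
by rewrite modn_small // divn_small // addn0 (negbTE i0).
Qed.

Lemma enc_mark st j : enc_store st (- (W * j)%:Z)%R = if W * j == 0 then S1 else SB.
Proof.
rewrite /enc_store; case: (eqVneq (W * j) 0) => [->|h] //.
rewrite ifF; last by lia.
rewrite ifF; last by lia.
by rewrite (_ : `|_| = W * j) ?modnMr //; lia.
Qed.

Lemma enc_set st i l j s : i < W ->
  (forall r, nth SB (map bsym l) r = if r == j then s else nth SB (map bsym (st i)) r) ->
  enc_store (setst st i l) = upd_tape (enc_store st) (cell i j) s.
Proof.
move=> iW h; apply: functional_extensionality => z.
rewrite /enc_store /upd_tape /cell /setst.
case: (eqVneq i 0) => [i0|i0].
  subst i; case: (ltrP 0 z) => z0.
    rewrite ifF; last by lia.
    case: z z0 => // -[|[|z]] // _; first by rewrite [RHS]ifF //; lia.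
    by rewrite /= h (_ : (Posz z.+2 == _) = (z == j)); last by lia.
  rewrite [in RHS]ifF; last by lia.
  by case: eqP => //; case: eqP => // ->.
case: (eqVneq z 0%R) => z0; first by rewrite ifF; last by lia.
case: ltrP => zn; first by rewrite [RHS]ifF; last lia.
case: (eqVneq (`|z| %% W) 0) => m0.
  rewrite [RHS]ifF //; apply/eqP => ez; move: m0; rewrite ez.
  rewrite (_ : `|_| = j * W + i) ?modnMDl ?modn_small; lia.
case: (eqVneq (`|z| %% W) i) => mi; last first.
  rewrite [RHS]ifF //; apply/eqP => ez; move: mi; rewrite ez.
  by rewrite (_ : `|_| = j * W + i) ?modnMDl ?modn_small ?eqxx //; lia.
rewrite h (_ : (z == _) = (`|z| %/ W == j)) ?mi //.
have := divn_eq `|z| W; rewrite mi => e; apply/eqP/eqP => [ez|ej].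
  rewrite ez (_ : `|_| = j * W + i); last by lia.
  by rewrite divnMDl ?divn_small ?addn0; lia.
by rewrite ej in e; lia.
Qed.

Lemma enc_push st i b : i < W ->
  enc_store (setst st i (rcons (st i) b)) =
  upd_tape (enc_store st) (cell i (size (st i))) (bsym b).
Proof.
move=> iW; apply: enc_set => // r; rewrite map_rcons nth_rcons size_map.
case: ltngtP => // h; by rewrite nth_default // size_map ltnW.
Qed.

Lemma enc_pop st i l b : i < W -> st i = rcons l b ->
  enc_store (setst st i l) = upd_tape (enc_store st) (cell i (size l)) SB.
Proof.
move=> iW e; apply: enc_set => // r; rewrite e map_rcons nth_rcons size_map.
by case: ltngtP => // h; rewrite nth_default // size_map ?h // ltnW.
Qed.

End Encoding.

Section StackMachine.
Variable W : nat.

(** Where [seek] parks the head: on the top cell of stack 0 (position 1 if empty), and for the other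
    stacks on the multiple of [-W] between the top cell and the first free one. One look decides
    emptiness: the parking cell of stack 0 is then blank, while that of another stack is the marker
    at 0, all other multiples being blank. This is why [nonempty] uses opposite tests. *)
Definition spos (i j : nat) : int :=
  if i == 0 then Posz j.+1 else (- (Posz (W * j)))%R.
Definition seek i := if i == 0
  then TSeq (go MR 2) (TSeq (While nonblank (go MR 1)) (go ML 1))
  else TSeq (go ML i) (TSeq (While nonblank (go ML W)) (go MR i)).
Definition home i := if i == 0
  then TSeq (go ML 1) (TSeq (While nonblank (go ML 1)) (go ML 1))
  else TSeq (go MR i) (While blank (go MR W)).
Definition to_free i := if i == 0 then go MR 1 else go ML i.
Definition to_top i := go MR (if i == 0 then 0 else W - i).
Definition nonempty i := if i == 0 then nonblank else blank.

(** Every command starts and ends at position 0. In a loop each branch ends with a [seek], so that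
    the test always finds the head parked; the last [go ML (i == 0)] corrects for stack 0, whose
    parking position when empty is 1. *)
Fixpoint tc_of (c : cmd) : tc :=
  match c with
  | Skip => go1 MS
  | Push i b => TSeq (seek i) (TSeq (to_free i) (TSeq (write (bsym b)) (home i)))
  | CSeq a b => TSeq (tc_of a) (tc_of b)
  | Loop i c0 c1 =>
      let branch c := TSeq (write SB) (TSeq (home i) (TSeq (tc_of c) (seek i))) in
      TSeq (seek i) (TSeq
        (While (nonempty i) (TSeq (to_top i) (TIf is_S1 (branch c1) (branch c0))))
        (go ML (i == 0)))
  end.

Lemma walk1P (q : sym -> bool) m n f p :
  (forall j : nat, j < n -> q (f (p + dz m * j%:Z)%R)) ->
  ~~ q (f (p + dz m * n%:Z)%R) ->
  texecle (While q (go m 1)) (f, p) (f, p + dz m * n%:Z)%R (n * 5).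
Proof.
move=> h1 h2; rewrite -[n in (_ * n%:Z)%R]mul1n; apply: (@walkP q m 1 n f p) => [j|].
  by rewrite mul1n; apply: h1.
by rewrite mul1n.
Qed.

Lemma texecle_le c x y T T' : texecle c x y T -> T <= T' -> texecle c x y T'.
Proof. by case=> t e l l'; exists t => //; apply: leq_trans l l'. Qed.

Lemma texecle_pos c x f p p' T : p = p' ->
  texecle c x (f, p) T -> texecle c x (f, p') T.
Proof. by move=> ->. Qed.

Lemma seekP st i B : i < W -> size (st i) <= B ->
  texecle (seek i) (enc_store W st, 0%R) (enc_store W st, spos i (size (st i)))
    ((4 * W + 20) * B.+1).
Proof.
move=> iW sB; rewrite /seek /spos; case: (eqVneq i 0) => [i0|i0].
- have g1 := goP MR 2 (enc_store W st) 0%R.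
  have [||t2 e2 l2] := @walk1P nonblank MR (size (st i)) (enc_store W st) (0 + dz MR * 2)%R.
  + move=> j jl; rewrite (_ : (_ + _)%R = cell W 0 j); last by rewrite /cell /=; lia.
    by rewrite -i0 enc_cell ?nonblank_nth // i0.
  + rewrite (_ : (_ + _)%R = cell W 0 (size (st i))); last by rewrite /cell /=; lia.
    by rewrite -i0 enc_cell ?nonblank_nth ?ltnn // i0.
  have g3 := goP ML 1 (enc_store W st) (0 + dz MR * 2 + dz MR * (size (st i))%:Z)%R.
  have g23 := texecle_seq (ex_intro2 _ _ t2 e2 l2) g3 (ltnSn _).
  apply: texecle_pos (texecle_seq g1 g23 _); first by rewrite /=; lia.
  by nia.
- have g1 := goP ML i (enc_store W st) 0%R.
  have [||t2 e2 l2] := @walkP nonblank ML W (size (st i)) (enc_store W st) (0 + dz ML * i%:Z)%R.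
  + move=> j jl; rewrite (_ : (_ + _)%R = cell W i j); last first.
      by rewrite /cell (negbTE i0) /=; lia.
    by rewrite enc_cell ?nonblank_nth.
  + rewrite (_ : (_ + _)%R = cell W i (size (st i))); last first.
      by rewrite /cell (negbTE i0) /=; lia.
    by rewrite enc_cell ?nonblank_nth ?ltnn.
  have g3 := goP MR i (enc_store W st) (0 + dz ML * i%:Z + dz ML * (W * size (st i))%:Z)%R.
  have g23 := texecle_seq (ex_intro2 _ _ t2 e2 l2) g3 (ltnSn _).
  apply: texecle_pos (texecle_seq g1 g23 _); first by rewrite /=; lia.
  have : size (st i) * (2 * W + 3) <= B * (2 * W + 3) by rewrite leq_mul2r sB orbT.
  nia.
Qed.

Lemma homeP st i j B : i < W -> j <= size (st i) -> j <= B ->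
  texecle (home i) (enc_store W st, cell W i j) (enc_store W st, 0%R)
    ((4 * W + 20) * B.+1).
Proof.
move=> iW sB jB; rewrite /home; case: (eqVneq i 0) => [i0|i0].
- subst i; have g1 := goP ML 1 (enc_store W st) (cell W 0 j).
  have [||t2 e2 l2] := @walk1P nonblank ML j (enc_store W st) (cell W 0 j + dz ML * 1)%R.
  + move=> r jl; rewrite (_ : (_ + _ + _)%R = cell W 0 (j - r.+1)); last by rewrite /cell /=; lia.
    by rewrite enc_cell ?nonblank_nth //; lia.
  + by rewrite (_ : (_ + _ + _)%R = 1%R) //; rewrite /cell /=; lia.
  have g3 := goP ML 1 (enc_store W st) (cell W 0 j + dz ML * 1 + dz ML * j%:Z)%R.
  have g23 := texecle_seq (ex_intro2 _ _ t2 e2 l2) g3 (ltnSn _).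
  apply: texecle_pos (texecle_seq g1 g23 _); first by rewrite /cell /=; lia.
  by nia.
- have g1 := goP MR i (enc_store W st) (cell W i j).
  have [||t2 e2 l2] := @walkP blank MR W j (enc_store W st) (cell W i j + dz MR * i%:Z)%R.
  + move=> r jl; rewrite (_ : (_ + _ + _)%R = - (W * (j - r))%:Z)%R; last first.
      by rewrite /cell (negbTE i0) /=; lia.
    by rewrite enc_mark ifF //; nia.
  + rewrite (_ : (_ + _ + _)%R = - (W * 0)%:Z)%R; last first.
      by rewrite /cell (negbTE i0) /=; lia.
    by rewrite enc_mark muln0.
  have g2 : texecle _ _ _ _ := (ex_intro2 _ _ t2 e2 l2).
  apply: texecle_pos (texecle_seq g1 g2 _); first by rewrite /cell (negbTE i0) /=; lia.
  have : j * (2 * W + 3) <= B * (2 * W + 3) by rewrite leq_mul2r jB orbT.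
  nia.
Qed.

Lemma writeP s f p : texecle (write s) (f, p) (upd_tape f p s, p) 1.
Proof. by apply: texecle_act. Qed.

Definition op_cost B := (20 * W + 200) * B.+1.

Lemma pushP st i b B : i < W -> size (st i) <= B ->
  texecle (tc_of (Push i b)) (enc_store W st, 0%R)
    (enc_store W (setst st i (rcons (st i) b)), 0%R) (op_cost B).
Proof.
move=> iW sB /=.
have g1 := seekP iW sB.
have g2 : texecle (to_free i) (enc_store W st, spos i (size (st i)))
   (enc_store W st, cell W i (size (st i))) (2 * W + 4).
  rewrite /to_free /spos /cell; case: (eqVneq i 0) => i0.
    apply: texecle_le; first apply: texecle_pos (goP MR 1 _ _); rewrite /=; lia.
  apply: texecle_le; first apply: texecle_pos (goP ML i _ _); rewrite /=; lia.
have g3 := writeP (bsym b) (enc_store W st) (cell W i (size (st i))).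
rewrite -enc_push // in g3.
have g4 : texecle _ _ _ _ := @homeP (setst st i (rcons (st i) b)) i (size (st i)) B iW _ sB.
apply: texecle_seq g1 (texecle_seq g2 (texecle_seq g3 (g4 _) (ltnSn _)) (ltnSn _)) _.
  by rewrite setst_same size_rcons.
rewrite /op_cost; nia.
Qed.

Lemma to_topP st i j : i < W ->
  texecle (to_top i) (enc_store W st, spos i j.+1) (enc_store W st, cell W i j) (2 * W).+1.
Proof.
move=> iW; rewrite /to_top /spos /cell; case: (eqVneq i 0) => i0.
  by apply: texecle_le; first apply: texecle_pos (goP MR 0 _ _); rewrite /=; lia.
by apply: texecle_le; first apply: texecle_pos (goP MR (W - i) _ _); rewrite /=; nia.
Qed.

Lemma nonempty_spos st i : i < W ->
  nonempty i (enc_store W st (spos i (size (st i)))) = (0 < size (st i)).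
Proof.
move=> iW; rewrite /nonempty /spos; case: (eqVneq i 0) => i0.
  subst i; case E: (size (st 0)) => [|n] //.
  rewrite (_ : Posz n.+2 = cell W 0 n); last by rewrite /cell /=; lia.
  by rewrite enc_cell // nonblank_nth E ltnSn.
by rewrite enc_mark; case: (size _) => [|n]; rewrite ?muln0 //= ifF //; lia.
Qed.

(** By [exec_size] no stack outgrows [B + t], so each step of the source program costs a bounded
    number of walks of about that length. *)
Theorem tc_ofP c st st' t B : exec c st st' t -> cmd_below W c ->
  (forall i, size (st i) <= B) ->
  texecle (tc_of c) (enc_store W st, 0%R) (enc_store W st', 0%R) (t * (4 * op_cost (B + t))).
Proof.
move=> e; elim: e B => {c st st' t}.
- move=> st B _ _; apply: texecle_le (texecle_pos _ (go1P MS _ _)) _ => //.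
  by rewrite /op_cost; nia.
- move=> i b st B iW h; apply: texecle_le (pushP b iW (h i)) _.
  by rewrite /op_cost; nia.
- move=> c1 c2 st1 st2 st3 t1 t2 e1 IH1 e2 IH2 B /andP[w1 w2] h.
  apply: texecle_seq (IH1 B w1 h) (IH2 (B + t1) w2 (exec_size e1 h)) _.
  rewrite /op_cost; nia.
- move=> i c0 c1 st e B /and3P[iW w0 w1] h.
  have g1 := seekP iW (h i).
  set p := spos i _ in g1.
  have g2 : texecle (While (nonempty i) (TSeq (to_top i) (TIf is_S1 
     (TSeq (write SB) (TSeq (home i) (TSeq (tc_of c1) (seek i))))
     (TSeq (write SB) (TSeq (home i) (TSeq (tc_of c0) (seek i)))))))
     (enc_store W st, p) (enc_store W st, p) 0.
    by exists 0 => //; apply: XWhileF; rewrite nonempty_spos // e.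
  have g3 := goP ML (i == 0) (enc_store W st) p.
  apply: texecle_pos (texecle_seq g1 (texecle_seq g2 g3 (ltnSn _)) _).
    by rewrite /p e /spos; case: (i == 0) => /=; rewrite ?muln0; lia.
  have := h i; rewrite /op_cost; case: (i == 0); nia.
- move=> i c0 c1 st l b st1 st2 t1 t2 e e1 IH1 e2 IH2 B wL h.
  have h' : forall r, size (setst st i l r) <= B.
    move=> r; rewrite /setst; case: eqP => _ //.
    by have := h i; rewrite e size_rcons; lia.
  have [t e3 le3] := IH2 _ wL (exec_size e1 h').
  case/and3P: wL => iW w0 w1.
  have [t1' e1' l1'] := IH1 B (if b as b return cmd_below W (if b then c1 else c0) then w1 else w0) h'.
  (* The run given for the remaining iterations starts with its own [seek]. Inversion detaches it,
     to serve as the [seek] that ends the first iteration, and exposes the rest of the [While]. *)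
  inversion e3 as [|a b' x [f p] z ta tb ea eb| | | |]; subst.
  inversion eb as [|a b' x y z tc td ec ed| | | |]; subst.
  have [ts es ls] := seekP iW (h i).
  have [tt et lt] := to_topP st (size l) iW.
  rewrite -(size_rcons l b) -e in et.
  have [tw ew lw] := writeP SB (enc_store W st) (cell W i (size l)).
  rewrite -(enc_pop iW e) in ew.
  have lB : size l <= B by have := h i; rewrite e size_rcons; lia.
  have [th eh lh] := @homeP (setst st i l) i (size l) B iW (eq_leq (esym (f_equal size (setst_same _ _ _)))) lB.
  have := XSeq ew (XSeq eh (XSeq e1' ea)).
  set tbr := (tw + _) => ebr.
  exists (ts + (((tt + tbr.+1.+1) + tc.+1).+1 + td.+1).+1); last first.
    rewrite /tbr; move: le3 ls lt lw lh l1'; rewrite /op_cost; clear; nia.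
  apply: XSeq es (XSeq (XWhileT _ (XSeq et _) ec) ed).
  + by rewrite nonempty_spos // e size_rcons.
  + case: b e ebr e1' IH1 e1 => e ebr _ _ _.
      apply: XIfT ebr; rewrite /= enc_cell // e map_rcons nth_rcons size_map ltnn eqxx //.
    by apply: XIfF ebr; rewrite /= enc_cell // e map_rcons nth_rcons size_map ltnn eqxx.
Qed.

End StackMachine.

Definition io_store (x : seq bool) : store := fun i => if i == 0 then x else [::].

Lemma enc_io_store W x : 0 < W ->
  enc_store W (io_store x) = upd_tape (input_tape x 2) 0 S1.
Proof.
move=> W0; apply: functional_extensionality => z.
rewrite /enc_store /upd_tape /input_tape /io_store; case: (eqVneq z 0%R) => // z0.
case: ltrP => zp.
  case: z z0 zp => // -[|[|z]] // _ _ /=.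
  by rewrite subn2.
rewrite [in RHS]ifF; last by lia.
by case: ifP => // /negbT /negbTE ->; rewrite nth_nil.
Qed.

(** Stack 0 begins at position 2, hence the origin 2: with the input as only content, an encoded
    store differs from an input tape just by the marker. *)
Definition with_marker (c : tc) : tc :=
  TSeq (go ML 2) (TSeq (write S1) (TSeq c (TSeq (write SB) (go MR 2)))).

Lemma with_markerP W c x y T : 0 < W ->
  texecle c (enc_store W (io_store x), 0%R) (enc_store W (io_store y), 0%R) T ->
  texecle (with_marker c) (input_tape x 2, 2%R) (input_tape y 2, 2%R) (T + 20).
Proof.
move=> W0 e.
have g1 := goP ML 2 (input_tape x 2) 2%R.
have g2 := writeP S1 (input_tape x 2) 0%R.
have g3 := writeP SB (enc_store W (io_store y)) 0%R.
have g4 := goP MR 2 (input_tape y 2) 0%R.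
have e' : upd_tape (enc_store W (io_store y)) 0 SB = input_tape y 2.
  apply: functional_extensionality => z; rewrite enc_io_store // /upd_tape.
  by case: eqP => // ->.
rewrite e' in g3; rewrite -(enc_io_store _ W0) in g2.
apply: texecle_seq g1 (texecle_seq g2 (texecle_seq e (texecle_seq g3 g4 (ltnSn _)) (ltnSn _)) (ltnSn _)) _.
by lia.
Qed.

(** The overhead is quadratic because each of [t] steps may walk along stacks of height up to
    [size x + t]. The program has to empty every stack except its output. *)
Theorem stack_program_decides (c : cmd) (M : TM) : exists (M' : TM) (C : nat),
  forall x y t t2 P, exec c (io_store x) (io_store y) t -> decides_at M y t2 P ->
  exists2 t', t' <= C * (t + size x).+1 ^ 2 + t2 & decides_at M' x t' P.
Proof.
have [W hW] := cmd_bounded c.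
have {}hW : cmd_below W.+1 c by apply: cmd_belowW hW.
exists (then_tm (tcompile (with_marker (tc_of W.+1 c))) M), (4 * (20 * W.+1 + 200) + 30).
move=> x y t t2 P e d.
have hs i : size (io_store x i) <= size x by rewrite /io_store; case: eqP.
have [u eu lu] := with_markerP (ltn0Sn W) (tc_ofP e hW hs).
exists (u + t2.+1); last exact: then_tm_decides (tcompile_run eu) d.
rewrite addnS -addSn leq_add2r; apply: leq_ltn_trans lu _; rewrite /op_cost.
rewrite (addnC (size x)); set a := (20 * _ + 200); set b := (t + _).
have h1 : t * b.+1 <= b.+1 ^ 2 by rewrite leq_mul2r /b; lia.
have h2 : 0 < b.+1 ^ 2 by [].
have : a * (t * b.+1) <= a * b.+1 ^ 2 by rewrite leq_mul2l h1 orbT.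
have : 30 <= 30 * b.+1 ^ 2 by rewrite leq_pmulr.
by move: (b.+1 ^ 2) h2 => B h2; lia.
Qed.

(** * Programs on unary registers *)

Definition execle c st st' T := exists2 t, exec c st st' t & t <= T.

Lemma execle_seq a b x y z t1 t2 T :
  execle a x y t1 -> execle b y z t2 -> t1 + t2 < T -> execle (CSeq a b) x z T.
Proof.
case=> u1 e1 l1 [u2 e2 l2] lT; exists (u1 + u2 + 1); first exact: ESeq e1 e2.
by lia.
Qed.

Lemma execle_le c x y T T' : execle c x y T -> T <= T' -> execle c x y T'.
Proof. by case=> t e l l'; exists t => //; apply: leq_trans l l'. Qed.

Lemma execle_push i b st st' T : 0 < T -> st' = setst st i (rcons (st i) b) ->
  execle (Push i b) st st' T.
Proof. by move=> T0 ->; exists 1 => //; constructor. Qed.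

Lemma execle_skip st T : 0 < T -> execle Skip st st T.
Proof. by move=> T0; exists 1 => //; constructor. Qed.

Lemma setst_id (st : store) i l : st i = l -> setst st i l = st.
Proof. by move=> <-; apply: functional_extensionality => r; rewrite /setst; case: eqP => // ->. Qed.

(** [A k] is the store before iteration [k], and [s] lists the bits in popping order, so the stack
    itself holds [rev s]. *)
Lemma execle_loop i c0 c1 (s : seq bool) (A : nat -> store) T :
  A 0 i = rev s ->
  (forall k, k < size s -> execle (if nth false s k then c1 else c0)
     (setst (A k) i (rev (drop k.+1 s))) (A k.+1) T) ->
  (forall k, k <= size s -> A k i = rev (drop k s)) ->
  execle (Loop i c0 c1) (A 0) (A (size s)) (size s * (T + 1)).+1.
Proof.
elim: s A => [|b s IH] A e h hA; first by exists 1 => //; apply: ELoopE.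
have [t1 e1 l1] := h 0 isT.
have [||| t2 e2 l2] := IH (fun k => A k.+1).
- by have := hA 1 isT; rewrite /= drop0.
- by move=> k ks; have := h k.+1 ks.
- by move=> k ks; have := hA k.+1 ks.
exists (t1 + t2 + 1); last by rewrite /=; nia.
apply: ELoopS e2; first by rewrite e rev_cons.
by move: e1; rewrite /= drop0.
Qed.

Lemma execle_count i c0 c1 n (A : nat -> store) T :
  (forall k, k < n -> execle c1 (setst (A k) i (nseq (n - k.+1) true)) (A k.+1) T) ->
  (forall k, k <= n -> A k i = nseq (n - k) true) ->
  execle (Loop i c0 c1) (A 0) (A n) (n * (T + 1)).+1.
Proof.
move=> h hA; have E := @execle_loop i c0 c1 (nseq n true) A T.
rewrite size_nseq in E; apply: E.
- by rewrite hA // subn0 rev_nseq.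
- by move=> k kn; rewrite nth_nseq kn drop_nseq rev_nseq; apply: h.
- by move=> k kn; rewrite drop_nseq rev_nseq; apply: hA.
Qed.

Fixpoint pushes (ts : seq nat) := if ts is t :: ts' then CSeq (Push t true) (pushes ts') else Skip.

Lemma pushesP ts st :
  execle (pushes ts) st (fun r => st r ++ nseq (count_mem r ts) true) (2 * size ts).+1.
Proof.
elim: ts st => [|a ts IH] st /=.
  by have := execle_skip st (ltn0Sn 0); congr execle; apply: functional_extensionality => r; rewrite cats0.
have := IH (setst st a (rcons (st a) true)).
set s := (fun r => _) => e; set s' := (fun r => _).
have -> : s' = s.
  apply: functional_extensionality => r; rewrite /s /s' /setst [a == r]eq_sym.
  by case: eqP => [->|] //=; rewrite cat_rcons.
by apply: execle_seq (execle_push (ltn0Sn 0) erefl) e _; lia.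
Qed.

(** A repeated target receives a multiple of the value. Moving a register away and then back to
    itself and to another one is how values are copied. *)
Definition moves i ts := Loop i Skip (pushes ts).

Lemma nseqD n m : nseq (n + m) true = nseq n true ++ nseq m true.
Proof. by rewrite cat_nseq -[nseq m _]/(ncons m true [::]) /nseq /ncons iterD. Qed.

Lemma movesP i ts n st : st i = nseq n true -> i \notin ts ->
  execle (moves i ts) st
    (fun r => if r == i then [::] else st r ++ nseq (n * count_mem r ts) true)
    (n * (2 * size ts + 2)).+1.
Proof.
move=> e it.
have E := @execle_count i Skip (pushes ts) n (fun k r => if r == i then nseq (n - k) true
    else st r ++ nseq (k * count_mem r ts) true) (2 * size ts).+1.
have -> : (n * (2 * size ts + 2)).+1 = (n * ((2 * size ts).+1 + 1)).+1 by lia.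
have := E _ _; set A0 := (fun _ => _) in E *.
have -> : A0 = st.
  apply: functional_extensionality => r; rewrite /A0 mul0n cats0 subn0.
  by case: eqP => // ->.
rewrite /= subnn; apply.
- move=> k kn; have := pushesP ts (setst (fun r => if r == i then nseq (n - k) true
    else st r ++ nseq (k * count_mem r ts) true) i (nseq (n - k.+1) true)).
  congr execle; apply: functional_extensionality => r; rewrite /setst.
  case: eqP => [->|_]; first by rewrite (count_memPn it) cats0.
  by rewrite -catA -nseqD mulSn addnC.
- by move=> k kn; rewrite eqxx.
Qed.

Definition clear i := Loop i Skip Skip.

Lemma clearP i n st : st i = nseq n true ->
  execle (clear i) st (setst st i [::]) (n * 2).+1.
Proof.
move=> e; have := @movesP i [::] n st e isT; congr execle => //.
by apply: functional_extensionality => r; rewrite muln0 cats0.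
Qed.

(** Appending instead of assigning lets the same programs accumulate sums and stream numbers onto
    the output stack. *)
Definition addto (st : store) d n := setst st d (st d ++ nseq n true).

(** A loop always drains its register, so one unit cannot be popped in isolation. The value is
    rebuilt in [r] while [b] holds back the latest unit; discarding [b] at the end loses exactly
    that unit. *)
Definition decr r a b := CSeq (moves r [:: a])
  (CSeq (Loop a Skip (CSeq (moves b [:: r]) (Push b true))) (clear b)).

Lemma decrP r a b n st : st r = nseq n true -> st a = [::] -> st b = [::] ->
  r != a -> r != b -> a != b ->
  execle (decr r a b) st (setst st r (nseq n.-1 true)) (30 * n.+1).
Proof.
move=> er ea eb ra rb ab.
have e1 : execle (moves r [:: a]) st (setst (setst st r [::]) a (nseq n true)) (n * 4).+1.
  have := @movesP r [:: a] n st er; rewrite inE => /(_ ra); congr execle => //.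
  apply: functional_extensionality => j; rewrite /setst /=.
  case: (eqVneq j a) => [->|ja]; first by rewrite eq_sym (negbTE ra) ea ?eqxx muln1.
  by case: eqP => // _; rewrite ?[a == _]eq_sym ?(negbTE ja) muln0 cats0.
have e2 : execle (Loop a Skip (CSeq (moves b [:: r]) (Push b true)))
   (setst (setst st r [::]) a (nseq n true))
   (setst (setst st r (nseq n.-1 true)) b (nseq (0 < n) true)) (n * 14).+1.
  have E := @execle_count a Skip (CSeq (moves b [:: r]) (Push b true)) n
    (fun k => setst (setst (setst st r (nseq k.-1 true)) b (nseq (0 < k) true)) a (nseq (n - k) true)) 13.
  rewrite subn0 subnn in E.
  have := E _ _; set A0 := setst _ _ _.
  have -> : A0 = setst (setst st r [::]) a (nseq n true).
    apply: functional_extensionality => j; rewrite /A0 /setst.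
    by case: eqP => // _; case: eqP => // ->; rewrite (negbTE (contraNneq _ rb)) ?eb // => ->.
  set A1 := setst _ a [::].
  have -> : A1 = setst (setst st r (nseq n.-1 true)) b (nseq (0 < n) true).
    apply: functional_extensionality => j; rewrite /A1 /setst; case: eqP => // ->.
    by rewrite (negbTE ab) eq_sym (negbTE ra) ea.
  apply.
  - move=> k kn; set s := setst _ a _.
    have := @movesP b [:: r] (0 < k) s; rewrite inE eq_sym rb => h.
    have {}h := h _ isT; apply: execle_seq (h _) (execle_push (ltn0Sn 0) _) _.
    + by rewrite /s /setst !(eq_sym b) (negbTE ab) eqxx.
    + rewrite /s; apply: functional_extensionality => j; rewrite /setst /= eqxx /=.
      case: (eqVneq j a) => [->|ja].
        by rewrite (negbTE ab) (negbTE ra) muln0 cats0.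
      case: (eqVneq j b) => // jb; case: (eqVneq j r) => _.
        by rewrite addn0 muln1 -nseqD; case: (k) => //= k1; rewrite addn1.
      by rewrite muln0 cats0.
    + by case: (0 < k).
  - by move=> k kn; rewrite setst_same.
have e3 := @clearP b (0 < n) (setst (setst st r (nseq n.-1 true)) b (nseq (0 < n) true)) (setst_same _ _ _).
have <- : setst (setst (setst st r (nseq n.-1 true)) b (nseq (0 < n) true)) b [::] = setst st r (nseq n.-1 true).
  apply: functional_extensionality => j; rewrite /setst; case: eqP => // ->.
  by rewrite eq_sym (negbTE rb) eb.
apply: execle_seq e1 (execle_seq e2 e3 (ltnSn _)) _; case: (0 < n); lia.
Qed.

(** The calling convention: register 1 holds the input reversed, so that it pops in reading order,
    register 2 is reserved for scanning it, [rho] are the registers of the variables, and all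
    registers from [fr] on are empty scratch space. *)
Record ready (L : seq nat) (rho vs : seq nat) (fr dst : nat) (st : store) : Prop := Ready {
  rd_in : st 1 = rev (enc_nats L);
  rd_tmp : st 2 = [::];
  rd_env : map st rho = map (fun v => nseq v true) vs;
  rd_rho : all (fun r => (2 < r) && (r < fr)) rho;
  rd_free : forall r, fr <= r -> st r = [::];
  rd_fr : 2 < fr;
  rd_dst : dst < fr;
  rd_dst_rho : dst \notin rho;
  rd_dst1 : dst != 1;
  rd_dst2 : dst != 2 }.

Lemma map_setst_notin (st : store) rho i l : i \notin rho -> map (setst st i l) rho = map st rho.
Proof.
move=> h; apply/eq_in_map => r hr; rewrite setst_neq //.
by apply: contraNneq h => <-.
Qed.

Lemma fresh_notin rho fr : all (fun r => (2 < r) && (r < fr)) rho -> fr \notin rho.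
Proof. by move=> h; apply/negP => /(allP h); rewrite ltnn andbF. Qed.

Lemma ready_addto L rho vs fr dst st n :
  ready L rho vs fr dst st -> ready L rho vs fr dst (addto st dst n).
Proof.
case=> h1 h2 h3 h4 h5 h6 h7 h8 h9 h10; split=> //.
- by rewrite /addto setst_neq // eq_sym.
- by rewrite /addto setst_neq // eq_sym.
- by rewrite /addto map_setst_notin.
- by move=> r hr; rewrite /addto setst_neq ?h5 // neq_ltn (leq_trans h7) // orbT.
Qed.

Lemma ready_set L rho vs fr dst st l :
  ready L rho vs fr dst st -> ready L rho vs fr.+1 dst (setst st fr l).
Proof.
case=> h1 h2 h3 h4 h5 h6 h7 h8 h9 h10; split=> //.
- by rewrite setst_neq //; lia.
- by rewrite setst_neq //; lia.
- by rewrite map_setst_notin // fresh_notin.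
- by apply: sub_all h4 => r /=; lia.
- by move=> r hr; rewrite setst_neq ?h5 //; lia.
- lia.
- lia.
Qed.

Lemma ready_fresh L rho vs fr dst st :
  ready L rho vs fr dst st -> ready L rho vs fr.+1 fr st.
Proof.
case=> h1 h2 h3 h4 h5 h6 h7 h8 h9 h10; split=> //; try lia.
- by apply: sub_all h4 => r /=; lia.
- by move=> r hr; apply: h5; lia.
- by rewrite fresh_notin.
Qed.

Lemma ready_bind L rho vs fr dst st n :
  ready L rho vs fr dst st ->
  ready L (fr :: rho) (n :: vs) fr.+1 dst (setst st fr (nseq n true)).
Proof.
move=> h; have h4 := rd_rho h; have h7 := rd_dst h; case: (ready_set (nseq n true) h).
move=> g1 g2 g3 g4 g5 g6 g7 g8 g9 g10; split=> //=.
- by rewrite setst_same g3.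
- by rewrite g4 (leq_trans (rd_fr h)) // ltnSn.
- by rewrite inE negb_or g8 neq_ltn h7.
Qed.

Definition computes_with (g : nat -> nat -> seq nat -> cmd)
    (F : seq nat -> seq nat -> nat) (D : nat) :=
  forall M L rho vs fr dst st, 1 < M -> size (enc_nats L) <= M ->
    all (fun v => v <= M) vs -> ready L rho vs fr dst st ->
    F L vs <= M ^ D /\ execle (g dst fr rho) st (addto st dst (F L vs)) (M ^ D).

(* Some stack program adds [F L vs] to a register, in time polynomial in a
   bound on the input list [L] and the environment [vs]. *)
Definition polycomp F := exists g D, computes_with g F D.

(** * Closure properties of the polynomially computable functions *)

Lemma leq_exp2 M a b : 1 < M -> a <= b -> M ^ a <= M ^ b.
Proof. by move=> M1 ab; rewrite leq_exp2l. Qed.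

Lemma const_leq_exp M c : 1 < M -> c <= M ^ c.
Proof. by move=> M1; apply: ltnW; apply: ltn_expl. Qed.

Lemma addto0 st d : addto st d 0 = st.
Proof. by apply: setst_id; rewrite cats0. Qed.

Lemma addto_add st d n m : addto (addto st d n) d m = addto st d (n + m).
Proof.
apply: functional_extensionality => r; rewrite /addto /setst eqxx.
by case: eqP => // _; rewrite nseqD catA.
Qed.

Lemma addto_free (st : store) d n : st d = [::] -> addto st d n = setst st d (nseq n true).
Proof. by rewrite /addto => ->. Qed.

Lemma comp_ext F G : (forall L vs, F L vs = G L vs) -> polycomp F -> polycomp G.
Proof.
move=> e [g [D h]]; exists g, D => M L rho vs fr dst st M1 hL hv hr.
by rewrite -e; apply: h hr.
Qed.

Lemma comp_const n : polycomp (fun _ _ => n).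
Proof.
exists (fun dst _ _ => pushes (nseq n dst)), (2 * n + 1) => M L rho vs fr dst st M1 _ _ _.
split; first by apply: leq_trans (const_leq_exp n M1) _; apply: leq_exp2; lia.
have := pushesP (nseq n dst) st; rewrite size_nseq => e.
have -> : addto st dst n = fun r => st r ++ nseq (count_mem r (nseq n dst)) true.
  apply: functional_extensionality => r; rewrite /addto /setst count_nseq /= [dst == r]eq_sym.
  by case: eqP => [->|_]; rewrite ?mul1n ?mul0n ?cats0.
by apply: execle_le e _; have := const_leq_exp (2 * n).+1 M1; rewrite addn1.
Qed.

Lemma comp_var i : polycomp (fun _ vs => nth 0 vs i).
Proof.
exists (fun dst fr rho => if i < size rho then
  CSeq (moves (nth 0 rho i) [:: fr]) (moves fr [:: nth 0 rho i; dst]) else Skip), 6.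
move=> M L rho vs fr dst st M1 _ hv hr.
have sz : size rho = size vs by rewrite -(size_map st) (rd_env hr) size_map.
case: ltnP => isz; last first.
  rewrite nth_default -?sz // addto0; split=> //.
  by apply: execle_skip; rewrite expn_gt0; lia.
set x := nth 0 rho i; set v := nth 0 vs i.
have vM : v <= M by apply: (allP hv); rewrite mem_nth // -sz.
have xr : x \in rho by rewrite mem_nth.
have /andP[x2 xfr] := allP (rd_rho hr) x xr.
have xd : x != dst by apply: contraNneq (rd_dst_rho hr) => <-.
have xf : x != fr by rewrite neq_ltn xfr.
have df : dst != fr by rewrite neq_ltn (rd_dst hr).
have sx : st x = nseq v true.
  by rewrite -(nth_map _ [::]) // (rd_env hr) (nth_map 0) // -sz.
have M6 : 64 * M <= M ^ 7.
  have h : 2 ^ 6 <= M ^ 6 by rewrite leq_exp2r.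
  by rewrite expnSr leq_mul2r h orbT.
have M6' : 32 * M <= M ^ 6.
  have h : 2 ^ 5 <= M ^ 5 by rewrite leq_exp2r.
  by rewrite (expnSr M 5) leq_mul2r h orbT.
split; first by lia.
have e1 := @movesP x [:: fr] v st sx; rewrite inE in e1.
have e2 := @movesP fr [:: x; dst] v _ _ _; rewrite !inE in e2.
move: (e1 xf) => {}e1.
apply: execle_seq e1 _ _.
- set s1 := (fun r => _).
  have -> : addto st dst v = fun r => if r == fr then [::] else s1 r ++ nseq (v * count_mem r [:: x; dst]) true.
    apply: functional_extensionality => r; rewrite /s1 /addto /setst /=.
    case: (eqVneq r fr) => [->|rf]; first by rewrite eq_sym (negbTE df) (rd_free hr).
    case: (eqVneq r x) => [->|rx].
      by rewrite (negbTE xd) ?(negbTE xf) eq_sym (negbTE xd) ?addn0 muln1 cat0s.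
    case: (eqVneq r dst) => [->|rd].
      by rewrite add0n addn0 muln1 !muln0 cats0.
    by rewrite !muln0 !cats0.
  apply: e2; last by rewrite negb_or eq_sym xf eq_sym df.
  by rewrite /s1 eq_sym (negbTE xf) /= eqxx muln1 (rd_free hr).
- by rewrite /=; lia.
Qed.

Lemma comp_add F G : polycomp F -> polycomp G -> polycomp (fun L vs => F L vs + G L vs).
Proof.
case=> f [D1 h1] [g [D2 h2]].
exists (fun dst fr rho => CSeq (f dst fr rho) (g dst fr rho)), (D1 + D2 + 2).
move=> M L rho vs fr dst st M1 hL hv hr.
have [b1 e1] := h1 _ _ _ _ _ _ _ M1 hL hv hr.
have [b2 e2] := h2 _ _ _ _ _ _ _ M1 hL hv (ready_addto (F L vs) hr).
rewrite addto_add in e2.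
have X1 : M ^ D1 <= M ^ (D1 + D2) by apply: leq_exp2 => //; lia.
have X2 : M ^ D2 <= M ^ (D1 + D2) by apply: leq_exp2 => //; lia.
have X3 : 4 * M ^ (D1 + D2) <= M ^ (D1 + D2 + 2).
  by rewrite (expnD M (D1 + D2)) mulnC leq_mul2l (@leq_exp2r 2 M 2) // M1 orbT.
have X4 : 0 < M ^ (D1 + D2) by rewrite expn_gt0; lia.
by split; [lia | apply: execle_seq e1 e2 _; lia].
Qed.

(** The common form of the cost estimates below: three factors bounded by [M ^ E], and a constant up
    to 1000, absorbed by [M ^ 10] since [2 ^ 10] is 1024. *)
Lemma poly_bound M E : 1 < M ->
  [/\ 0 < M ^ E, M <= M ^ (3 * E + 10), M ^ E <= M ^ (3 * E + 10) &
  forall a b c, a <= M ^ E -> b <= M ^ E -> c <= M ^ E ->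
    1000 * (a * b * c) <= M ^ (3 * E + 10)].
Proof.
move=> M1; split.
- by rewrite expn_gt0; lia.
- by rewrite -{1}(expn1 M); apply: leq_exp2 => //; lia.
- by apply: leq_exp2 => //; lia.
move=> a b c ha hb hc; rewrite expnD (mulnC (M ^ _)).
have -> : M ^ (3 * E) = M ^ E * M ^ E * M ^ E by rewrite !mulSn mul0n addn0 !expnD mulnA.
apply: leq_mul; last by apply: leq_mul => //; apply: leq_mul.
by apply: (@leq_trans (2 ^ 10)) => //; rewrite leq_exp2r.
Qed.

Lemma comp_mul F G : polycomp F -> polycomp G -> polycomp (fun L vs => F L vs * G L vs).
Proof.
case=> f [D1 h1] [g [D2 h2]].
exists (fun dst fr rho => CSeq (f fr fr.+1 rho) (Loop fr Skip (g dst fr.+1 rho))), (3 * (D1 + D2) + 10).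
move=> M L rho vs fr dst st M1 hL hv hr.
have [b1 e1] := h1 _ _ _ _ _ _ _ M1 hL hv (ready_fresh hr).
have h2' k s := h2 M L rho vs fr.+1 dst _ M1 hL hv (ready_set (nseq k true) (ready_addto s hr)).
have [b2 _] := h2' 0 0.
set a := F L vs in b1 e1 *; set b := G L vs in b2 h2' *.
have df : dst != fr by rewrite neq_ltn (rd_dst hr).
have E := @execle_count fr Skip (g dst fr.+1 rho) a
  (fun k => setst (addto st dst (k * b)) fr (nseq (a - k) true)) (M ^ D2).
have [] := poly_bound (D1 + D2) M1.
have X1 : M ^ D1 <= M ^ (D1 + D2) by apply: leq_exp2 => //; lia.
have X2 : M ^ D2 <= M ^ (D1 + D2) by apply: leq_exp2 => //; lia.
set X := M ^ (D1 + D2) => X0 _ _ hX.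
have B1 := hX a b 1 (leq_trans b1 X1) (leq_trans b2 X2) X0.
have B2 := hX X X 1 (leqnn _) (leqnn _) X0.
have B3 : a * (M ^ D2 + 1) <= X * (X + 1) by apply: leq_mul; lia.
split; first by lia.
apply: execle_seq e1 (execle_le _ (leqnn _)) _; last first.
  have B4 := hX X 1 1 (leqnn _) X0 X0.
  have : (a * (M ^ D2 + 1)).+1 + M ^ D1 < M ^ (3 * (D1 + D2) + 10) by nia.
  rewrite addnC; exact.
move: E; rewrite subn0 subnn mul0n addto0 -addto_free ?(rd_free hr) //.
rewrite [setst (addto _ _ _) _ _]setst_id; last by rewrite /addto setst_neq ?(rd_free hr) // eq_sym.
apply=> [k kn|k kn]; last by rewrite setst_same.
have [_ e] := h2' (a - k.+1) (k * b).
suff -> : setst (addto st dst (k.+1 * b)) fr (nseq (a - k.+1) true) = addto (setst (addto st dst (k * b)) fr (nseq (a - k.+1) true)) dst b.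
  move: e; congr execle; apply: functional_extensionality => r; rewrite /setst; by case: eqP.
rewrite mulSn addnC -addto_add; apply: functional_extensionality => r.
rewrite /addto /setst (negbTE df) eqxx; case: (eqVneq r fr) => [->|] //.
by rewrite eq_sym (negbTE df).
Qed.

Lemma setstC (st : store) i j l l' : i != j ->
  setst (setst st i l) j l' = setst (setst st j l') i l.
Proof.
move=> ij; apply: functional_extensionality => r; rewrite /setst.
by case: (eqVneq r i) => [->|//]; rewrite (negbTE ij).
Qed.

Lemma setst_setst (st : store) i l l' : setst (setst st i l) i l' = setst st i l'.
Proof. by apply: functional_extensionality => r; rewrite /setst; case: eqP. Qed.

Lemma addto_setstC (st : store) i l d n : i != d ->
  addto (setst st i l) d n = setst (addto st d n) i l.
Proof. by move=> id; rewrite /addto setst_neq 1?eq_sym // setstC. Qed.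

(** Truncated subtraction is repeated [decr], which fixes 0. Comparisons, and with them all Boolean
    tests, are derived from it. *)
Lemma comp_sub F G : polycomp F -> polycomp G -> polycomp (fun L vs => F L vs - G L vs).
Proof.
case=> f [D1 h1] [g [D2 h2]].
exists (fun dst fr rho => CSeq (f fr fr.+1 rho) (CSeq (g fr.+1 fr.+2 rho)
  (CSeq (Loop fr.+1 Skip (decr fr fr.+2 fr.+3)) (moves fr [:: dst])))), (3 * (D1 + D2) + 10).
move=> M L rho vs fr dst st M1 hL hv hr.
have [b1 e1] := h1 _ _ _ _ _ _ _ M1 hL hv (ready_fresh hr).
have hr1 := ready_set (nseq (F L vs) true) hr.
have [b2 e2] := h2 _ _ _ _ _ _ _ M1 hL hv (ready_fresh hr1).
set a := F L vs in b1 e1 hr1 e2 *; set b := G L vs in b2 e2 *.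
have df : dst != fr by rewrite neq_ltn (rd_dst hr).
have f0 r : fr <= r -> st r = [::] by apply: rd_free hr r.
rewrite addto_free ?f0 // in e1.
rewrite addto_free in e2; last by rewrite setst_neq ?f0 //; lia.
pose A k := setst (setst st fr (nseq (a - k) true)) fr.+1 (nseq (b - k) true).
have E := @execle_count fr.+1 Skip (decr fr fr.+2 fr.+3) b A (30 * a.+1).
have {}E : execle (Loop fr.+1 Skip (decr fr fr.+2 fr.+3)) (A 0) (A b) (b * (30 * a.+1 + 1)).+1.
  apply: E => k kb; last by rewrite /A setst_same.
  set s := setst (A k) _ _.
  have := @decrP fr fr.+2 fr.+3 (a - k) s _ _ _ _ _ _.
  have -> : setst s fr (nseq (a - k).-1 true) = A k.+1.
    rewrite /s /A setst_setst setstC; last by lia.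
    by rewrite setst_setst -subnS.
  move=> h; apply: execle_le (h _ _ _ _ _ _) _; try lia.
  - by rewrite /s /A setst_setst setst_neq ?setst_same //; lia.
  - by rewrite /s /A !setst_neq ?f0 //; lia.
  - by rewrite /s /A !setst_neq ?f0 //; lia.
have e4 := @movesP fr [:: dst] (a - b) (A b) _ _.
have [] := poly_bound (D1 + D2) M1.
have X1 : M ^ D1 <= M ^ (D1 + D2) by apply: leq_exp2 => //; lia.
have X2 : M ^ D2 <= M ^ (D1 + D2) by apply: leq_exp2 => //; lia.
set X := M ^ (D1 + D2) => X0 _ _ hX.
have B1 := hX X 1 1 (leqnn _) X0 X0.
have B2 := hX b a 1 (leq_trans b2 X2) (leq_trans b1 X1) X0.
have B3 := hX X X 1 (leqnn _) (leqnn _) X0.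
have B4 : X <= X * X by rewrite leq_pmulr.
split; first by lia.
rewrite /A !subn0 in E.
apply: execle_seq e1 (execle_seq e2 (execle_seq E (execle_le _ (leqnn _)) (ltnSn _)) (ltnSn _)) _.
- have -> : addto st dst (a - b) =
      fun r => if r == fr then [::] else A b r ++ nseq ((a - b) * count_mem r [:: dst]) true.
    apply: functional_extensionality => r; rewrite /A /addto /setst /= subnn.
    case: (eqVneq r fr) => [->|rf]; first by rewrite eq_sym (negbTE df) f0.
    case: (eqVneq r dst) => [->|rd].
      by rewrite ltn_eqF ?addn0 ?muln1 // ltnW // ltnS (rd_dst hr).
    rewrite addn0 muln0 cats0; case: eqP => // ->; exact: f0.
  apply: e4; last by rewrite inE eq_sym.
  by rewrite /A setst_neq ?setst_same //; lia.
- rewrite /=; nia.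
Qed.

Lemma comp_sum B F : polycomp B -> polycomp F ->
  polycomp (fun L vs => \sum_(i < B L vs) F L (nat_of_ord i :: vs)).
Proof.
case=> gb [D1 h1] [gf [D2 h2]].
exists (fun dst fr rho => CSeq (gb fr fr.+1 rho) (CSeq
   (Loop fr Skip (CSeq (gf dst fr.+2 (fr.+1 :: rho)) (Push fr.+1 true))) (clear fr.+1))),
  (3 * ((D1 + 1) * (D2 + 1)) + 10).
move=> M L rho vs fr dst st M1 hL hv hr.
have [b1 e1] := h1 _ _ _ _ _ _ _ M1 hL hv (ready_fresh hr).
set b := B L vs in b1 e1 *.
have df : dst != fr by rewrite neq_ltn (rd_dst hr).
have df1 : dst != fr.+1 by have := rd_dst hr; lia.
have f0 r : fr <= r -> st r = [::] by apply: rd_free hr r.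
rewrite addto_free ?f0 // in e1.
(* The index is a new variable and may exceed [M], so the body is run with a larger bound; exponents
   thereby multiply. *)
pose M' := M ^ (D1 + 1).
have MM' : M <= M' by rewrite -{1}(expn1 M); apply: leq_exp2 => //; lia.
have M'1 : 1 < M' by apply: leq_trans M1 MM'.
have bM' : b <= M' by apply: leq_trans b1 _; apply: leq_exp2 => //; lia.
pose S k := \sum_(i < k) F L (nat_of_ord i :: vs).
pose s k := setst (addto st dst (S k)) fr (nseq (b - k.+1) true).
have hk k : k < b -> F L (k :: vs) <= M' ^ D2 /\
    execle (gf dst fr.+2 (fr.+1 :: rho)) (setst (s k) fr.+1 (nseq k true))
      (addto (setst (s k) fr.+1 (nseq k true)) dst (F L (k :: vs))) (M' ^ D2).
  move=> kb; apply: h2 M'1 (leq_trans hL MM') _ _.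
    rewrite /= (leq_trans (ltnW kb) bM') /=.
    by apply: sub_all hv => v /= vM; apply: leq_trans vM MM'.
  by apply: ready_bind; apply: ready_set; apply: ready_addto.
pose A k := setst (setst (addto st dst (S k)) fr (nseq (b - k) true)) fr.+1 (nseq k true).
have E : execle (Loop fr Skip (CSeq (gf dst fr.+2 (fr.+1 :: rho)) (Push fr.+1 true)))
    (A 0) (A b) (b * (M' ^ D2 + 2 + 1)).+1.
  apply: execle_count => k kb; last by rewrite /A setst_neq ?setst_same //; lia.
  have [_ e] := hk k kb.
  have -> : setst (A k) fr (nseq (b - k.+1) true) = setst (s k) fr.+1 (nseq k true).
    rewrite /A /s setstC; last by lia.
    by rewrite setst_setst.
  apply: execle_seq e (execle_push (ltn0Sn 0) _) _; last by lia.
  rewrite addto_setstC 1?eq_sym // setst_setst setst_same /s addto_setstC 1?eq_sym //.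
  rewrite addto_add /A; congr (setst (setst (addto st dst _) _ _) _ _).
    by rewrite /S big_ord_recr.
  by rewrite -cats1 -(nseqD k 1) addn1.
have E0 : A 0 = setst st fr (nseq b true).
  rewrite /A /S big_ord0 addto0 subn0 [LHS]setst_id //.
  by rewrite setst_neq ?f0 //; lia.
have e3 := @clearP fr.+1 b (A b) (setst_same _ _ _).
have E1 : setst (A b) fr.+1 [::] = addto st dst (S b).
  have g r : fr <= r -> addto st dst (S b) r = [::].
    by move=> h; rewrite /addto setst_neq ?f0 //; have := rd_dst hr; lia.
  by rewrite /A subnn setst_setst (setst_id (g _ (leqnn _))) setst_id // g.
have Sb : S b <= b * M' ^ D2.
  rewrite /S -[b in b * _]card_ord -sum_nat_const; apply: leq_sum => i _.
  by have [] := hk i (ltn_ord i).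
have [] := poly_bound ((D1 + 1) * (D2 + 1)) M1.
have X1 : M ^ D1 <= M ^ ((D1 + 1) * (D2 + 1)) by apply: leq_exp2 => //; nia.
have X2 : M' ^ D2 <= M ^ ((D1 + 1) * (D2 + 1)) by rewrite /M' -expnM; apply: leq_exp2 => //; nia.
set X := M ^ ((D1 + 1) * (D2 + 1)) => X0 _ _ hX.
have B1 := hX b (M' ^ D2) 1 (leq_trans b1 X1) X2 X0.
have B2 := hX X X 1 (leqnn _) (leqnn _) X0.
have B4 : X <= X * X by rewrite leq_pmulr.
have B5 : b <= X by apply: leq_trans b1 X1.
split; first by rewrite -/(S b); lia.
rewrite E1 in e3; rewrite E0 in E.
apply: execle_seq e1 (execle_seq E e3 (ltnSn _)) _; nia.
Qed.

(* The cap [C] keeps the iterates polynomially bounded. *)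
Lemma comp_iter N C I B : polycomp N -> polycomp C -> polycomp I -> polycomp B ->
  polycomp (fun L vs =>
    iter (N L vs) (fun a => minn (B L (a :: C L vs :: vs)) (C L vs)) (I L vs)).
Proof.
case=> gn [D1 h1] [gc [D2 h2]] [gi [D3 h3]] cB.
(* The minimum of [b] and [c] is [b - (b - c)]; variable 1 is the cap. *)
have [gb [D4 h4]] := comp_sub cB (comp_sub cB (comp_var 1)).
exists (fun dst fr rho => CSeq (gn fr fr.+1 rho) (CSeq (gc fr.+1 fr.+2 rho)
  (CSeq (gi fr.+2 fr.+3 rho) (CSeq
   (Loop fr Skip (CSeq (gb fr.+3 fr.+4 (fr.+2 :: fr.+1 :: rho))
     (CSeq (clear fr.+2) (moves fr.+3 [:: fr.+2]))))
   (CSeq (moves fr.+2 [:: dst]) (clear fr.+1)))))),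
  (3 * ((D1 + D2 + D3 + 1) * (D4 + 1)) + 10).
move=> M L rho vs fr dst st M1 hL hv hr.
have [b1 e1] := h1 _ _ _ _ _ _ _ M1 hL hv (ready_fresh hr).
have hr1 := ready_set (nseq (N L vs) true) hr.
have [b2 e2] := h2 _ _ _ _ _ _ _ M1 hL hv (ready_fresh hr1).
have hr2 := ready_set (nseq (C L vs) true) hr1.
have [b3 e3] := h3 _ _ _ _ _ _ _ M1 hL hv (ready_fresh hr2).
set n := N L vs in b1 e1 hr1 e2 hr2 e3 *; set c := C L vs in b2 e2 hr2 e3 *.
set i0 := I L vs in b3 e3 *.
have df : dst < fr := rd_dst hr.
have f0 r : fr <= r -> st r = [::] by apply: rd_free hr r.
rewrite addto_free ?f0 // in e1.
rewrite addto_free in e2; last by rewrite setst_neq ?f0 //; lia.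
rewrite addto_free in e3; last by rewrite !setst_neq ?f0 //; lia.
pose acc k := iter k (fun a => minn (B L (a :: c :: vs)) c) i0.
pose M' := M ^ (D1 + D2 + D3 + 1).
have MM' : M <= M' by rewrite -{1}(expn1 M); apply: leq_exp2 => //; lia.
have M'1 : 1 < M' by apply: leq_trans M1 MM'.
have cM' : c <= M' by apply: leq_trans b2 _; apply: leq_exp2 => //; lia.
have aM' k : acc k <= M'.
  case: k => [|k]; last by rewrite /acc iterS; apply: leq_trans (geq_minr _ _) cM'.
  by apply: leq_trans b3 _; apply: leq_exp2 => //; lia.
pose s k := setst (setst st fr (nseq (n - k) true)) fr.+1 (nseq c true).
pose A k := setst (s k) fr.+2 (nseq (acc k) true).
have hb k : execle (gb fr.+3 fr.+4 [:: fr.+2, fr.+1 & rho]) (A k)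
    (setst (A k) fr.+3 (nseq (acc k.+1) true)) (M' ^ D4) /\ acc k.+1 <= M' ^ D4.
  have hr3 : ready L (fr.+1 :: rho) (c :: vs) fr.+2 dst (s k).
    exact: ready_bind (ready_set _ hr).
  have hr4 := ready_fresh (ready_bind (acc k) hr3).
  have hv' : all (fun v => v <= M') [:: acc k, c & vs].
    by rewrite /= aM' cM' /=; apply: sub_all hv => v /= vM; apply: leq_trans vM MM'.
  have [b e] := h4 _ _ _ _ _ _ _ M'1 (leq_trans hL MM') hv' hr4.
  have E : acc k.+1 = B L [:: acc k, c & vs] - (B L [:: acc k, c & vs] - c).
    by rewrite /acc iterS; lia.
  rewrite /= -E in b e; split=> //.
  rewrite addto_free // in e.
  by rewrite /A /s !setst_neq ?f0 //; lia.
have E : execle (Loop fr Skip (CSeq (gb fr.+3 fr.+4 (fr.+2 :: fr.+1 :: rho))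
     (CSeq (clear fr.+2) (moves fr.+3 [:: fr.+2])))) (A 0) (A n) (n * (M' ^ D4 + 2 * M' + 4 * M' ^ D4 + 5 + 1)).+1.
  apply: execle_count => k kn; last by rewrite /A /s setst_neq 1?setst_neq ?setst_same //; lia.
  have [e b] := hb k.+1.
  have -> : setst (A k) fr (nseq (n - k.+1) true) = setst (s k.+1) fr.+2 (nseq (acc k) true).
    rewrite /A /s setstC; last by lia.
    by rewrite (@setstC (setst _ _ _) fr.+1) ?setst_setst //; lia.
  have [e' b'] := hb k; have e5 := @clearP fr.+2 (acc k) (setst (setst (s k.+1) fr.+2 (nseq (acc k) true)) fr.+3 (nseq (acc k.+1) true)) _.
  have hr3 : ready L (fr.+1 :: rho) (c :: vs) fr.+2 dst (s k.+1).
    exact: ready_bind (ready_set _ hr).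
  have hr4 := ready_fresh (ready_bind (acc k) hr3).
  have hv' : all (fun v => v <= M') [:: acc k, c & vs].
    by rewrite /= aM' cM' /=; apply: sub_all hv => v /= vM; apply: leq_trans vM MM'.
  have [_ e6] := h4 _ _ _ _ _ _ _ M'1 (leq_trans hL MM') hv' hr4.
  have E : acc k.+1 = B L [:: acc k, c & vs] - (B L [:: acc k, c & vs] - c).
    by rewrite /acc iterS; lia.
  rewrite /= -E addto_free in e6; last by rewrite /s !setst_neq ?f0 //; lia.
  set s2 := setst (setst (s k.+1) fr.+2 _) fr.+3 _ in e5 e6.
  have e7 := @movesP fr.+3 [:: fr.+2] (acc k.+1) (setst s2 fr.+2 [::]) _ _.
  have E7 : (fun r => if r == fr.+3 then [::] else setst s2 fr.+2 [::] r ++ nseq (acc k.+1 * count_mem r [:: fr.+2]) true) = A k.+1.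
    apply: functional_extensionality => r; rewrite /A /s2 /s /setst /= addn0 [fr.+2 == r]eq_sym.
    case: (eqVneq r fr.+3) => [->|_].
      by rewrite !gtn_eqF ?f0 //; lia.
    by case: (eqVneq r fr.+2) => _; rewrite ?muln1 ?muln0 ?cats0.
  rewrite E7 in e7.
  apply: execle_seq e6 (execle_seq (e5 _) (e7 _ _) (ltnSn _)) _.
  - by rewrite /s2 setst_neq ?setst_same //; lia.
  - by rewrite /s2 setst_neq ?setst_same //; lia.
  - by rewrite inE; lia.
  - by have := aM' k; rewrite /=; lia.
have e8 := @movesP fr.+2 [:: dst] (acc n) (A n) (setst_same _ _ _) _.
have E8 : (fun r => if r == fr.+2 then [::] else A n r ++ nseq (acc n * count_mem r [:: dst]) true) = setst (addto st dst (acc n)) fr.+1 (nseq c true).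
  apply: functional_extensionality => r; rewrite /A /s subnn /addto /setst /= addn0 [dst == r]eq_sym.
  case: (eqVneq r fr.+2) => [->|_].
    by rewrite !gtn_eqF ?f0 //; lia.
  case: (eqVneq r fr.+1) => [->|_].
    by rewrite gtn_eqF ?muln0 ?cats0 //; lia.
  case: (eqVneq r dst) => [->|_].
    by rewrite ltn_eqF ?muln1.
  by rewrite muln0 cats0; case: eqP => // ->; rewrite f0.
rewrite E8 in e8.
have e9 := @clearP fr.+1 c _ (setst_same (addto st dst (acc n)) _ _).
rewrite setst_setst (@setst_id _ fr.+1 [::]) in e9; last first.
  by rewrite /addto setst_neq ?f0 //; lia.
have [] := poly_bound ((D1 + D2 + D3 + 1) * (D4 + 1)) M1.
have X1 : M' <= M ^ ((D1 + D2 + D3 + 1) * (D4 + 1)) by apply: leq_exp2 => //; nia.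
have X2 : M' ^ D4 <= M ^ ((D1 + D2 + D3 + 1) * (D4 + 1)).
  by rewrite /M' -expnM; apply: leq_exp2 => //; nia.
set X := M ^ ((D1 + D2 + D3 + 1) * (D4 + 1)) => X0 _ X3 hX.
have B1 := hX X X 1 (leqnn _) (leqnn _) X0.
have B4 : X <= X * X by rewrite leq_pmulr.
have nM' : n <= M' by apply: leq_trans b1 _; apply: leq_exp2 => //; lia.
have t1 : M ^ D1 <= X by apply: leq_trans X1; apply: leq_exp2 => //; lia.
have t2 : M ^ D2 <= X by apply: leq_trans X1; apply: leq_exp2 => //; lia.
have t3 : M ^ D3 <= X by apply: leq_trans X1; apply: leq_exp2 => //; lia.
split; first by apply: leq_trans (aM' n) (leq_trans X1 X3).
have A0 : A 0 = setst (setst (setst st fr (nseq n true)) fr.+1 (nseq c true)) fr.+2 (nseq i0 true).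
  by rewrite /A /s subn0.
rewrite A0 in E.
have T : n * (M' ^ D4 + 2 * M' + 4 * M' ^ D4 + 5 + 1) <= X * (13 * X) by apply: leq_mul; lia.
have an := aM' n.
apply: execle_seq e1 (execle_seq e2 (execle_seq e3 (execle_seq E (execle_seq (e8 _) e9 (ltnSn _)) (ltnSn _)) (ltnSn _)) (ltnSn _)) _.
  by rewrite inE; lia.
rewrite /=; lia.
Qed.

(** In a sequence of blocks of ones, each closed by a zero, the ones before the [c]-th zero add up
    to the first [c] numbers. A single destructive pass thus yields prefix sums, and random access
    to the input is a difference of two of them. *)
Fixpoint ones_before (c : nat) (s : seq bool) : nat :=
  match s with
  | [::] => 0
  | b :: s' => if b then (0 < c) + ones_before c s' else ones_before c.-1 s'
  end.

Lemma ones_before_nats c L : ones_before c (enc_nats L) = sumn (take c L).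
Proof.
elim: L c => [|k L IH] c //=.
have -> : forall s, ones_before c (nseq k true ++ false :: s) = (0 < c) * k + ones_before c.-1 s.
  move=> s; elim: k => [|k IHk] /=; first by rewrite muln0.
  by rewrite IHk mulnS addnA.
by rewrite IH; case: c => [|c] /=; rewrite ?take0 // mul1n.
Qed.

(** That [c] is positive shows only while it is drained: each unit is saved in [a] and resets the
    flag [b] to a single 1, which finally goes to [d]. *)
Definition incr_if_pos c d a b := CSeq
  (Loop c Skip (CSeq (Push a true) (CSeq (clear b) (Push b true))))
  (CSeq (moves a [:: c]) (moves b [:: d])).

Lemma incr_if_posP c d a b n st : st c = nseq n true -> st a = [::] -> st b = [::] ->
  c != d -> c != a -> c != b -> d != a -> d != b -> a != b ->
  execle (incr_if_pos c d a b) st (addto st d (0 < n)) (30 * n.+1).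
Proof.
move=> ec ea eb cd ca cb da db ab.
have ac : a != c by rewrite eq_sym.
have bc : b != c by rewrite eq_sym.
have ba : b != a by rewrite eq_sym.
pose A k := setst (setst (setst st c (nseq (n - k) true)) a (nseq k true)) b (nseq (0 < k) true).
have E : execle (Loop c Skip (CSeq (Push a true) (CSeq (clear b) (Push b true)))) (A 0) (A n) (n * (9 + 1)).+1.
  apply: execle_count => k kn; last by rewrite /A setst_neq 1?setst_neq ?setst_same.
  set s := setst (A k) _ _.
  have e1 := execle_push (i := a) (b := true) (st := s) (ltn0Sn 0) erefl.
  have e2 := @clearP b (0 < k) (setst s a (rcons (s a) true)) _.
  apply: execle_seq e1 (execle_seq (e2 _) (execle_push (ltn0Sn 0) _) (ltnSn _)) _.
  - by rewrite /s /A setst_neq 1?setst_neq ?setst_same.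
  - apply: functional_extensionality => r; rewrite /s /A /setst.
    case: (eqVneq r b) => _; first by rewrite ?eqxx.
    rewrite (negbTE ab) (negbTE ac) eqxx.
    case: (eqVneq r a) => _; first by rewrite -cats1 -(nseqD k 1) addn1.
    by case: (eqVneq r c).
  - by case: (0 < k).
have E0 : A 0 = st.
  rewrite /A subn0 setst_id; last by rewrite !setst_neq.
  by rewrite setst_id ?setst_neq // setst_id.
rewrite E0 in E.
have e2 := @movesP a [:: c] n (A n) _ _.
have E2 : (fun r => if r == a then [::] else A n r ++ nseq (n * count_mem r [:: c]) true) = setst st b (nseq (0 < n) true).
  apply: functional_extensionality => r; rewrite /A subnn /setst /= addn0 [c == r]eq_sym.
  case: (eqVneq r a) => [->|_]; first by rewrite (negbTE ab).
  case: (eqVneq r b) => [->|_]; first by rewrite (negbTE bc) muln0 cats0.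
  by case: (eqVneq r c) => [->|_]; rewrite ?ec ?muln1 ?muln0 ?cats0.
rewrite E2 in e2.
have e3 := @movesP b [:: d] (0 < n) _ (setst_same st _ _) _.
have E3 : (fun r => if r == b then [::] else setst st b (nseq (0 < n) true) r ++ nseq ((0 < n) * count_mem r [:: d]) true) = addto st d (0 < n).
  apply: functional_extensionality => r; rewrite /addto /setst /= addn0 [d == r]eq_sym.
  case: (eqVneq r b) => [->|_]; first by rewrite eq_sym (negbTE db).
  by case: (eqVneq r d) => [->|_]; rewrite ?muln1 ?muln0 ?cats0.
rewrite E3 in e3.
apply: execle_seq E (execle_seq (e2 _ _) (e3 _) (ltnSn _)) _.
- by rewrite /A setst_neq ?setst_same.
- by rewrite inE.
- by rewrite inE eq_sym.
- by rewrite /=; case: (0 < n); lia.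
Qed.

Definition scan c d a b :=
  Loop 1 (CSeq (Push 2 false) (decr c a b)) (CSeq (Push 2 true) (incr_if_pos c d a b)).

Lemma scanP c d a b n s st : st 1 = rev s -> st c = nseq n true -> st a = [::] -> st b = [::] ->
  uniq [:: 1; 2; c; d; a; b] ->
  execle (scan c d a b) st
    (addto (setst (setst (setst st 1 [::]) 2 (st 2 ++ s)) c (nseq (n - count negb s) true))
       d (ones_before n s)) (size s * (30 * n + 33)).+1.
Proof.
move=> e1 ec ea eb; rewrite /= !inE !negb_or -!andbA.
move=> /and5P[n12 n1c n1d n1a /and5P[n1b n2c n2d n2a /and5P[n2b ncd nca ncb /and4P[nda ndb nab _]]]].
elim: s n st e1 ec ea eb => [|x s IH] n st e1 ec ea eb.
  rewrite /= addto0 subn0 cats0 (setst_id e1).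
  by rewrite (setst_id (erefl (st 2))) (setst_id ec); exists 1 => //; apply: ELoopE.
pose n' := if x then n else n.-1.
pose st' := addto (setst (setst (setst st 1 (rev s)) 2 (rcons (st 2) x)) c (nseq n' true)) d (if x then nat_of_bool (0 < n) else 0).
have nn' : n' <= n by rewrite /n'; case: x {st'} n' e1; lia.
have eb' : execle (if x then CSeq (Push 2 true) (incr_if_pos c d a b) else CSeq (Push 2 false) (decr c a b))
    (setst st 1 (rev s)) st' (30 * n + 32).
  have p : execle (Push 2 x) (setst st 1 (rev s)) (setst (setst st 1 (rev s)) 2 (rcons (st 2) x)) 1.
    by apply: execle_push => //; rewrite (setst_neq _ _ (i := 1)) // eq_sym.
  have hc : setst (setst st 1 (rev s)) 2 (rcons (st 2) x) c = nseq n true.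
    by rewrite !setst_neq // eq_sym.
  have ha : setst (setst st 1 (rev s)) 2 (rcons (st 2) x) a = [::].
    by rewrite !setst_neq // eq_sym.
  have hb : setst (setst st 1 (rev s)) 2 (rcons (st 2) x) b = [::].
    by rewrite !setst_neq // eq_sym.
  rewrite /st' /n'; case: x p hc ha hb {st' e1 n' nn'} => p hc ha hb.
    have := incr_if_posP hc ha hb ncd nca ncb nda ndb nab.
    by rewrite [setst _ c _]setst_id // => q; apply: execle_seq p q _; lia.
  have := decrP hc ha hb nca ncb nab; rewrite addto0.
  by move=> q; apply: execle_seq p q _; lia.
have [] := IH n' st'.
- by rewrite /st' /addto setst_neq 1?setst_neq 1?setst_neq ?setst_same.
- by rewrite /st' /addto setst_neq ?setst_same.
- by rewrite /st' /addto !setst_neq // eq_sym.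
- by rewrite /st' /addto !setst_neq // eq_sym.
move=> t2 e2 l2; case: eb' => t1 e3 l3.
set fin := addto _ _ _ in e2; set fin' := addto _ _ _.
have -> : fin' = fin.
  rewrite /fin /fin' /st'; apply: functional_extensionality => r.
  rewrite /addto /setst; rewrite !(eq_sym d) (negbTE ncd) (negbTE n1d) (negbTE n2d) !eqxx.
  rewrite ?(negbTE n2c) ?(negbTE n2d).
  case: (eqVneq r d) => [_|_].
    rewrite -catA -nseqD; congr (_ ++ nseq _ _).
    by rewrite /n'; case: (x).
  case: (eqVneq r c) => [_|_]; first by congr nseq; rewrite /n'; case: (x) => /=; lia.
  case: (eqVneq r 2) => [_|_]; first by rewrite cat_rcons.
  by case: (eqVneq r 1).
exists (t1 + t2 + 1).
  apply: ELoopS e2; first by rewrite e1 rev_cons.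
  by move: e3; case: (x).
have : size s * (30 * n' + 33) <= size s * (30 * n + 33) by rewrite leq_mul2l; lia.
rewrite /=; lia.
Qed.

Lemma comp_prefix_sum E : polycomp E -> polycomp (fun L vs => sumn (take (E L vs) L)).
Proof.
case=> g [D h].
exists (fun dst fr rho => CSeq (g fr fr.+1 rho) (CSeq (scan fr dst fr.+1 fr.+2)
  (CSeq (Loop 2 (Push 1 false) (Push 1 true)) (clear fr)))), (3 * (D + 1) + 10).
move=> M L rho vs fr dst st M1 hL hv hr.
have [b1 e1] := h _ _ _ _ _ _ _ M1 hL hv (ready_fresh hr).
set n := E L vs in b1 e1 *; rewrite -ones_before_nats.
have df : dst < fr := rd_dst hr.
have fr2 := rd_fr hr; have d1 := rd_dst1 hr; have d2 := rd_dst2 hr.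
have f0 r : fr <= r -> st r = [::] by apply: rd_free hr r.
rewrite addto_free ?f0 // in e1.
have := @scanP fr dst fr.+1 fr.+2 n (enc_nats L) (setst st fr (nseq n true)) _ (setst_same _ _ _) _ _ _.
set s := enc_nats L in hL *.
set st2 := addto _ _ _ => e2.
set m := n - count negb s in st2 e2.
pose A k := setst (setst st2 1 (rev (drop (size s - k) s))) 2 (take (size s - k) s).
have d1' : (1 == dst) = false by rewrite eq_sym; apply/negbTE.
have d2' : (2 == dst) = false by rewrite eq_sym; apply/negbTE.
have f1' : (1 == fr) = false by lia.
have f2' : (2 == fr) = false by lia.
have s21 : st2 1 = rev [::] by rewrite /st2 /addto /setst d1' f1'.
have s22 : st2 2 = s by rewrite /st2 /addto /setst d2' f2' /= (rd_tmp hr).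
have A0 : A 0 = st2 by rewrite /A subn0 drop_size take_size (setst_id s21) (setst_id s22).
have e3 : execle (Loop 2 (Push 1 false) (Push 1 true)) (A 0) (A (size s)) (size s * (1 + 1)).+1.
  have := @execle_loop 2 (Push 1 false) (Push 1 true) (rev s) A 1.
  rewrite size_rev; apply.
  - by rewrite revK /A setst_same subn0 take_size.
  - move=> k ks; rewrite nth_rev // drop_rev revK.
    have E3 : A k.+1 = setst (setst (A k) 2 (take (size s - k.+1) s)) 1
        (rcons (setst (A k) 2 (take (size s - k.+1) s) 1) (nth false s (size s - k.+1))).
      rewrite /A !setst_setst; apply: functional_extensionality => r; rewrite /setst /=.
      case: (eqVneq r 2) => [->|r2] //; case: (eqVneq r 1) => [_|//].
      by rewrite -rev_cons (@drop_nth _ false (size s - k.+1)); [congr (rev (_ :: drop _ _)) |]; lia.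
    by case: (nth _ _ _) E3 => E3; apply: execle_push.
  - by move=> k ks; rewrite /A setst_same drop_rev revK.
have E4 : A (size s) = setst (addto st dst (ones_before n s)) fr (nseq m true).
  rewrite /A subnn drop0 take0; apply: functional_extensionality => r.
  rewrite /st2 /addto /setst (ltn_eqF df) (negbTE d1) (negbTE d2).
  case: (eqVneq r fr) => [->|rf].
    by rewrite gtn_eqF // gtn_eqF ?(gtn_eqF df) //; lia.
  case: (eqVneq r dst) => [->|rd]; first by rewrite (negbTE d1) (negbTE d2).
  case: (eqVneq r 2) => [->|r2]; first by rewrite (rd_tmp hr).
  by case: (eqVneq r 1) => [->|//]; rewrite (rd_in hr).
rewrite A0 E4 in e3.
have e5 := @clearP fr m _ (setst_same (addto st dst (ones_before n s)) _ _).
rewrite setst_setst (@setst_id _ fr [::]) in e5; last by rewrite /addto setst_neq ?f0 //; lia.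
have os : ones_before n s <= size s.
  elim: (s) (n) => [|x s' IH] n' //=; case: x; first by have := IH n'; case: (0 < n'); lia.
  by have := IH n'.-1; lia.
have mn : m <= n by rewrite /m; lia.
have [] := poly_bound (D + 1) M1.
have X1 : M ^ D <= M ^ (D + 1) by apply: leq_exp2 => //; lia.
have X2 : M <= M ^ (D + 1) by rewrite -{1}(expn1 M); apply: leq_exp2 => //; lia.
set X := M ^ (D + 1) => X0 Y _ hX.
have B1 := hX X X 1 (leqnn _) (leqnn _) X0.
have B4 : X <= X * X by rewrite leq_pmulr.
have B5 : size s * (30 * n + 33) <= X * (63 * X) by apply: leq_mul; lia.
split; first by apply: leq_trans os (leq_trans hL Y).
apply: execle_seq e1 (execle_seq (e2 _ _ _ _) (execle_seq e3 e5 (ltnSn _)) (ltnSn _)) _.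
- by rewrite setst_neq ?(rd_in hr) ?f1' .
- by rewrite setst_neq ?f0 //; lia.
- by rewrite setst_neq ?f0 //; lia.
- by rewrite /= !inE; lia.
- lia.
Qed.

(** * The game of a system of linear constraints *)

(* Vertices: 0 = root, 1, 2, 3 = gadget, [4 + h] = hub [h], [4 + H + h] = its anchor, then
   the free vertices.  Vertex 1 chases 3, which avoids it, so it insists on being with 2,
   away from everyone else.  The pair {1, 2} then offers utility 2 to each anchor, whose
   only other friends are the root and its hub, and utility 1 to each hub. *)
Definition game_weight (H : nat) (b : nat -> bool) (a : nat -> nat -> int) (u v : nat) : int :=
  if u == 1 then (if (v == 2) || (v == 3) then 1%R else (-1)%R)
  else if u == 3 then (if v == 1 then (-1)%R else 0%R)
  else if u < 4 then 0%R
  else if u < 4 + H then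
    (if v == 0 then Posz (b (u - 4)) else if v == 1 then 1%R
     else if v < 4 + 2 * H then 0%R else a (u - 4) (v - (4 + 2 * H)))
  else if u < 4 + 2 * H then (if (v < 3) || (v == u - H) then 1%R else 0%R)
  else 0%R.

Lemma game_weight_hub H b a h v : h < H -> game_weight H b a (4 + h) v =
  if v == 0 then Posz (b h) else if v == 1 then 1%R
  else if v < 4 + 2 * H then 0%R else a h (v - (4 + 2 * H)).
Proof.
move=> hH; rewrite /game_weight addKn.
rewrite (_ : (4 + h == 1) = false) 1?(_ : (4 + h == 3) = false); try by lia.
by rewrite (_ : (4 + h < 4) = false) 1?(_ : (4 + h < 4 + H)); try lia.
Qed.

Lemma game_weight_anchor H b a h v : h < H -> game_weight H b a (4 + H + h) v =
  if (v < 3) || (v == 4 + h) then 1%R else 0%R.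
Proof.
move=> hH; rewrite /game_weight.
rewrite (_ : (4 + H + h == 1) = false) 1?(_ : (4 + H + h == 3) = false); try by lia.
rewrite (_ : (4 + H + h < 4) = false) 1?(_ : (4 + H + h < 4 + H) = false); try by lia.
by rewrite (_ : 4 + H + h < 4 + 2 * H) 1?(_ : 4 + H + h - H = 4 + h) //; lia.
Qed.

Lemma game_weight_free H b a x v : game_weight H b a (4 + 2 * H + x) v = 0%R.
Proof.
rewrite /game_weight; set u := 4 + 2 * H + x.
rewrite (_ : (u == 1) = false) 1?(_ : (u == 3) = false); try by rewrite /u; lia.
rewrite (_ : (u < 4) = false) 1?(_ : (u < 4 + H) = false); try by rewrite /u; lia.
by rewrite (_ : (u < 4 + 2 * H) = false) // /u; lia.
Qed.

Section Game.
Variables (H F : nat) (b : nat -> bool) (a : nat -> nat -> int).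
Hypothesis a_le1 : forall h x, (a h x <= 1)%R.
Let n := 4 + 2 * H + F.
Let nE : n = 4 + 2 * H + F. Proof. by []. Qed.
Let w (i j : 'I_n) : int := game_weight H b a i j.

Let ltn0 : 0 < n. Proof. by rewrite /n; lia. Qed.
Let ltn1 : 1 < n. Proof. by rewrite /n; lia. Qed.
Let ltn2 : 2 < n. Proof. by rewrite /n; lia. Qed.
Let ltn3 : 3 < n. Proof. by rewrite /n; lia. Qed.
Let r : 'I_n := Ordinal ltn0.
Let d1 : 'I_n := Ordinal ltn1.
Let d2 : 'I_n := Ordinal ltn2.
Let e : 'I_n := Ordinal ltn3.
Let hub_lt (h : 'I_H) : 4 + h < n. Proof. by rewrite /n; case: h => h /=; lia. Qed.
Let anchor_lt (h : 'I_H) : 4 + H + h < n. Proof. by rewrite /n; case: h => h /=; lia. Qed.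
Let free_lt (x : 'I_F) : 4 + 2 * H + x < n. Proof. by rewrite /n; case: x => x /=; lia. Qed.
Let hub h : 'I_n := Ordinal (hub_lt h).
Let anchor h : 'I_n := Ordinal (anchor_lt h).
Let free x : 'I_n := Ordinal (free_lt x).

Variant vertex_spec (u : 'I_n) : Type :=
| IsRoot of u = r | IsD1 of u = d1 | IsD2 of u = d2 | IsE of u = e
| IsHub h of u = hub h | IsAnchor h of u = anchor h | IsFree x of u = free x.

Lemma vertexP u : vertex_spec u.
Proof.
case: (ltnP u 4) => [|u4].
  case: u => -[|[|[|[|u]]]] lu //= _.
  - by apply: IsRoot; apply: val_inj.
  - by apply: IsD1; apply: val_inj.
  - by apply: IsD2; apply: val_inj.
  - by apply: IsE; apply: val_inj.
case: (ltnP u (4 + H)) => [uH|uH].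
  have h : u - 4 < H by lia.
  by apply: (@IsHub u (Ordinal h)); apply: val_inj => /=; lia.
case: (ltnP u (4 + 2 * H)) => [uH2|uH2].
  have h : u - (4 + H) < H by lia.
  by apply: (@IsAnchor u (Ordinal h)); apply: val_inj => /=; lia.
have h : u - (4 + 2 * H) < F by have := ltn_ord u; have := nE; lia.
by apply: (@IsFree u (Ordinal h)); apply: val_inj => /=; lia.
Qed.

Lemma sum_delta (S : {set 'I_n}) v o :
  (\sum_(u in S | u != v) Posz (u == o) = Posz ((o \in S) && (o != v)))%R.
Proof.
case: (boolP ((o \in S) && (o != v))) => ho.
  rewrite (bigD1 o) //= eqxx big1 ?addr0 // => u /andP[_ /negbTE ->] //.
rewrite big1 // => u hu; case: eqP => // uo; by rewrite -uo hu in ho.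
Qed.

Lemma util_anchor h S : utility w (anchor h) S =
  (Posz (r \in S) + Posz (d1 \in S) + Posz (d2 \in S) + Posz (hub h \in S))%R.
Proof.
have E o : o != anchor h -> Posz (o \in S) = Posz ((o \in S) && (o != anchor h)).
  by move=> ->; rewrite andbT.
rewrite !E; try by apply/eqP => /(congr1 val) /=; have := ltn_ord h; lia.
rewrite -!sum_delta -!big_split /utility; apply: eq_bigr => u _ /=.
rewrite /w /= game_weight_anchor // -!val_eqE /=; case: h {E} => h lh /=.
by case: ifP; lia.
Qed.

Lemma util_hub h S : utility w (hub h) S =
  (Posz (b h && (r \in S)) + Posz (d1 \in S) + \sum_(x < F) a h x *+ (free x \in S))%R.
Proof.
have E o : o != hub h -> Posz (o \in S) = Posz ((o \in S) && (o != hub h)).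
  by move=> ->; rewrite andbT.
have rE : (Posz (b h && (r \in S)) = \sum_(u in S | u != hub h) Posz (u == r) * Posz (b h))%R.
  rewrite -mulr_suml sum_delta -E; last by apply/eqP => /(congr1 val) /=; lia.
  by case: (b h); case: (r \in S).
have sE : (\sum_(x < F) a h x *+ (free x \in S) =
   \sum_(u in S | u != hub h) (if (4 + 2 * H <= u)%N then a h (u - (4 + 2 * H))%N else 0))%R.
  rewrite [RHS]big_mkcond (@big_split_ord _ _ _ (4 + 2 * H) F) /= [X in (X + _)%R]big1 ?add0r => [|u _].
    apply: eq_bigr => x _; rewrite (_ : rshift _ x = free x); last exact: val_inj.
    rewrite leq_addr addKn (_ : free x != hub h) ?andbT; first by case: ifP.
    by apply/eqP => /(congr1 val) /=; have := ltn_ord h; lia.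
  by rewrite leqNgt ltn_ord if_same.
rewrite rE sE E; last by apply/eqP => /(congr1 val) /=; lia.
rewrite -sum_delta -!big_split /utility; apply: eq_bigr => u /andP[_ uh] /=.
rewrite /w /= game_weight_hub // -!val_eqE /=; clear E rE sE; case: h uh => h lh /= uh.
case: (eqVneq (u : nat) 0) => [->|u0] /=; first by lia.
case: (eqVneq (u : nat) 1) => [->|u1] /=; first by lia.
rewrite ltnNge; case: (leqP (4 + 2 * H) u) => _ /=; lia.
Qed.

Lemma util_e S : utility w e S = (- Posz (d1 \in S))%R.
Proof.
have -> : d1 \in S = (d1 \in S) && (d1 != e) by rewrite andbT.
rewrite -sum_delta -sumrN /utility; apply: eq_bigr => u _.
by rewrite /w /game_weight /= -val_eqE /=; case: eqP.
Qed.

Lemma util_d1 S : (utility w d1 S <= Posz (d2 \in S) + Posz (e \in S))%R.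
Proof.
have E o : o != d1 -> Posz (o \in S) = Posz ((o \in S) && (o != d1)).
  by move=> ->; rewrite andbT.
rewrite !E // -!sum_delta -big_split /utility; apply: ler_sum => u _ /=.
by rewrite /w /game_weight /= -!val_eqE /=; do 2 case: eqP.
Qed.

Lemma util_d1_lt (S : {set 'I_n}) x : x \in S -> x != d1 -> x != d2 -> x != e ->
  (utility w d1 S < Posz (d2 \in S) + Posz (e \in S))%R.
Proof.
move=> xS x1 x2 x3.
have E o : o != d1 -> Posz (o \in S) = Posz ((o \in S) && (o != d1)).
  by move=> ->; rewrite andbT.
rewrite !E // -!sum_delta -big_split /utility.
rewrite (bigD1 x) ?xS //= [X in (_ < X)%R](bigD1 x) ?xS //=.
apply: ltr_leD.
  rewrite /w /game_weight /= (negbTE x2) (negbTE x3).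
  by rewrite ifF //; move: x2 x3; rewrite -!val_eqE /= => /negbTE -> /negbTE ->.
apply: ler_sum => u _ /=.
by rewrite /w /game_weight /= -!val_eqE /=; do 2 case: eqP.
Qed.

Lemma util_passive v S : v = r \/ v = d2 \/ (exists x, v = free x) -> utility w v S = 0%R.
Proof.
move=> hv; rewrite /utility big1 // => u _.
by case: hv => [->|[->|[x ->]]]; rewrite /w //= game_weight_free.
Qed.

Lemma adj_e z : adj w e z -> z = d1.
Proof.
rewrite /adj /w => /andP[ze]; move: ze.
case: (vertexP z) => [->|->|->|->|h ->|h ->|x ->] //=.
- by rewrite game_weight_hub //= addSn.
- by rewrite game_weight_anchor.
- by rewrite game_weight_free.
Qed.

Lemma hub_neq_anchor h : hub h != anchor h.
Proof. by rewrite -val_eqE /=; have := ltn_ord h; lia. Qed.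

Lemma hub_neq_free h x : hub h != free x.
Proof. by rewrite -val_eqE /=; have := ltn_ord h; lia. Qed.

Lemma weight_hub_free h x : w (hub h) (free x) = a h x.
Proof.
by rewrite /w game_weight_hub //= ltnNge leq_addr /= addKn.
Qed.

Lemma sat_of_stable : has_connected_NS w ->
  exists y : nat -> bool, forall h, h < H ->
    (1 - Posz (b h) <= \sum_(x < F) a h x *+ y x)%R.
Proof.
case=> P [[/and3P[/eqP cov tI nS0] ns] con].
have mem v : v \in pblock P v by rewrite mem_pblock cov inE.
have memP v : pblock P v \in P by rewrite pblock_mem // cov inE.
have same u v : u \in pblock P v -> pblock P u = pblock P v by apply: same_pblock.
have envy v u : (utility w v (pblock P u) <= utility w v (pblock P v))%R.
  by case: (ns v) => _; apply.
have nonneg v : (0 <= utility w v (pblock P v))%R by case: (ns v).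
have e_d1 : d1 \notin pblock P e.
  by apply/negP => h; have := nonneg e; rewrite util_e h.
(* Nonnegative utility keeps 3 apart from 1, its only neighbour, so connectivity isolates it. Vertex
   1 can then always move to 3 for utility 1. *)
have e_alone x : x \in pblock P e -> x = e.
  move=> xS; have /connectP[[|z p] /= hp ->] := con _ (memP e) e x (mem e) xS => //.
  move: hp => /andP[/andP[/andP[_ zS]] /adj_e zd1 _].
  by rewrite zd1 (negbTE e_d1) in zS.
have d1_ge : (1 <= utility w d1 (pblock P d1))%R.
  have := envy d1 e; congr (_ <= _)%R.
  have -> : pblock P e = [set e].
    apply/setP => x; rewrite inE; apply/idP/eqP => [/e_alone //|->].
    exact: mem.
  rewrite /utility (big_pred1 e) => [|u] /=; last by rewrite inE; case: (eqVneq u e) => [->|].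
  by [].

have d1_e : e \notin pblock P d1.
  by apply/negP => h; move: e_d1; rewrite (same _ _ h) mem.
have d1_d2 : d2 \in pblock P d1.
  have := util_d1 (pblock P d1); rewrite (negbTE d1_e); case: (d2 \in _) => //; lia.
(* With 3 elsewhere, the utility 1 owed to vertex 1 comes from 2 alone; any further companion has
   weight -1 and would spoil it. *)
have D u : u \in pblock P d1 -> u = d1 \/ u = d2.
  move=> uS; case: (eqVneq u d1) => [|u1]; first by left.
  case: (eqVneq u d2) => [|u2]; first by right.
  have ue : u != e by apply: contraNneq d1_e => <-.
  have := util_d1_lt uS u1 u2 ue; rewrite d1_d2 (negbTE d1_e).
  by move=> /(le_lt_trans d1_ge); rewrite ltxx.
(* The anchor can get 2 from the pair, and outside of it has only two friends, the root and the hub,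
   so it must be with both. *)
have hr h : hub h \in pblock P r.
  have c_d1 : anchor h \notin pblock P d1.
    by apply/negP => /D [] /(congr1 val) /=; lia.
  have d1_c : d1 \notin pblock P (anchor h).
    by apply: contra c_d1 => /same ->; apply: mem.
  have d2_c : d2 \notin pblock P (anchor h).
    by apply: contra c_d1 => hd; rewrite -(same _ _ d1_d2) (same _ _ hd) mem.
  have := envy (anchor h) d1; rewrite !util_anchor mem d1_d2 (negbTE d1_c) (negbTE d2_c).
  have := fun H' : r \in pblock P (anchor h) => esym (same _ _ H').
  case: (r \in pblock P (anchor h)) => [/(_ isT) ->|_];
    by case: (r \in _); case: (hub h \in pblock P d1); case: (hub h \in _).
exists (fun x => if insub x is Some x' then free x' \in pblock P r else false) => h hH.
(* Moving to the pair would give the hub exactly 1, from vertex 1; in the coalition of the root it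
   gets [b h] plus its linear form. *)
have h1 := envy (hub (Ordinal hH)) d1.
have d1_r : d1 \notin pblock P r.
  apply/negP => /same hd; have := hr (Ordinal hH); rewrite -hd => /D [] /(congr1 val) /=; lia.
rewrite (same _ _ (hr (Ordinal hH))) !util_hub mem (negbTE d1_r) mem andbT in h1.
move: h1; rewrite (_ : b _ && (r \in pblock P d1) = false); last first.
  by apply/negbTE/negP => /andP[_ /D [] /(congr1 val)].
rewrite [X in (_ + X <= _)%R]big1 => [|x _]; last first.
  by rewrite (_ : _ \in _ = false) //; apply/negbTE/negP => /D [] /(congr1 val) /=; lia.
rewrite /= addr0 add0r [X in (_ <= X)%R]addrAC addr0 => h1.
rewrite lerBlDl; apply: le_trans h1 _; rewrite lerD2l.
by apply: ler_sum => x _; rewrite valK.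
Qed.

Section Stable.
Variable y0 : nat -> bool.
Hypothesis sat : forall h : 'I_H, (1 - Posz (b h) <= \sum_(x < F) a h x *+ y0 x)%R.

(* Free vertices without an arc to a hub stay outside, so that the big coalition is connected. *)
Let y (x : 'I_F) : bool := y0 x && [exists h : 'I_H, a h x != 0%R].
Let T : {set 'I_n} := [set u : 'I_n |
  [|| u == r, (4 <= u) && (u < 4 + 2 * H) | [exists x, (u == free x) && y x]]].
(** The shift by 2 avoids the labels of the coalition of the root and of the pair, so that every
    other vertex is alone. *)
Let label (u : 'I_n) : nat := if u \in T then 0 else if (u == d1) || (u == d2) then 1 else u.+2.
Let P := preim_partition label [set: 'I_n].
Let class v := [set u | label u == label v].

Let rT : r \in T. Proof. by rewrite inE eqxx. Qed.
Let hubT h : hub h \in T. Proof. by rewrite inE /=; case: h => h /=; lia. Qed.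
Let anchorT h : anchor h \in T. Proof. by rewrite inE /=; case: h => h /=; lia. Qed.
Let freeT x : (free x \in T) = y x.
Proof.
rewrite inE /= (_ : (_ < 4 + 2 * H) = false) /=; last by lia.
apply/existsP/idP => [[x' /andP[/eqP /(congr1 val) /= e' yx]]|yx].
  by rewrite (_ : x = x') //; apply: val_inj => /=; lia.
by exists x; rewrite eqxx.
Qed.
Let smallT (u : 'I_n) : 0 < u < 4 -> u \notin T.
Proof.
move=> hu; rewrite inE -val_eqE /= !negb_or; apply/and3P; split; try lia.
by apply/negP => /existsP[x /andP[/eqP /(congr1 val) /= ex _]]; lia.
Qed.
Let d1T : d1 \notin T. Proof. exact: smallT. Qed.
Let d2T : d2 \notin T. Proof. exact: smallT. Qed.
Let eT : e \notin T. Proof. exact: smallT. Qed.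

Let class_T v : v \in T -> class v = T.
Proof.
move=> vT; apply/setP => u; rewrite inE /label vT.
by case: ifP => // _; case: ifP.
Qed.

Let class_d v : (v == d1) || (v == d2) -> class v = [set d1; d2].
Proof.
move=> vd; apply/setP => u; rewrite !inE /label vd.
rewrite (_ : (v \in T) = false); last first.
  by case/orP: vd => /eqP ->; apply/negbTE.
case: ifP => [uT|_]; last by case: ifP.
by apply/esym/negbTE; apply: contraTN uT => /orP[] /eqP ->.
Qed.

Let class_1 v : v \notin T -> (v == d1) || (v == d2) = false -> class v = [set v].
Proof.
move=> vT vd; apply/setP => u; rewrite !inE /label (negbTE vT) vd.
case: ifP => [uT|_]; first by apply/esym/negbTE; apply: contraNneq vT => <-.
case: ifP => [ud|_]; first by apply/esym/negbTE; apply: contraFneq vd => <-.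
by rewrite !eqSS val_eqE.
Qed.

Let classP v : [\/ v \in T /\ class v = T, class v = [set d1; d2] |
  [/\ v \notin T, (v == d1) || (v == d2) = false & class v = [set v]]].
Proof.
case: (boolP (v \in T)) => vT; first by constructor 1; rewrite class_T.
case E: ((v == d1) || (v == d2)); first by constructor 2; rewrite class_d.
by constructor 3; rewrite class_1.
Qed.

Let util_single v z : utility w v [set z] = if z == v then 0%R else w v z.
Proof.
rewrite /utility (eq_bigl (fun u => (u == z) && (z != v))); last first.
  by move=> u; rewrite inE; case: (eqVneq u z) => [->|].
case: (eqVneq z v) => [_|zv]; first by rewrite big1 // => u; rewrite andbF.
by rewrite (big_pred1 z) // => u; rewrite andbT.
Qed.

Let util_guard v : w v d2 = 0%R -> v != d1 -> v != d2 -> utility w v [set d1; d2] = w v d1.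
Proof.
move=> w0 v1 v2; rewrite /utility (bigD1 d1) /=; last by rewrite !inE eqxx /= eq_sym.
rewrite (bigD1 d2) /=; last by rewrite !inE eqxx orbT /= eq_sym v2.
rewrite w0 big1 ?addr0 // => u; rewrite !inE -!andbA => /and4P[]; by case/orP=> ->.
Qed.

Let block v : pblock P v = class v.
Proof.
have eqR : {in [set: 'I_n] & &, equivalence_rel [rel x y | label x == label y]}.
  by move=> x1 x2 x3 _ _ _ /=; split=> // /eqP ->.
apply/setP => u; rewrite (pblock_equivalence_partition eqR) ?in_setT //.
by rewrite [RHS]in_set /= eq_sym.
Qed.

Let stable_class v z : (utility w v (class z) <= utility w v (class v))%R.
Proof.
case: (vertexP v) => [->|->|->|->|h ->|h ->|x ->]; try by rewrite !util_passive //; auto; right; right; eexists.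
- rewrite [X in (_ <= X)%R](_ : _ = 1%R); last first.
    rewrite class_d ?eqxx // /utility (big_pred1 d2) // => u /=; rewrite !inE.
    by case: (eqVneq u d1) => [->|] //=; rewrite andbT.
  apply: le_trans (util_d1 _) _.
  case: (classP z) => [[zT ->]|->|[zT zd ->]].
  + by rewrite (negbTE d2T) (negbTE eT).
  + by rewrite !inE.
  + by rewrite !inE; case: (eqVneq d2 z) => [<-|_] //; case: (_ == _).
- have d1e : d1 \in [set e] = false by rewrite inE.
  by rewrite (class_1 (v := e)) // !util_e d1e; case: (d1 \in _).
(* The inequality of the hub gives it utility 1, and nothing outside [T] offers more: the pair gives
   1, and a single vertex at most one weight. *)
- have hT : (1 <= utility w (hub h) (class (hub h)))%R.
    rewrite (class_T (hubT h)) util_hub rT andbT (negbTE d1T) addr0.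
    have := sat h; rewrite lerBlDl; congr (_ <= _ + _)%R; apply: eq_bigr => x _.
    rewrite freeT /y; case: (y0 x) => //=; case: existsP => //= hn.
    by have [->|/negP] := eqVneq (a h x) 0%R; rewrite ?mul0rn // => nz; case: hn; exists h; apply/negP.
  case: (classP z) => [[zT ->]|->|[zT zd ->]].
  + by rewrite (class_T (hubT h)).
  + apply: le_trans hT; by rewrite util_guard /w //= ?game_weight_hub //=.
  + apply: le_trans hT; rewrite util_single; case: ifP => // _.
    rewrite /w game_weight_hub //; case: (b h); do 3 (case: ifP => // _).
- rewrite (class_T (anchorT h)) !util_anchor rT (negbTE d1T) (negbTE d2T) hubT.
  case: (classP z) => [[zT ->]|->|[zT zd ->]].
  + by rewrite rT (negbTE d1T) (negbTE d2T) hubT.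
  + by rewrite !inE.
  + rewrite !inE; move: zT zd; case: (eqVneq r z) => [<-|_]; first by rewrite rT.
    case: (eqVneq d1 z) => [<-|_] //; case: (eqVneq d2 z) => [<-|_] //; case: eqP => //= <-.
Qed.

Lemma stable_of_sat : has_connected_NS w.
Proof.
exists P; split.
  split; first exact: preim_partitionP.
  move=> v; rewrite block; split.
    case: (vertexP v) => [vE|vE|vE|vE|h vE|h vE|x vE]; try by rewrite vE util_passive //; auto; right; right; eexists.
    - apply: le_trans (stable_class v e); rewrite vE (class_1 (v := e)) //.
      by rewrite util_single.
    - by rewrite vE (class_1 (v := e)) // util_e inE.
    - apply: le_trans (stable_class v d1); rewrite vE (class_d (v := d1)) ?eqxx //.
      by rewrite util_guard /w //= ?game_weight_hub.
    - by rewrite vE util_anchor.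
  move=> S SP; have [z zS] : exists z, z \in S.
    by apply/set0Pn; apply: contraTneq SP => ->; case/and3P: (preim_partitionP label [set: 'I_n]).
  have tI : trivIset P by case/and3P: (preim_partitionP label [set: 'I_n]).
  by rewrite -(def_pblock tI SP zS) block; apply: stable_class.
move=> S SP x z xS zS.
have tI : trivIset P by case/and3P: (preim_partitionP label [set: 'I_n]).
have SE : S = class x by rewrite -block (def_pblock tI SP xS).
set rel_S := [rel _ _ | _].
have sym : connect_sym rel_S.
  by apply: sym_connect_sym => u v /=; rewrite /adj eq_sym orbC [(u \in S) && _]andbC.
have adjI u v : u \in S -> v \in S -> (w u v != 0)%R -> u != v -> connect rel_S u v.
  by move=> uS vS wuv uv; apply: connect1; rewrite /= uS vS /adj uv wuv.
case: (classP x) => [[xT cT]|cD|[xT xd c1]].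
- rewrite cT in SE; subst S.
  (* Anchors join the hubs to the root, even those with no arc to it, and [y] admits only free
     vertices adjacent to some hub. *)
  suff toR u : u \in T -> connect rel_S u r by rewrite (connect_trans (toR _ xS)) // sym toR.
  have aR h : connect rel_S (anchor h) r.
    by apply: adjI => //; rewrite /w ?game_weight_anchor // -val_eqE.
  have hR h : connect rel_S (hub h) r.
    apply: connect_trans (aR h); rewrite sym; apply: adjI => //.
      by rewrite /w game_weight_anchor //= ?eqxx ?orbT.
    by rewrite eq_sym hub_neq_anchor.
  case: (vertexP u) => [->|->|->|->|h ->|h ->|v ->] uT //.
  + by rewrite (negbTE d1T) in uT.
  + by rewrite (negbTE d2T) in uT.
  + by rewrite (negbTE eT) in uT.
  + have := uT; rewrite freeT => /andP[_ /existsP[h nz]].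
    apply: connect_trans (hR h); rewrite sym; apply: adjI => //.
      by rewrite weight_hub_free.
    by rewrite hub_neq_free.
- rewrite cD in SE; subst S.
  have c12 : connect rel_S d1 d2 by apply: adjI; rewrite ?inE ?eqxx ?orbT.
  move: xS zS; rewrite !inE => /orP[] /eqP -> /orP[] /eqP -> //.
  by rewrite sym.
- by rewrite c1 in SE; subst S; move: zS; rewrite inE => /eqP ->; apply: connect0.
Qed.

End Stable.
End Game.

Theorem game_correct H F (b : nat -> bool) (a : nat -> nat -> int) :
  (forall h x, (a h x <= 1)%R) ->
  has_connected_NS (fun i j : 'I_(4 + 2 * H + F) => game_weight H b a i j) <->
  exists y : nat -> bool, forall h, h < H -> (1 - Posz (b h) <= \sum_(x < F) a h x *+ y x)%R.
Proof.
move=> a1; split; first exact: sat_of_stable.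
case=> y hy; apply: (@stable_of_sat H F b a a1 y) => h; exact: hy.
Qed.

(** * Satisfiability as a system of constraints *)

Lemma sum_blocks (f : nat -> int) U X :
  (\sum_(0 <= x < U * X) f x = \sum_(0 <= u < U) \sum_(0 <= i < X) f (u * X + i)%N)%R.
Proof.
elim: U => [|U IH]; first by rewrite mul0n !big_geq.
rewrite big_nat_recr //= -IH mulSnr (big_cat_nat (leq0n _) (leq_addr _ _)) /=.
congr (_ + _)%R; rewrite -{1}[U * X]add0n big_addn addKn.
by apply: eq_bigr => i _; rewrite addnC.
Qed.

Lemma sum_delta_nat (c : nat -> int) U u : u < U ->
  (\sum_(0 <= v < U) c v *+ (v == u) = c u)%R.
Proof.
move=> uU; rewrite big_mkord (bigD1 (Ordinal uU)) //= eqxx big1 ?addr0 // => v.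
by rewrite -val_eqE /= => /negbTE ->.
Qed.

(** A counter [c] stands for the value [c - 1]. For [c = 0] the form vanishes whatever [B] is, which
    is what makes 0 harmless. *)
Lemma telescope_prefix (B : nat -> bool) X c : c <= X ->
  (\sum_(0 <= i < X) (Posz (B i) - Posz ((0 < i)%N && B i.-1)) *+ (i < c)%N =
   Posz ((0 < c)%N && B c.-1))%R.
Proof.
move=> cX; rewrite (big_cat_nat (leq0n c) cX) /= [X in (_ + X)%R]big_nat_cond.
rewrite [X in (_ + X)%R]big1 ?addr0 => [|i]; last by rewrite andbT => /andP[ci _]; rewrite (leq_gtF ci).
elim: c {cX} => [|c IH]; first by rewrite big_geq.
rewrite big_nat_recr //= ltnSn mulr1n.
rewrite (_ : \sum_(0 <= i < c) _ = Posz ((0 < c)%N && B c.-1))%R; first by lia.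
rewrite -IH !big_mkord; apply: eq_bigr => i _; by rewrite ltnS (ltnW (ltn_ord i)) ltn_ord.
Qed.

Lemma monotone_prefix (f : nat -> bool) X : (forall i, i.+1 < X -> f i.+1 -> f i) ->
  forall i, i < X -> f i = (i < \sum_(0 <= j < X) f j).
Proof.
elim: X => [|X IH] // mono i; rewrite ltnS => iX.
have {}IH : forall i, i < X -> f i = (i < \sum_(0 <= j < X) f j).
  by apply: IH => j jX; apply: mono; apply: ltnW.
have sX : \sum_(0 <= j < X) f j <= X.
  rewrite big_mkord -[X in _ <= X]muln1 -[X in _ <= X * _]card_ord -sum_nat_const.
  by apply: leq_sum => j _; case: (f j).
rewrite big_nat_recr //=; case fX: (f X).
  have all j : j <= X -> f (X - j).
    elim: j => [|j IHj] jX; first by rewrite subn0.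
    by apply: mono; [lia | rewrite (_ : (X - j.+1).+1 = X - j) ?IHj; lia].
  have -> : \sum_(0 <= j < X) f j = X.
    rewrite big_nat_cond (eq_bigr (fun=> 1)) => [|j]; last first.
      by rewrite andbT => /andP[_ jX]; rewrite (_ : j = X - (X - j)) ?all //; lia.
    by rewrite -big_nat_cond sum_nat_const_nat; lia.
  by rewrite addn1 ltnS iX (_ : i = X - (X - i)) ?all //; lia.
rewrite addn0; move: iX; rewrite leq_eqVlt => /orP[/eqP ->|]; last exact: IH.
by rewrite fX; apply/esym/negbTE; rewrite -leqNgt.
Qed.

Fixpoint from_bits s (f : nat -> bool) : nat :=
  if s is s'.+1 then f 0 + (from_bits s' (fun b => f b.+1)).*2 else 0.

Lemma from_bits_lt s f : from_bits s f < 2 ^ s.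
Proof.
elim: s f => [|s IH] f //=; have := IH (fun b => f b.+1).
by rewrite expnS; case: (f 0); lia.
Qed.

Lemma from_bits_bit s f b : b < s -> odd (from_bits s f %/ 2 ^ b) = f b.
Proof.
elim: s f b => [|s IH] f [|b] //= bs; first by rewrite divn1 oddD odd_double addbF oddb.
rewrite -(IH (fun b => f b.+1)) // expnS divnMA; congr (odd (_ %/ _)).
by case: (f 0); lia.
Qed.

Section Constraints.
Variables (k X m : nat) (prs pl : nat -> bool) (vr : nat -> nat).

(* The free vertex [x = (t * k + g) * X + i] asserts that, at time [t], the counter of
   group [g] exceeds [i].  Hub [h < Q] keeps a block monotone, hub [Q + u] compares the
   counters of group [u %% k] at two consecutive times (cyclically), and hub [Q + U + j]
   checks clause [j], which reads the counters at times [3 * j + l]. *)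
Definition nblocks := 3 * m * k.
Definition nfree := nblocks * X.
Definition nhubs := nfree + nblocks + m.

Definition bit_of i b := odd (i %/ 2 ^ b).

(** Time [t] belongs to literal [t %% 3] of clause [t %/ 3], and [prs t] says that this literal
    exists. Variable [v] is bit [v %/ k] of group [v %% k]. *)
Definition reads j x := let t := x %/ X %/ k in
  [&& t %/ 3 == j, prs t & x %/ X %% k == vr t %% k].

Definition pos_coef h x : bool :=
  if h < nfree then x == h
  else if h < nfree + nblocks then x %/ X == h - nfree
  else reads (h - (nfree + nblocks)) x &&
       (bit_of (x %% X) (vr (x %/ X %/ k) %/ k) == pl (x %/ X %/ k)).

(** The test [x %% X != 0] ends the monotone chain at the end of a block. For a clause, the
    indicator at the preceding value is subtracted, which produces the form of
    [telescope_prefix]. *)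
Definition neg_coef h x : bool :=
  if h < nfree then (x == h.+1) && (x %% X != 0)
  else if h < nfree + nblocks then x %/ X == (h - nfree + k) %% nblocks
  else reads (h - (nfree + nblocks)) x &&
       ((0 < x %% X) && (bit_of (x %% X).-1 (vr (x %/ X %/ k) %/ k) == pl (x %/ X %/ k))).

Definition coef h x : int := (Posz (pos_coef h x) - Posz (neg_coef h x))%R.
(** Slack is a weight 1 from the hub to the root. It lowers the threshold 1 to 0, as monotonicity
    and comparison require; a clause keeps threshold 1, one true literal. *)
Definition slack h := h < nfree + nblocks.

Variables (nv s : nat).
Hypothesis XE : X = 2 ^ s.
Hypothesis k_gt0 : 0 < k.
Hypothesis nv_le : nv <= k * s.
Hypothesis vr_lt : forall t, prs t -> vr t < nv.

Let X_gt0 : 0 < X. Proof. by rewrite XE expn_gt0. Qed.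

Lemma block_div u i : i < X -> (u * X + i) %/ X = u.
Proof. by move=> iX; rewrite divnMDl // divn_small // addn0. Qed.
Lemma block_mod u i : i < X -> (u * X + i) %% X = i.
Proof. by move=> iX; rewrite modnMDl modn_small. Qed.

Definition satisfies (y : nat -> bool) := forall h, h < nhubs ->
  (1 - Posz (slack h) <= \sum_(0 <= x < nfree) coef h x *+ y x)%R.

Definition clause_term (c : nat -> nat) j u : bool :=
  let t := u %/ k in [&& t %/ 3 == j, prs t, u %% k == vr t %% k, 0 < c u &
                        bit_of (c u).-1 (vr t %/ k) == pl t].

Section Counters.
Variables (y : nat -> bool) (c : nat -> nat).
Hypothesis yc : forall u i, u < nblocks -> i < X -> y (u * X + i) = (i < c u).
Hypothesis c_le : forall u, u < nblocks -> c u <= X.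

Lemma eq_sum_nat (f g : nat -> int) N : (forall i, i < N -> f i = g i) ->
  (\sum_(0 <= i < N) f i = \sum_(0 <= i < N) g i)%R.
Proof. by move=> fg; rewrite !big_mkord; apply: eq_bigr => i _; apply: fg. Qed.

Lemma sum_lt C : C <= X -> (\sum_(0 <= i < X) Posz (i < C)%N = Posz C)%R.
Proof.
move=> CX; rewrite (big_cat_nat (leq0n C) CX) /= [X in (_ + X)%R]big_nat_cond.
rewrite [X in (_ + X)%R]big1 ?addr0 => [|i]; last by rewrite andbT => /andP[ci _]; rewrite (leq_gtF ci).
rewrite big_mkord (eq_bigr (fun=> 1%R)) => [|i _]; last by rewrite ltn_ord.
by rewrite sumr_const card_ord; lia.
Qed.

Lemma sum_equal u : u < nblocks ->
  (\sum_(0 <= x < nfree) coef (nfree + u)%N x *+ y x =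
   Posz (c u) - Posz (c ((u + k) %% nblocks)%N))%R.
Proof.
move=> uU; have U0 : 0 < nblocks by apply: leq_ltn_trans uU.
rewrite /nfree sum_blocks.
rewrite (eq_sum_nat (g := fun v => (Posz (c v) *+ (v == u) - Posz (c v) *+ (v == (u + k) %% nblocks)%N)%R)).
  rewrite big_split /= sum_delta_nat // sumrN sum_delta_nat //; exact: ltn_pmod.
move=> v vU; rewrite -(sum_lt (c_le vU)) -!sumrMnl -sumrB; apply: eq_sum_nat => i iX.
rewrite /coef /pos_coef /neg_coef ltnNge leq_addr /= ltn_add2l uU addKn block_div // yc //.
by case: (v == u); case: (v == _); case: (i < c v).
Qed.

Lemma sum_clause j : j < m ->
  (\sum_(0 <= x < nfree) coef (nfree + nblocks + j)%N x *+ y x =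
   \sum_(0 <= u < nblocks) Posz (clause_term c j u))%R.
Proof.
move=> jm; rewrite [LHS](sum_blocks _ nblocks X); apply: eq_sum_nat => u uU.
set cond := [&& u %/ k %/ 3 == j, prs (u %/ k) & u %% k == vr (u %/ k) %% k].
pose B i := bit_of i (vr (u %/ k) %/ k) == pl (u %/ k).
have -> : clause_term c j u = cond && ((0 < c u) && B (c u).-1).
  by rewrite /clause_term /cond -!andbA.
transitivity (\sum_(0 <= i < X) (Posz (B i) - Posz ((0 < i)%N && B i.-1)) *+ (i < c u)%N *+ cond)%R.
  apply: eq_sum_nat => i iX.
  rewrite /coef /pos_coef /neg_coef addKn.
  rewrite (_ : (nfree + nblocks + j < nfree) = false); last by lia.
  rewrite (_ : (nfree + nblocks + j < nfree + nblocks) = false); last by lia.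
  rewrite /reads block_div // block_mod // yc // -/cond -/(B _) -/(B i.-1).
  by case: cond; rewrite /= ?mulr1n ?mulr0n ?subrr ?mul0rn.
by rewrite sumrMnl telescope_prefix ?c_le //; case: cond.
Qed.

End Counters.

Lemma sum_mono (y : nat -> bool) h : h < nfree ->
  (\sum_(0 <= x < nfree) coef h x *+ y x =
   Posz (y h) - Posz [&& h.+1 < nfree, h.+1 %% X != 0 & y h.+1]%N)%R.
Proof.
move=> hQ; rewrite /coef /pos_coef /neg_coef hQ.
rewrite (eq_sum_nat (g := fun x => (Posz (y x) *+ (x == h) - Posz ((x %% X != 0)%N && y x) *+ (x == h.+1))%R)).
  rewrite big_split /= sum_delta_nat // sumrN; case: (ltnP h.+1 nfree) => h1.
    by rewrite sum_delta_nat.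
  rewrite [X in (_ - X)%R]big_mkord big1 // => x _.
  by rewrite (_ : (x == h.+1 :> nat) = false) //; have := ltn_ord x; lia.
by move=> x _; case: (x == h); case: (x == h.+1); case: (y x); case: (x %% X != 0).
Qed.

Definition assignment_ok (al : nat -> bool) := forall j, j < m ->
  exists2 l, l < 3 & prs (3 * j + l) && (al (vr (3 * j + l)) == pl (3 * j + l)).

Lemma assignment_of_counters c (al : nat -> bool) :
  (forall u, u < nblocks -> c u = c (u %% k)) ->
  (forall x, x < nv -> 0 < c (x %% k) -> al x = bit_of (c (x %% k)).-1 (x %/ k)) ->
  (forall j, j < m -> (1 <= \sum_(0 <= u < nblocks) Posz (clause_term c j u))%R) ->
  assignment_ok al.
Proof.
move=> cmod hal hj j jm; have := hj j jm.
case: (boolP [exists u : 'I_nblocks, clause_term c j u]) => [/existsP[u hu] _|].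
  have := hu; rewrite /clause_term; set t := u %/ k => /and5P[/eqP tj pt /eqP uk cu /eqP bt].
  exists (t %% 3); first exact: ltn_pmod.
  have <- : t = 3 * j + t %% 3 by rewrite -tj mulnC -divn_eq.
  by rewrite pt hal ?vr_lt // -uk -?cmod // bt eqxx.
rewrite negb_exists => /forallP h; rewrite big_mkord big1 // => u _.
by rewrite (negbTE (h u)).
Qed.

(** Within a group the counters never increase from one time to the next, nor from the last time
    back to the first, so they are constant. *)
Lemma cyclic_counters (c : nat -> nat) :
  (forall u, u < nblocks -> c ((u + k) %% nblocks) <= c u) ->
  forall u, u < nblocks -> c u = c (u %% k).
Proof.
move=> h u uU; have U0 : 0 < nblocks by apply: leq_ltn_trans uU.
have m0 : 0 < 3 * m by move: U0; rewrite /nblocks muln_gt0 => /andP[].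
have gk : u %% k < k by rewrite ltn_pmod.
have step t : (t.+1 < 3 * m) -> c (t.+1 * k + u %% k) <= c (t * k + u %% k).
  move=> tm; have lt : t.+1 * k + u %% k < nblocks.
    have : t.+2 * k <= 3 * m * k by rewrite leq_mul2r tm orbT.
    by rewrite /nblocks; nia.
  have := h (t * k + u %% k); rewrite addnAC -mulSnr (modn_small lt).
  by apply; apply: leq_ltn_trans lt; rewrite leq_add2r leq_mul2r leqnSn orbT.
have chain t d : t + d < 3 * m -> c ((t + d) * k + u %% k) <= c (t * k + u %% k).
  elim: d => [|d IH]; rewrite ?addn0 // addnS => tm.
  by apply: leq_trans (step _ tm) (IH (ltnW tm)).
have wrap : c (u %% k) <= c ((3 * m).-1 * k + u %% k).
  have := h ((3 * m).-1 * k + u %% k); rewrite addnAC -mulSnr prednK // modnDl.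
  rewrite (_ : u %% k %% nblocks = u %% k); last first.
    by rewrite modn_small // (leq_trans gk) // leq_pmull.
  apply; have <- : (3 * m).-1.+1 * k = nblocks by rewrite prednK.
  by rewrite (mulSnr (3 * m).-1) ltn_add2l.
have uE := divn_eq u k; set t := u %/ k in uE.
have tm : t < 3 * m by rewrite /t ltn_divLR.
apply/eqP; rewrite eqn_leq {1}uE.
have := chain 0 t; rewrite mul0n !add0n => -> //=.
apply: leq_trans wrap _; rewrite [in X in _ <= X]uE.
have := chain t ((3 * m).-1 - t); rewrite subnKC; last by lia.
by apply; lia.
Qed.

Theorem constraints_correct : (exists y, satisfies y) <-> (exists al, assignment_ok al).
Proof.
split=> [[y hy]|[al hal]].
- pose c u := \sum_(0 <= i < X) y (u * X + i).
  have yc u i : u < nblocks -> i < X -> y (u * X + i) = (i < c u).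
    move=> uU; apply: (monotone_prefix (f := fun i => y (u * X + i))) => {}i iX yi.
    have hQ : (u * X + i).+1 < nfree.
      rewrite /nfree -addnS; apply: leq_trans (_ : u.+1 * X <= _).
        by rewrite mulSnr ltn_add2l.
      by rewrite leq_mul2r uU orbT.
    have hh : u * X + i < nhubs by rewrite /nhubs; lia.
    have hs : slack (u * X + i) by rewrite /slack; lia.
    have := hy _ hh; rewrite sum_mono ?(ltnW hQ) // hQ hs -addnS block_mod //= yi.
    by case: (y (u * X + i)).
  have c_le u : u < nblocks -> c u <= X.
    move=> uU; rewrite /c big_mkord -[X in _ <= X]muln1 -[X in _ <= X * _]card_ord -sum_nat_const.
    by apply: leq_sum => j _; case: (y _).
  have cmod : forall u, u < nblocks -> c u = c (u %% k).
    apply: cyclic_counters => u uU; have := hy (nfree + u).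
    rewrite (sum_equal yc c_le uU) /slack ltn_add2l uU => /(_ _).
    suff -> : nfree + u < nhubs by move=> /(_ isT); lia.
    by rewrite /nhubs -addnA ltn_add2l ltn_addr.
  exists (fun x => bit_of (c (x %% k)).-1 (x %/ k)).
  apply: (assignment_of_counters cmod) => // j jm.
  rewrite -(sum_clause yc c_le jm); have := hy (nfree + nblocks + j).
  rewrite (_ : slack _ = false) ?subr0; last by rewrite /slack; lia.
  by apply; rewrite /nhubs ltn_add2l.
- pose v g := from_bits s (fun b => al (g + k * b)).
  have vX g : v g < X by rewrite XE from_bits_lt.
  have hb g b : b < s -> bit_of (v g) b = al (g + k * b) by apply: from_bits_bit.
  (* The counter is one more than the number of the assignment, since 0 is reserved; as [v g < X] it
     still fits the block. *)
  pose c u := (v (u %% k)).+1.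
  pose y x := x %% X < c (x %/ X).
  have yc u i : u < nblocks -> i < X -> y (u * X + i) = (i < c u).
    by move=> uU iX; rewrite /y block_mod // block_div.
  have c_le u : u < nblocks -> c u <= X by move=> _; apply: vX.
  exists y => h hh; case: (ltnP h nfree) => hQ.
    rewrite sum_mono // /slack (leq_trans hQ) ?leq_addr //.
    case: (boolP [&& _, _ & _]) => [/and3P[h1 h2 yh]|_]; last by case: (y h).
    suff -> : y h by [].
    move: yh h2; rewrite /y => yh h2.
    have E : h.+1 = h %/ X * X + (h %% X).+1 by rewrite addnS -divn_eq.
    have lt : (h %% X).+1 < X.
      have := ltn_pmod h X_gt0; rewrite leq_eqVlt => /orP[/eqP e|//].
      by move: h2; rewrite E e -mulSnr modnMl.
    by move: yh; rewrite E block_mod // block_div //; apply: ltnW.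
  case: (ltnP h (nfree + nblocks)) => hU.
    rewrite -(subnKC hQ) in hU *; set u := h - nfree in hU *; rewrite ltn_add2l in hU.
    rewrite (sum_equal yc c_le hU) /slack ltn_add2l hU /c modn_dvdm; last by rewrite /nblocks dvdn_mull.
    by rewrite modnDr !subrr.
  rewrite -(subnKC hU) in hh *; set j := h - (nfree + nblocks) in hh *.
  have jm : j < m by move: hh; rewrite /nhubs ltn_add2l.
  rewrite (sum_clause yc c_le jm) (_ : slack _ = false) ?subr0; last by rewrite /slack; lia.
  have [l l3 /andP[pt /eqP at_]] := hal j jm; set t := 3 * j + l in pt at_.
  have gk := ltn_pmod (vr t) k_gt0.
  have tm : t < 3 * m by rewrite /t; lia.
  have uU : t * k + vr t %% k < nblocks.
    have : t.+1 * k <= 3 * m * k by rewrite leq_mul2r tm orbT.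
    by rewrite /nblocks; nia.
  rewrite big_mkord (bigD1 (Ordinal uU)) //= (_ : clause_term _ _ _ = true).
    by rewrite lerDl sumr_ge0.
  have dE : (t * k + vr t %% k) %/ k = t by rewrite divnMDl // (divn_small gk) addn0.
  have mE : (t * k + vr t %% k) %% k = vr t %% k by rewrite modnMDl (modn_small gk).
  rewrite /clause_term /c dE mE eqxx pt /=.
  rewrite (_ : t %/ 3 = j) ?eqxx /=; last by rewrite /t; lia.
  rewrite hb; last first.
    by rewrite ltn_divLR // mulnC; apply: leq_trans (vr_lt pt) nv_le.
  by rewrite addnC mulnC -divn_eq at_ eqxx.
Qed.

End Constraints.

(** * Pathwidth *)

Section Pathwidth.
Variables (k X m : nat) (prs pl : nat -> bool) (vr : nat -> nat).
Hypotheses (k_gt0 : 0 < k) (X_gt0 : 0 < X).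
Let U := nblocks k m.
Let Q := nfree k X m.
Let H := nhubs k X m.
Let n := 4 + 2 * H + Q.
Let gw u v := game_weight H (slack k X m) (coef k X m prs pl vr) u v.

Let HE : H = Q + U + m. Proof. by []. Qed.
Let nE : n = 4 + 2 * H + Q. Proof. by []. Qed.
Let UE : U = 3 * m * k. Proof. by []. Qed.
Let QE : Q = U * X. Proof. by []. Qed.

(** Bag [q] is the moment when the sweep reaches free vertex [q]. A comparison hub lives during the
    two times that it compares, except that those of the last time compare with time 0 and stay
    throughout. *)
Definition hub_in_bag h q :=
  if h < Q then q == h
  else if h < Q + U then [|| (h - Q) %/ k == 3 * m - 1, q %/ X %/ k == (h - Q) %/ k
                           | q %/ X %/ k == ((h - Q) %/ k).+1]
  else q %/ X %/ k %/ 3 == h - Q - U.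

(** Each bag has two consecutive free vertices because a monotonicity hub may have arcs to both. An
    anchor follows its hub. *)
Definition in_bag q v :=
  if v < 4 then true
  else if v < 4 + H then hub_in_bag (v - 4) q
  else if v < 4 + 2 * H then hub_in_bag (v - 4 - H) q
  else (v - 4 - 2 * H == q) || (v - 4 - 2 * H == q.+1).

Lemma hub_in_bag_convex h i j l : i <= j <= l ->
  hub_in_bag h i -> hub_in_bag h l -> hub_in_bag h j.
Proof.
move=> /andP[ij jl]; rewrite /hub_in_bag.
have d1 : i %/ X %/ k <= j %/ X %/ k by rewrite !leq_div2r.
have d2 : j %/ X %/ k <= l %/ X %/ k by rewrite !leq_div2r.
have d3 : i %/ X %/ k %/ 3 <= j %/ X %/ k %/ 3 by rewrite leq_div2r.
have d4 : j %/ X %/ k %/ 3 <= l %/ X %/ k %/ 3 by rewrite leq_div2r.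
move: d1 d2 d3 d4; move: (i %/ X %/ k %/ 3) (j %/ X %/ k %/ 3) (l %/ X %/ k %/ 3).
move: (i %/ X %/ k) (j %/ X %/ k) (l %/ X %/ k) ((h - Q) %/ k) => a1 a2 a3 a4 b1 b2 b3.
move=> d1 d2 d3 d4; case: ifP => _; first by lia.
by case: ifP => _; lia.
Qed.

Lemma in_bag_convex v i j l : i <= j <= l -> in_bag i v -> in_bag l v -> in_bag j v.
Proof.
move=> hij; rewrite /in_bag; case: ifP => // _; case: ifP => _; first exact: hub_in_bag_convex.
by case: ifP => _; [exact: hub_in_bag_convex | lia].
Qed.

Lemma hub_in_some_bag h : h < H -> exists2 q, q <= Q & hub_in_bag h q.
Proof.
move=> hH; rewrite /hub_in_bag; case hQ: (h < Q); first by exists h; lia.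
case hU: (h < Q + U).
  exists ((h - Q) %/ k * k * X).
    rewrite QE leq_mul2r; apply/orP; right.
    apply: leq_trans (leq_divM _ _) _; lia.
  by rewrite (mulnK _ X_gt0) (mulnK _ k_gt0) eqxx orbT.
exists ((h - Q - U) * 3 * k * X).
  by rewrite QE UE !leq_mul2r; apply/orP; right; apply/orP; right; lia.
by rewrite (mulnK _ X_gt0) (mulnK _ k_gt0) mulnK.
Qed.

Lemma in_some_bag v : v < n -> exists2 q, q <= Q & in_bag q v.
Proof.
move=> vn; rewrite /in_bag; case h0: (v < 4); first by exists 0.
case h1: (v < 4 + H); first by apply: hub_in_some_bag; lia.
case h2: (v < 4 + 2 * H); first by apply: hub_in_some_bag; lia.
by exists (v - 4 - 2 * H); rewrite ?eqxx //; lia.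
Qed.

Lemma core_in_bag q v : v < 4 -> in_bag q v.
Proof. by rewrite /in_bag => ->. Qed.

Lemma hub_bag q h : h < H -> in_bag q (4 + h) = hub_in_bag h q.
Proof.
move=> hH; rewrite /in_bag ltnNge leq_addr /= ltn_add2l hH.
by congr hub_in_bag; lia.
Qed.

Lemma anchor_bag q h : h < H -> in_bag q (4 + H + h) = hub_in_bag h q.
Proof.
move=> hH; rewrite /in_bag (_ : 4 + H + h < 4 = false); last by lia.
rewrite (_ : 4 + H + h < 4 + H = false); last by lia.
rewrite (_ : 4 + H + h < 4 + 2 * H); last by lia.
by congr hub_in_bag; lia.
Qed.

Lemma free_bag q x : in_bag q (4 + 2 * H + x) = (x == q) || (x == q.+1).
Proof.
rewrite /in_bag (_ : 4 + 2 * H + x < 4 = false); last by lia.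
rewrite (_ : 4 + 2 * H + x < 4 + H = false); last by lia.
rewrite (_ : 4 + 2 * H + x < 4 + 2 * H = false); last by lia.
by rewrite (_ : 4 + 2 * H + x - 4 - 2 * H = x) //; lia.
Qed.

Lemma coef_bag h x : h < H -> x < Q -> coef k X m prs pl vr h x != 0%R ->
  exists2 q, q <= Q & hub_in_bag h q && ((x == q) || (x == q.+1)).
Proof.
move=> hH xQ; rewrite /coef /pos_coef /neg_coef -/Q -/U /hub_in_bag.
case hQ: (h < Q).
  move=> nz; exists h; first by lia.
  by rewrite eqxx; move: nz; case: (x == h) => //; case: (x == h.+1).
case hU: (h < Q + U) => nz; exists x; rewrite ?eqxx ?(ltnW xQ) //=; rewrite andbT.
  have xU : x %/ X < U by rewrite ltn_divLR.
  have : (x %/ X == h - Q) || (x %/ X == (h - Q + k) %% U).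
    by move: nz; case: (x %/ X == h - Q) => //=; case: (x %/ X == _ %% _).
  case/orP=> /eqP ->; first by rewrite eqxx orbT.
  case: (ltnP (h - Q + k) U) => hk.
    by rewrite modn_small // divnDr // divnn k_gt0 addn1 eqxx !orbT.
  (* The comparison wraps around, so the hub belongs to the last time and is in every bag. *)
  apply/orP; left; apply/eqP.
  have le : 3 * m - 1 <= (h - Q) %/ k.
    by rewrite leq_divRL // mulnBl mul1n -UE leq_subLR addnC.
  have lt : (h - Q) %/ k < 3 * m.
    by rewrite ltn_divLR // -UE ltn_subLR // leqNgt hQ.
  by apply/eqP; rewrite eqn_leq le andbT; move: lt; clear; move: (_ %/ k) => w; lia.
have : reads k X prs vr (h - (Q + U)) x.
  by move: nz; rewrite /reads; case: [&& _, _ & _].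
by rewrite /reads => /and3P[/eqP -> _ _]; rewrite subnDA.
Qed.

Lemma arc_in_bag u v : u < n -> v < n -> gw u v != 0%R ->
  exists2 q, q <= Q & in_bag q u && in_bag q v.
Proof.
move=> un vn nz; have [u4|u4] := ltnP u 4.
  by have [q qQ hq] := in_some_bag vn; exists q; rewrite // core_in_bag.
have [v4|v4] := ltnP v 4.
  by have [q qQ hq] := in_some_bag un; exists q; rewrite // hq core_in_bag.
have [uH|uH] := ltnP u (4 + H).
  have hu : u - 4 < H by lia.
  rewrite -(subnKC u4) in nz *; rewrite /gw game_weight_hub // in nz.
  move: nz; rewrite (_ : (v == 0) = false) 1?(_ : (v == 1) = false); try lia.
  case: ltnP => // vF /coef_bag -/(_ hu)[]; first by lia.
  move=> q qQ hq; exists q => //; rewrite hub_bag // -[v in in_bag q v](subnKC vF) free_bag.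
  exact: hq.
have [uH2|uH2] := ltnP u (4 + 2 * H); last first.
  by move: nz; rewrite /gw -(subnKC uH2) game_weight_free.
have hu : u - (4 + H) < H by lia.
rewrite -(subnKC uH) in nz *; rewrite /gw game_weight_anchor // in nz.
move: nz; case: ifP => // /orP[|/eqP -> _]; first by lia.
have [q qQ hq] := hub_in_some_bag hu.
by exists q => //; rewrite hub_bag // anchor_bag // hq.
Qed.

(** Origin of the width: four gadget vertices, two free ones, a monotonicity hub and a clause hub
    with anchors make 10, and each group contributes comparison hubs of three times with anchors.
    Repetitions, as for [t = 0], do no harm to an upper bound. *)
Definition bag_list q : seq nat :=
  let t := q %/ X %/ k in
  [:: 0; 1; 2; 3; 4 + 2 * H + q; 4 + 2 * H + q.+1; 4 + q; 4 + H + q;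
      4 + (Q + U + t %/ 3); 4 + H + (Q + U + t %/ 3)] ++
  flatten [seq [:: 4 + (Q + (t * k + g)); 4 + H + (Q + (t * k + g));
                   4 + (Q + (t.-1 * k + g)); 4 + H + (Q + (t.-1 * k + g));
                   4 + (Q + ((3 * m - 1) * k + g)); 4 + H + (Q + ((3 * m - 1) * k + g))]
          | g <- iota 0 k].

Lemma size_bag_list q : size (bag_list q) = (6 * k + 9).+1.
Proof.
rewrite size_cat size_flatten /shape -map_comp (eq_map (g := fun=> 6)) //.
have -> : sumn [seq 6 | _ <- iota 0 k] = 6 * k.
  have E c b : sumn [seq 6 | _ <- iota b c] = 6 * c by elim: c b => [|c IH] b //=; rewrite IH mulnS.
  exact: E.
by rewrite /= addnC; lia.
Qed.

Lemma hub_in_bag_list h q : h < H -> hub_in_bag h q ->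
  (4 + h \in bag_list q) && (4 + H + h \in bag_list q).
Proof.
move=> hH; rewrite /hub_in_bag; case: ifP => hQ.
  by move=> /eqP ->; rewrite !mem_cat !inE !eqxx !orbT.
case: ifP => hU.
  move=> hh; have : exists2 w, w \in [:: q %/ X %/ k; (q %/ X %/ k).-1; 3 * m - 1] & (h - Q) %/ k = w.
    case/or3P: hh => /eqP ->; [exists (3 * m - 1) | exists ((h - Q) %/ k) | exists ((h - Q) %/ k)] => //=;
    by rewrite !inE ?eqxx ?orbT.
  case=> w hw e; have hE : h = Q + (w * k + (h - Q) %% k).
    by rewrite -e -divn_eq; clear e hw hh; lia.
  have gI : (h - Q) %% k \in iota 0 k by rewrite mem_iota ltn_pmod.
  rewrite !mem_cat; apply/andP; split; apply/orP; right; apply/flatten_mapP;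
    exists ((h - Q) %% k) => //; move: hw hE; move: (_ %% k) => g; rewrite !inE => /or3P[] /eqP -> ->;
    by rewrite !eqxx ?orbT.
move=> /eqP e; have -> : h = Q + U + q %/ X %/ k %/ 3 by rewrite e; clear e; lia.
by rewrite !mem_cat !inE !eqxx /= ?orbT.
Qed.

Lemma in_bag_list q v : v < n -> in_bag q v -> v \in bag_list q.
Proof.
move=> vn; have [v4 _|v4] := ltnP v 4.
  by case: v v4 vn => [|[|[|[|v]]]].
have [vH|vH] := ltnP v (4 + H).
  have hv : v - 4 < H by lia.
  by rewrite -(subnKC v4) hub_bag // => /(hub_in_bag_list hv) /andP[].
have [vH2|vH2] := ltnP v (4 + 2 * H).
  have hv : v - (4 + H) < H by lia.
  by rewrite -(subnKC vH) anchor_bag // => /(hub_in_bag_list hv) /andP[].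
rewrite -(subnKC vH2) free_bag => /orP[] /eqP ->;
  by rewrite !mem_cat !inE !eqxx /= ?orbT.
Qed.

Theorem pathwidth_le : pw_le (fun i j : 'I_n => gw i j) (6 * k + 9).
Proof.
pose bag q : {set 'I_n} := [set v : 'I_n | in_bag q v].
exists [seq bag q | q <- iota 0 Q.+1]; split; last first.
  move=> _ /mapP[q _ ->]; rewrite -(size_bag_list q) cardE -(size_map val).
  apply: uniq_leq_size; first by rewrite map_inj_uniq ?enum_uniq //; apply: val_inj.
  move=> _ /mapP[v hv ->]; apply: (in_bag_list (ltn_ord v)).
  by move: hv; rewrite mem_enum inE.
have memB q : q <= Q -> bag q \in [seq bag q | q <- iota 0 Q.+1].
  by move=> qQ; apply: map_f; rewrite mem_iota.
split; first by move=> v; have [q qQ hq] := in_some_bag (ltn_ord v); exists (bag q); rewrite ?memB // inE.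
split.
  move=> u v /andP[_ /orP[]] nz.
    have [q qQ /andP[h1 h2]] := arc_in_bag (ltn_ord u) (ltn_ord v) nz.
    by exists (bag q); rewrite ?memB // !inE h1.
  have [q qQ /andP[h1 h2]] := arc_in_bag (ltn_ord v) (ltn_ord u) nz.
  by exists (bag q); rewrite ?memB // !inE h1 h2.
have nthB i : nth set0 [seq bag q | q <- iota 0 Q.+1] i = if i <= Q then bag i else set0.
  case: leqP => iQ; first by rewrite (nth_map 0) ?size_iota // nth_iota.
  by rewrite nth_default // size_map size_iota.
move=> v i j l /andP[ij jl]; rewrite !nthB.
case: (leqP l Q) => lQ; last by rewrite inE.
rewrite (leq_trans jl lQ) (leq_trans ij (leq_trans jl lQ)) !inE.
by apply: in_bag_convex; rewrite ij.
Qed.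

End Pathwidth.

(** * The arc weights are computable *)

(** Variables are de Bruijn indices; under a sum the index becomes variable 0 and outer functions
    must skip it. *)
Lemma comp_weaken F : polycomp F -> polycomp (fun L vs => F L (behead vs)).
Proof.
case=> g [D h]; exists (fun dst fr rho => g dst fr (behead rho)), D.
move=> M L rho vs fr dst st M1 hL hv hr; apply: h => //.
  by case: vs hv {hr} => //= v vs /andP[].
case: hr => h1 h2 h3 h4 h5 h6 h7 h8 h9 h10; split=> //.
- by case: rho vs h3 {h4 h8 hv} => [|r rho] [|v vs] //= [].
- by case: rho h4 {h3 h8} => //= r rho /andP[].
- by case: rho h8 {h3 h4} => //= r rho; rewrite inE negb_or => /andP[].
Qed.

Definition polycompb (P : seq nat -> seq nat -> bool) := polycomp (fun L vs => nat_of_bool (P L vs)).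

Lemma compb_leq F G : polycomp F -> polycomp G -> polycompb (fun L vs => F L vs <= G L vs).
Proof.
move=> hF hG; apply: comp_ext (comp_sub (comp_const 1) (comp_sub hF hG)) => L vs.
by case: leqP; lia.
Qed.

Lemma compb_ltn F G : polycomp F -> polycomp G -> polycompb (fun L vs => F L vs < G L vs).
Proof. by move=> hF hG; apply: (compb_leq (comp_add (comp_const 1) hF) hG). Qed.

Lemma compb_and P Q : polycompb P -> polycompb Q -> polycompb (fun L vs => P L vs && Q L vs).
Proof.
move=> hP hQ; apply: comp_ext (comp_mul hP hQ) => L vs.
by case: (P L vs); case: (Q L vs).
Qed.

Lemma compb_not P : polycompb P -> polycompb (fun L vs => ~~ P L vs).
Proof. by move=> hP; apply: comp_ext (comp_sub (comp_const 1) hP) => L vs; case: (P L vs). Qed.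

Lemma compb_ext P Q : (forall L vs, P L vs = Q L vs) -> polycompb P -> polycompb Q.
Proof. by move=> e; apply: comp_ext => L vs; rewrite e. Qed.

Lemma compb_or P Q : polycompb P -> polycompb Q -> polycompb (fun L vs => P L vs || Q L vs).
Proof.
move=> hP hQ; apply: compb_ext (compb_not (compb_and (compb_not hP) (compb_not hQ))) => L vs.
by rewrite negb_and !negbK.
Qed.

Lemma compb_eq F G : polycomp F -> polycomp G -> polycompb (fun L vs => F L vs == G L vs).
Proof.
move=> hF hG; apply: compb_ext (compb_and (compb_leq hF hG) (compb_leq hG hF)) => L vs.
by rewrite eqn_leq.
Qed.

Lemma comp_if P F G : polycompb P -> polycomp F -> polycomp G ->
  polycomp (fun L vs => if P L vs then F L vs else G L vs).
Proof.
move=> hP hF hG.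
apply: comp_ext (comp_add (comp_mul hP hF) (comp_mul (compb_not hP) hG)) => L vs.
by case: (P L vs); rewrite !(mul1n, mul0n) ?addn0.
Qed.

Lemma compb_if P F G : polycompb P -> polycompb F -> polycompb G ->
  polycompb (fun L vs => if P L vs then F L vs else G L vs).
Proof.
by move=> hP hF hG; apply: comp_ext (comp_if hP hF hG) => L vs; case: (P L vs).
Qed.

Lemma divn_sum a b : 0 < b -> a %/ b = \sum_(i < a) (i.+1 * b <= a).
Proof.
move=> b0; rewrite (eq_bigr (fun i : 'I_a => nat_of_bool (i < a %/ b))); last first.
  by move=> i _; rewrite -leq_divRL.
have dl : a %/ b <= a by apply: leq_div.
rewrite -(big_mkord xpredT (fun i => nat_of_bool (i < a %/ b))) (big_cat_nat (leq0n _) dl) /=.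
rewrite [X in _ + X]big_nat_cond [X in _ + X]big1 ?addn0 => [|i]; last first.
  by rewrite andbT => /andP[h _]; rewrite ltnNge h.
by rewrite big_mkord (eq_bigr (fun=> 1)) ?sum1_card ?card_ord // => i _; rewrite ltn_ord.
Qed.

(** The quotient counts the positive multiples of the divisor up to the dividend. The factor [0 < G]
    is there for the convention that a quotient by 0 is 0. *)
Lemma comp_div F G : polycomp F -> polycomp G -> polycomp (fun L vs => F L vs %/ G L vs).
Proof.
move=> hF hG.
have h := compb_leq (comp_mul (comp_add (comp_const 1) (comp_var 0)) (comp_weaken hG)) (comp_weaken hF).
have g := comp_mul (compb_ltn (comp_const 0) hG) (comp_sum hF h).
apply: comp_ext g => L vs /=; case: (posnP (G L vs)) => [->|b0]; first by rewrite divn0.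
by rewrite mul1n (divn_sum _ b0).
Qed.

Lemma comp_mod F G : polycomp F -> polycomp G -> polycomp (fun L vs => F L vs %% G L vs).
Proof.
move=> hF hG; apply: comp_ext (comp_sub hF (comp_mul (comp_div hF hG) hG)) => L vs.
by rewrite {1}(divn_eq (F L vs) (G L vs)) addKn.
Qed.

Lemma compb_odd F : polycomp F -> polycompb (fun L vs => odd (F L vs)).
Proof. by move=> hF; apply: comp_ext (comp_mod hF (comp_const 2)) => L vs; rewrite modn2. Qed.

Lemma comp_nth E : polycomp E -> polycomp (fun L vs => nth 0 L (E L vs)).
Proof.
move=> hE.
have h := comp_sub (comp_prefix_sum (comp_add (comp_const 1) hE)) (comp_prefix_sum hE).
apply: comp_ext h => L vs; case: (ltnP (E L vs) (size L)) => hs.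
  by rewrite add1n (take_nth 0) // -cats1 sumn_cat /= addn0 addKn.
by rewrite nth_default // !take_oversize ?subnn //; lia.
Qed.

(** The exponent is itself a computed value, so an uncapped power would not be polynomially bounded.
    [X] exceeds the place value of every bit that is read. *)
Definition capped_pow2 X b := iter b (fun a => minn (2 * a) X) 1.

Lemma comp_pow2 F G : polycomp F -> polycomp G ->
  polycomp (fun L vs => capped_pow2 (F L vs) (G L vs)).
Proof.
by move=> hF hG; apply: (comp_iter hG hF (comp_const 1) (comp_mul (comp_const 2) (comp_var 0))).
Qed.

(* Position in [L] of the [j]-th clause. *)
Definition offset (L : seq nat) cap j := iter j (fun o => minn (o + 1 + 2 * nth 0 L o) cap) 2.

Lemma comp_offset F G : polycomp F -> polycomp G ->
  polycomp (fun L vs => offset L (F L vs) (G L vs)).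
Proof.
move=> hF hG; apply: (comp_iter hG hF (comp_const 2) (B := fun L vs => nth 0 vs 0 + 1 + 2 * nth 0 L (nth 0 vs 0))).
by apply: comp_add (comp_add (comp_var 0) (comp_const 1)) (comp_mul (comp_const 2) (comp_nth (comp_var 0))).
Qed.

Section WeightProgram.
Variables (L : seq nat) (k X cap : nat).
Let m := nth 0 L 1.
Definition code_blocks := 3 * m * k.
Definition code_free := code_blocks * X.
Definition code_hubs := code_free + code_blocks + m.
Definition code_size := 4 + 2 * code_hubs + code_free.
Definition code_prs t := t %% 3 < nth 0 L (offset L cap (t %/ 3)).
Definition code_vr t := nth 0 L (offset L cap (t %/ 3) + 1 + 2 * (t %% 3)).
Definition code_pl t := odd (nth 0 L (offset L cap (t %/ 3) + 2 + 2 * (t %% 3))).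
Definition code_bit i b := odd (i %/ capped_pow2 X b).
Definition code_reads j x := let t := x %/ X %/ k in
  [&& t %/ 3 == j, code_prs t & x %/ X %% k == code_vr t %% k].
Definition code_lit i x := code_bit i (code_vr (x %/ X %/ k) %/ k) == code_pl (x %/ X %/ k).
Definition code_pos h x : bool :=
  if h < code_free then x == h
  else if h < code_free + code_blocks then x %/ X == h - code_free
  else code_reads (h - (code_free + code_blocks)) x && code_lit (x %% X) x.
Definition code_neg h x : bool :=
  if h < code_free then (x == h.+1) && ~~ (x %% X == 0)
  else if h < code_free + code_blocks then x %/ X == (h - code_free + k) %% code_blocks
  else code_reads (h - (code_free + code_blocks)) x && ((0 < x %% X) && code_lit (x %% X - 1) x).
Definition code_coef h x : nat :=
  if code_pos h x then (if code_neg h x then 0 else 1) else if code_neg h x then 2 else 0.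
(** The case distinction of [game_weight] on data decoded from [L], with values as in [wcode]: 2
    stands for -1. *)
Definition code_weight u v : nat :=
  if u == 1 then (if (v == 2) || (v == 3) then 1 else 2)
  else if u == 3 then (if v == 1 then 2 else 0)
  else if u < 4 then 0
  else if u < 4 + code_hubs then
    (if v == 0 then nat_of_bool (u - 4 < code_free + code_blocks) else if v == 1 then 1
     else if v < 4 + 2 * code_hubs then 0
     else code_coef (u - 4) (v - (4 + 2 * code_hubs)))
  else if u < 4 + 2 * code_hubs then nat_of_bool ((v < 3) || (v == u - code_hubs))
  else 0.
End WeightProgram.

Section WeightComp.
Variables (k X cap : seq nat -> seq nat -> nat).
Hypotheses (hk : polycomp k) (hX : polycomp X) (hcap : polycomp cap).

Lemma comp_blocks : polycomp (fun L vs => code_blocks L (k L vs)).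
Proof. by apply: comp_mul hk; apply: comp_mul (comp_const _) (comp_nth (comp_const _)). Qed.

Lemma comp_free : polycomp (fun L vs => code_free L (k L vs) (X L vs)).
Proof. exact: comp_mul comp_blocks hX. Qed.

Lemma comp_hubs : polycomp (fun L vs => code_hubs L (k L vs) (X L vs)).
Proof. exact: comp_add (comp_add comp_free comp_blocks) (comp_nth (comp_const _)). Qed.

Lemma comp_size : polycomp (fun L vs => code_size L (k L vs) (X L vs)).
Proof. exact: comp_add (comp_add (comp_const 4) (comp_mul (comp_const 2) comp_hubs)) comp_free. Qed.

Lemma compb_eqb P Q : polycompb P -> polycompb Q -> polycompb (fun L vs => P L vs == Q L vs).
Proof.
move=> hP hQ; apply: compb_ext (compb_eq hP hQ) => L vs.
by case: (P L vs); case: (Q L vs).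
Qed.

Variables (h x : seq nat -> seq nat -> nat).
Hypotheses (hh : polycomp h) (hx : polycomp x).

Let time := fun L vs => x L vs %/ X L vs %/ k L vs.
Let htime : polycomp time.
Proof. exact: comp_div (comp_div hx hX) hk. Qed.
Let off := fun L vs => offset L (cap L vs) (time L vs %/ 3).
Let hoff : polycomp off.
Proof. exact: comp_offset hcap (comp_div htime (comp_const 3)). Qed.
Let hvr : polycomp (fun L vs => code_vr L (cap L vs) (time L vs)).
Proof.
exact: comp_nth (comp_add (comp_add hoff (comp_const 1)) (comp_mul (comp_const 2) (comp_mod htime (comp_const 3)))).
Qed.
Let hprs : polycompb (fun L vs => code_prs L (cap L vs) (time L vs)).
Proof. exact: compb_ltn (comp_mod htime (comp_const 3)) (comp_nth hoff). Qed.
Let hpl : polycompb (fun L vs => code_pl L (cap L vs) (time L vs)).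
Proof.
exact: compb_odd (comp_nth (comp_add (comp_add hoff (comp_const 2)) (comp_mul (comp_const 2) (comp_mod htime (comp_const 3))))).
Qed.

Let hlit i : polycomp i ->
  polycompb (fun L vs => code_lit L (k L vs) (X L vs) (cap L vs) (i L vs) (x L vs)).
Proof.
move=> hi; apply: compb_eqb hpl; apply: compb_odd; apply: comp_div hi _.
exact: comp_pow2 hX (comp_div hvr hk).
Qed.

Let hreads j : polycomp j ->
  polycompb (fun L vs => code_reads L (k L vs) (X L vs) (cap L vs) (j L vs) (x L vs)).
Proof.
move=> hj; apply: compb_and (compb_eq (comp_div htime (comp_const 3)) hj) _.
apply: compb_and hprs _; exact: compb_eq (comp_mod (comp_div hx hX) hk) (comp_mod hvr hk).
Qed.

Lemma comp_code_pos :
  polycompb (fun L vs => code_pos L (k L vs) (X L vs) (cap L vs) (h L vs) (x L vs)).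
Proof.
apply: compb_if (compb_ltn hh comp_free) (compb_eq hx hh) _.
apply: compb_if (compb_ltn hh (comp_add comp_free comp_blocks)) (compb_eq (comp_div hx hX) (comp_sub hh comp_free)) _.
exact: compb_and (hreads (comp_sub hh (comp_add comp_free comp_blocks))) (hlit (comp_mod hx hX)).
Qed.

Lemma comp_code_neg :
  polycompb (fun L vs => code_neg L (k L vs) (X L vs) (cap L vs) (h L vs) (x L vs)).
Proof.
have h0 := comp_mod hx hX.
apply: compb_if (compb_ltn hh comp_free) (compb_and (compb_eq hx (comp_add (comp_const 1) hh)) (compb_not (compb_eq h0 (comp_const 0)))) _.
apply: compb_if (compb_ltn hh (comp_add comp_free comp_blocks)) _ _.
  exact: compb_eq (comp_div hx hX) (comp_mod (comp_add (comp_sub hh comp_free) hk) comp_blocks).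
apply: compb_and (hreads (comp_sub hh (comp_add comp_free comp_blocks))) _.
exact: compb_and (compb_ltn (comp_const 0) h0) (hlit (comp_sub h0 (comp_const 1))).
Qed.

Lemma comp_code_coef :
  polycomp (fun L vs => code_coef L (k L vs) (X L vs) (cap L vs) (h L vs) (x L vs)).
Proof.
exact: comp_if comp_code_pos (comp_if comp_code_neg (comp_const 0) (comp_const 1))
  (comp_if comp_code_neg (comp_const 2) (comp_const 0)).
Qed.

End WeightComp.

Lemma comp_code_weight k X cap u v :
  polycomp k -> polycomp X -> polycomp cap -> polycomp u -> polycomp v ->
  polycomp (fun L vs => code_weight L (k L vs) (X L vs) (cap L vs) (u L vs) (v L vs)).
Proof.
move=> hk hX hcap hu hv; have hH := comp_hubs hk hX.
have h2H := comp_add (comp_const 4) (comp_mul (comp_const 2) hH).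
have hu4 := comp_sub hu (comp_const 4).
have eqc F c : polycomp F -> polycompb (fun L vs => F L vs == c) by move=> hF; exact: compb_eq hF (comp_const c).
have ltc F c : polycomp F -> polycompb (fun L vs => F L vs < c) by move=> hF; exact: compb_ltn hF (comp_const c).
apply: comp_if (eqc _ 1 hu) (comp_if (compb_or (eqc _ 2 hv) (eqc _ 3 hv)) (comp_const 1) (comp_const 2)) _.
apply: comp_if (eqc _ 3 hu) (comp_if (eqc _ 1 hv) (comp_const 2) (comp_const 0)) _.
apply: comp_if (ltc _ 4 hu) (comp_const 0) _.
apply: comp_if (compb_ltn hu (comp_add (comp_const 4) hH)) _ _.
  apply: comp_if (eqc _ 0 hv) (compb_ltn hu4 (comp_add (comp_free hk hX) (comp_blocks hk))) _.
  apply: comp_if (eqc _ 1 hv) (comp_const 1) _.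
  apply: comp_if (compb_ltn hv h2H) (comp_const 0) _.
  exact: (comp_code_coef hk hX hcap hu4 (comp_sub hv h2H)).
apply: comp_if (compb_ltn hu h2H) _ (comp_const 0).
exact: compb_or (ltc _ 3 hv) (compb_eq hv (comp_sub hu hH)).
Qed.

(** * Reading the formula from its encoding *)

Definition clause_data (C : seq (nat * bool)) : seq nat :=
  size C :: flatten [seq [:: l.1; nat_of_bool l.2] | l <- C].

Definition cnf_nats nv cls : seq nat :=
  nv :: size cls :: flatten [seq clause_data C | C <- cls].

Definition lit_at (cls : seq (seq (nat * bool))) t :=
  nth (0, false) (nth [::] cls (t %/ 3)) (t %% 3).
(** Clauses with fewer than three literals leave times at which nothing is read; the default in
    [lit_at] is never consulted there. *)
Definition lit_present (cls : seq (seq (nat * bool))) t := t %% 3 < size (nth [::] cls (t %/ 3)).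
Definition lit_var cls t := (lit_at cls t).1.
Definition lit_pol cls t := (lit_at cls t).2.

Lemma size_enc_nats L : size L <= size (enc_nats L).
Proof. by elim: L => //= a L IH; rewrite size_cat /= addnS ltnS; apply: leq_trans IH (leq_addl _ _). Qed.

Section Formula.
Variables (nv : nat) (cls : seq (seq (nat * bool))) (cap : nat).
Let L := cnf_nats nv cls.
Hypothesis cap_ge : size L <= cap.

Definition prefix_len j := 2 + size (flatten [seq clause_data C | C <- take j cls]).

Lemma size_clause_data C : size (clause_data C) = 1 + 2 * size C.
Proof. by rewrite /= add1n; congr _.+1; elim: C => //= l C ->; lia. Qed.

Lemma nth_clause_data j i : j < size cls -> i < size (clause_data (nth [::] cls j)) ->
  nth 0 L (prefix_len j + i) = nth 0 (clause_data (nth [::] cls j)) i.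
Proof.
move=> jc ic; rewrite /L /cnf_nats /prefix_len -addnA add2n /=.
rewrite -{1}(cat_take_drop j cls) map_cat flatten_cat nth_cat.
rewrite ltnNge leq_addr /= addKn (drop_nth [::]) // map_cons.
by rewrite [flatten _]/= -cat_cons nth_cat ic.
Qed.

Lemma nth_header j : j < size cls -> nth 0 L (prefix_len j) = size (nth [::] cls j).
Proof. by move=> jc; rewrite -[prefix_len j]addn0 nth_clause_data. Qed.

Lemma prefix_lenS j : j < size cls ->
  prefix_len j.+1 = prefix_len j + 1 + 2 * size (nth [::] cls j).
Proof.
move=> jc; rewrite /prefix_len (take_nth [::]) // map_rcons -cats1 flatten_cat size_cat.
by rewrite [flatten [:: _]]/= cats0 size_clause_data; lia.
Qed.

Lemma prefix_len_le j : prefix_len j <= size L.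
Proof.
rewrite /prefix_len /L /= add2n !ltnS -{2}(cat_take_drop j cls) map_cat flatten_cat size_cat.
exact: leq_addr.
Qed.

(** Offsets never pass the length of [L], so the cap has no effect. *)
Lemma offset_prefix j : j <= size cls -> offset L cap j = prefix_len j.
Proof.
elim: j => [|j IH] jc; first by rewrite /prefix_len take0.
rewrite /offset iterS -/(offset L cap j) IH 1?ltnW // nth_header //.
rewrite -prefix_lenS //; apply/minn_idPl.
exact: leq_trans (prefix_len_le _) cap_ge.
Qed.

Lemma code_prsE t : t %/ 3 < size cls -> code_prs L cap t = lit_present cls t.
Proof.
move=> tc; rewrite /code_prs (offset_prefix (ltnW tc)).
by rewrite nth_header.
Qed.

Lemma nth_pairs C i : i < size C ->
  nth 0 (clause_data C) (1 + 2 * i) = (nth (0, false) C i).1 /\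
  nth 0 (clause_data C) (2 + 2 * i) = nat_of_bool (nth (0, false) C i).2.
Proof.
rewrite add1n add2n /clause_data; elim: C i => [|l C IH] [|i] // iC.
rewrite (_ : 2 * i.+1 = (2 * i).+2) /=; last by lia.
exact: IH.
Qed.

Lemma code_litE t : t %/ 3 < size cls -> lit_present cls t ->
  code_vr L cap t = lit_var cls t /\ code_pl L cap t = lit_pol cls t.
Proof.
move=> tc pt; rewrite /code_vr /code_pl (offset_prefix (ltnW tc)) -!addnA.
have [e1 e2] := nth_pairs pt.
rewrite !nth_clause_data ?size_clause_data //; try by move: pt; rewrite /lit_present; lia.
by rewrite e1 e2 oddb.
Qed.

Lemma capped_pow2E X b : 2 ^ b <= X -> capped_pow2 X b = 2 ^ b.
Proof.
elim: b => [|b IH] hb //; have h : 2 ^ b <= X by apply: leq_trans hb; rewrite leq_exp2l.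
by rewrite /capped_pow2 iterS -/(capped_pow2 X b) IH // -expnS; apply/minn_idPl.
Qed.

Hypothesis cnf : is3cnf nv cls.

Lemma lit_var_lt t : lit_present cls t -> lit_var cls t < nv.
Proof.
rewrite /lit_present => pt; have tc : t %/ 3 < size cls.
  by rewrite ltnNge; apply/negP => h; move: pt; rewrite nth_default.
have /andP[_ /allP h] := allP cnf _ (mem_nth [::] tc).
exact: h _ (mem_nth _ pt).
Qed.

Variables (k s : nat).
Hypotheses (k_gt0 : 0 < k) (nv_le : nv <= k * s).
Let X := 2 ^ s.
Let m := size cls.
Let prs := lit_present cls.
Let pl := lit_pol cls.
Let vr := lit_var cls.

Let X_gt0 : 0 < X. Proof. by rewrite expn_gt0. Qed.

Lemma time_lt x : x < nfree k X m -> x %/ X %/ k %/ 3 < m.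
Proof. by move=> xQ; rewrite !ltn_divLR // (mulnC m). Qed.

Lemma code_readsE j x : x < nfree k X m -> code_reads L k X cap j x = reads k X prs vr j x.
Proof.
move=> xQ; have t3 := time_lt xQ; rewrite /code_reads /reads code_prsE //.
case: (boolP (lit_present _ _)) => pt; last by rewrite /prs (negbTE pt).
by have [-> _] := code_litE t3 pt; rewrite /prs pt.
Qed.

(** A literal that is read has a variable below [nv], hence a bit index below [s], where the capped
    power is the true one. *)
Lemma code_lit_bit i j x : x < nfree k X m -> reads k X prs vr j x ->
  code_lit L k X cap i x = (bit_of i (vr (x %/ X %/ k) %/ k) == pl (x %/ X %/ k)).
Proof.
move=> xQ /and3P[_ pt _]; have [e1 e2] := code_litE (time_lt xQ) pt.
rewrite /code_lit /code_bit e1 e2 capped_pow2E // /X leq_exp2l //.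
rewrite ltnW // ltn_divLR // mulnC; apply: leq_trans (lit_var_lt pt) nv_le.
Qed.

Lemma code_posE h x : x < nfree k X m -> code_pos L k X cap h x = pos_coef k X m prs pl vr h x.
Proof.
move=> xQ; rewrite /code_pos /pos_coef.
rewrite -[code_free _ _ _]/(nfree k X m) -[code_blocks _ _]/(nblocks k m).
case: ifP => _ //; case: ifP => _ //; rewrite code_readsE //.
by case rd: (reads _ _ _ _ _ _) => //=; rewrite (code_lit_bit _ xQ rd).
Qed.

Lemma code_negE h x : x < nfree k X m -> code_neg L k X cap h x = neg_coef k X m prs pl vr h x.
Proof.
move=> xQ; rewrite /code_neg /neg_coef.
rewrite -[code_free _ _ _]/(nfree k X m) -[code_blocks _ _]/(nblocks k m).
case: ifP => _ //; case: ifP => _ //; rewrite code_readsE //.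
by case rd: (reads _ _ _ _ _ _) => //=; rewrite (code_lit_bit _ xQ rd) subn1.
Qed.

Let H := nhubs k X m.
Let n := 4 + 2 * H + nfree k X m.
Let gw u v := game_weight H (slack k X m) (coef k X m prs pl vr) u v.

Lemma code_weightE u v : u < n -> v < n -> code_weight L k X cap u v = wcode (gw u v).
Proof.
move=> un vn; rewrite /code_weight /gw /game_weight.
rewrite -[code_hubs _ _ _]/H -[code_free _ _ _]/(nfree k X m) -[code_blocks _ _]/(nblocks k m).
case: ifP => _; first by case: ifP.
case: ifP => _; first by case: ifP.
case: ifP => _ //; case: ifP => _.
  case: ifP => _; first by rewrite /slack; case: ltnP.
  case: ifP => _ //; case: ltnP => vH //.
  have xQ : v - (4 + 2 * H) < nfree k X m by rewrite ltn_subLR.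
  rewrite /code_coef code_posE // code_negE // /coef.
  by case: pos_coef; case: neg_coef.
by case: ifP => _ //; case: (_ || _).
Qed.

Lemma weights_pm1_instance : weights_pm1 (fun i j : 'I_n => gw i j).
Proof.
move=> i j; rewrite /gw /game_weight.
do 2 (case: ifP => _; first by case: ifP; auto).
case: ifP => _; first by auto.
case: ifP => _.
  case: ifP => _; first by case: slack; auto.
  case: ifP => _; first by auto.
  case: ifP => _; first by auto.
  by rewrite /coef; case: pos_coef; case: neg_coef; rewrite ?subrr; auto.
case: ifP => _; last by auto.
by case: ifP; auto.
Qed.

Lemma satisfiable_assignment : (exists al, assignment_ok m prs pl vr al) <-> satisfiable cls.
Proof.
have div3 j l : l < 3 -> (3 * j + l) %/ 3 = j /\ (3 * j + l) %% 3 = l.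
  by move=> l3; rewrite mulnC divnMDl // divn_small // addn0 modnMDl modn_small.
split=> -[al hal]; exists al.
  apply/(all_nthP [::]) => j jm; have [l l3] := hal j jm.
  rewrite /prs /vr /pl /lit_present /lit_var /lit_pol /lit_at.
  have [-> ->] := div3 j l l3 => /andP[lC e].
  by apply/(has_nthP (0, false)); exists l.
move=> j jm; have /(all_nthP [::]) /(_ j jm) /(has_nthP (0, false)) [l lC e] := hal.
have l3 : l < 3.
  by have /andP[h _] := allP cnf _ (mem_nth [::] jm); apply: leq_trans lC h.
exists l => //; rewrite /prs /vr /pl /lit_present /lit_var /lit_pol /lit_at.
by have [-> ->] := div3 j l l3; rewrite lC.
Qed.

Lemma instance_correct : has_connected_NS (fun i j : 'I_n => gw i j) <-> satisfiable cls.
Proof.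
rewrite -satisfiable_assignment -(@constraints_correct k X m prs pl vr nv s erefl k_gt0 nv_le lit_var_lt).
rewrite /gw (game_correct H (nfree k X m)); last first.
  by move=> h x; rewrite /coef; case: pos_coef; case: neg_coef.
split=> -[y hy]; exists y => h hh; have := hy h hh; by rewrite big_mkord.
Qed.

Lemma pathwidth_instance : pw_le (fun i j : 'I_n => gw i j) (6 * k + 9).
Proof. exact: pathwidth_le. Qed.

End Formula.

Lemma enc_gameE n (f : nat -> nat -> int) (g : nat -> nat -> nat) :
  (forall i j, i < n -> j < n -> g i j = wcode (f i j)) ->
  enc_game (fun i j : 'I_n => f i j) = enc_nats (n :: [seq g i j | i <- iota 0 n, j <- iota 0 n]).
Proof.
move=> h; rewrite /enc_game; congr (enc_nats (n :: _)).
rewrite -val_enum_ord allpairs_mapl allpairs_mapr.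
apply: eq_allpairs => i j; exact: esym (h _ _ (ltn_ord i) (ltn_ord j)).
Qed.

(** * The program writing the game *)

Definition regs (l : seq (seq bool)) : store := fun r => nth [::] l r.

Lemma enc_nats_cat s1 s2 : enc_nats (s1 ++ s2) = enc_nats s1 ++ enc_nats s2.
Proof. by elim: s1 => //= a s IH; rewrite IH -catA. Qed.

Ltac cells n r := lazymatch n with
  | O => idtac
  | S ?m => destruct r as [|r]; [ | cells m r]
  end.

Ltac store_eq := apply: functional_extensionality; let r := fresh "r" in intro r;
  rewrite /regs /addto /setst /io_store; cells constr:(13) r; rewrite /= ?nth_nil //=.

Lemma clear_anyP i st : execle (clear i) st (setst st i [::]) (size (st i) * 2).+1.
Proof.
have := @execle_loop i Skip Skip (rev (st i)) (fun k => setst st i (rev (drop k (rev (st i))))) 1.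
have e0 : setst st i (rev (drop 0 (rev (st i)))) = st by rewrite drop0 revK setst_id.
rewrite drop_size size_rev e0; apply=> //; first by rewrite revK.
- by move=> k ks; rewrite if_same setst_setst; apply: execle_skip.
- by move=> k _; rewrite setst_same.
Qed.

Section Program.
Variables (gs gn gw : nat -> nat -> seq nat -> cmd) (Ds Dn Dw : nat).
Hypothesis gsP : computes_with gs (fun L vs => nth 0 L 0 %/ nth 0 vs 0 + 1) Ds.
Hypothesis gnP : computes_with gn (fun L vs => code_size L (nth 0 vs 0) (nth 0 vs 1)) Dn.
Hypothesis gwP : computes_with gw (fun L vs =>
  code_weight L (nth 0 vs 2) (nth 0 vs 3) (nth 0 vs 4) (nth 0 vs 0) (nth 0 vs 1)) Dw.

(* Registers: 0 input, then output; 1 the input reversed; 3 = k; 4 = input length;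
   5 = X; 6 = n; 7, 8 = current row and column; 9, 10 = loop counters; 11 = scratch. *)
Definition load_input := Loop 0 (CSeq (Push 1 false) (Push 4 true)) (CSeq (Push 1 true) (Push 4 true)).
Definition double_power := CSeq (moves 5 [:: 11; 11]) (moves 11 [:: 5]).
Definition powers := CSeq (Push 5 true) (Loop 9 Skip double_power).
Definition write_size := CSeq (moves 6 [:: 0; 9; 11]) (CSeq (moves 11 [:: 6]) (Push 0 false)).
(** The weight is computed straight onto the output stack, where the pushed zero closes its unary
    block. *)
Definition write_entry := CSeq (gw 0 12 [:: 7; 8; 3; 5; 4]) (CSeq (Push 0 false) (Push 8 true)).
Definition write_row := CSeq (moves 6 [:: 10; 11]) (CSeq (moves 11 [:: 6])
  (CSeq (Loop 10 Skip write_entry) (CSeq (clear 8) (Push 7 true)))).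
Definition cleanup := CSeq (clear 1) (CSeq (clear 3) (CSeq (clear 4) (CSeq (clear 5)
  (CSeq (clear 6) (clear 7))))).
Definition program k := CSeq load_input (CSeq (pushes (nseq k 3)) (CSeq (gs 9 12 [:: 3])
  (CSeq powers (CSeq (gn 6 12 [:: 3; 5]) (CSeq write_size (CSeq (Loop 9 Skip write_row) cleanup)))))).

Variables (L : seq nat) (k : nat).
Let x := enc_nats L.
Let s := nth 0 L 0 %/ k + 1.
Let X := 2 ^ s.
Let n := code_size L k X.
Let W := code_weight L k X (size x).
Let M := size x + k + X + 2.
Let u m := nseq m true.

Let state out c5 c6 c7 c8 c9 c10 : store :=
  regs [:: out; rev x; [::]; u k; u (size x); c5; c6; c7; c8; c9; c10].

Let M1 : 1 < M. Proof. by rewrite /M addn2. Qed.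
Let xM : size x <= M. Proof. by rewrite /M; lia. Qed.
Let kM : k <= M. Proof. by rewrite /M; lia. Qed.
Let XM : X <= M. Proof. by rewrite /M; lia. Qed.

Lemma load_input_run : execle load_input (io_store x)
  (regs [:: [::]; rev x; [::]; [::]; u (size x)]) (size x * 4).+1.
Proof.
have := @execle_loop 0 (CSeq (Push 1 false) (Push 4 true)) (CSeq (Push 1 true) (Push 4 true)) (rev x)
  (fun j => regs [:: rev (drop j (rev x)); take j (rev x); [::]; [::]; u j]) 3.
rewrite drop_size take_size size_rev drop0 revK take0.
have -> : regs [:: x; [::]; [::]; [::]; u 0] = io_store x by store_eq.
apply=> // j jx.
have E : regs [:: rev (drop j.+1 (rev x)); take j.+1 (rev x); [::]; [::]; u j.+1] =
  setst (setst (setst (regs [:: rev (drop j (rev x)); take j (rev x); [::]; [::]; u j]) 0 (rev (drop j.+1 (rev x))))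
    1 (rcons (take j (rev x)) (nth false (rev x) j))) 4 (rcons (u j) true).
  store_eq; first by rewrite (take_nth false) ?size_rev.
  by rewrite /u -cats1 -(nseqD j 1) addn1.
by case: (nth _ _ _) E => ->; apply: execle_seq (execle_push (ltn0Sn 0) erefl) (execle_push (ltn0Sn 0) erefl) _.
Qed.

Lemma double_power_run c9 j : execle double_power (state [::] (u j) [::] [::] [::] c9 [::])
  (state [::] (u (2 * j)) [::] [::] [::] c9 [::]) (14 * j + 5).
Proof.
have e1 := @movesP 5 [:: 11; 11] j (state [::] (u j) [::] [::] [::] c9 [::]) erefl erefl.
have := @movesP 11 [:: 5] (2 * j)
  (regs [:: [::]; rev x; [::]; u k; u (size x); [::]; [::]; [::]; [::]; c9; [::]; u (2 * j)]) erefl erefl.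
set s1 := (fun r => _) => e2.
have E1 : s1 = state [::] (u (2 * j)) [::] [::] [::] c9 [::].
  by rewrite /s1 /state; store_eq; rewrite ?muln0 ?cats0 // muln1.
rewrite E1 in e2.
apply: execle_seq e1 _ _; last by instantiate (1 := (2 * j * 4).+1); rewrite /=; lia.
move: e2; congr execle; rewrite /state; store_eq; rewrite ?muln0 ?cats0 // mulnC //.
Qed.

Lemma powers_run : execle powers (state [::] [::] [::] [::] [::] (u s) [::])
  (state [::] (u X) [::] [::] [::] [::] [::]) (s * (14 * X + 6) + 3).
Proof.
have e1 := @execle_push 5 true (state [::] [::] [::] [::] [::] (u s) [::])
  (state [::] (u 1) [::] [::] [::] (u s) [::]) 1 isT.
have := @execle_count 9 Skip double_power s
  (fun j => state [::] (u (2 ^ j)) [::] [::] [::] (u (s - j)) [::]) (14 * X + 5).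
rewrite subn0 subnn => e2.
apply: execle_seq (e1 _) (e2 _ _) _; first by rewrite /state; store_eq.
- move=> j js; apply: execle_le (_ : execle _ _ _ (14 * 2 ^ j + 5)) _; last first.
    by rewrite leq_add2r leq_mul2l /X leq_exp2l // ltnW.
  rewrite expnS; have := double_power_run (u (s - j.+1)) (2 ^ j).
  by congr execle; rewrite /state; store_eq.
- by move=> j js.
- by rewrite addn1; lia.
Qed.

Lemma write_size_run : execle write_size (state [::] (u X) (u n) [::] [::] [::] [::])
  (state (enc_nats [:: n]) (u X) (u n) [::] [::] (u n) [::]) (12 * n + 6).
Proof.
have e1 := @movesP 6 [:: 0; 9; 11] n (state [::] (u X) (u n) [::] [::] [::] [::]) erefl erefl.
have e2 := @movesP 11 [:: 6] n
  (regs [:: u n; rev x; [::]; u k; u (size x); u X; [::]; [::]; [::]; u n; [::]; u n]) erefl erefl.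
have e3 := @execle_push 0 false (state (u n) (u X) (u n) [::] [::] (u n) [::])
  (state (enc_nats [:: n]) (u X) (u n) [::] [::] (u n) [::]) 1 isT.
apply: execle_seq e1 (execle_seq _ (e3 _) (ltnSn _)) _; last first.
- by instantiate (1 := (n * 4).+1); rewrite /=; lia.
- by rewrite /state; store_eq; rewrite cats1.
move: e2; congr execle; rewrite /state; store_eq; by rewrite ?muln0 ?cats0 ?muln1.
Qed.

Let n_le : n <= M ^ (Dn + 1).
Proof.
have r : ready L [:: 3; 5] [:: k; X] 12 6 (state [::] (u X) [::] [::] [::] [::] [::]).
  by split=> //; do 12 (case=> //).
have [|b _] := gnP M1 xM _ r; first by rewrite /= kM XM.
by apply: leq_trans b _; apply: leq_exp2 => //; lia.
Qed.

Let N := M ^ (Dn + 1).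

Let MN : M <= N. Proof. by rewrite -{1}(expn1 M); apply: leq_exp2 => //; lia. Qed.

Lemma write_entry_run out c9 i j : i < n -> j < n ->
  execle write_entry (state out (u X) (u n) (u i) (u j) c9 (u (n - j.+1)))
    (state (out ++ enc_nats [:: W i j]) (u X) (u n) (u i) (u j.+1) c9 (u (n - j.+1))) (N ^ Dw + 4).
Proof.
move=> ilt jlt.
set st := state _ _ _ _ _ _ _.
have r : ready L [:: 7; 8; 3; 5; 4] [:: i; j; k; X; size x] 12 0 st.
  by split=> //; do 12 (case=> //).
have N1 : 1 < N by apply: leq_trans M1 MN.
have [||_ e1] := gwP N1 _ _ r.
- exact: leq_trans xM MN.
- rewrite /= (leq_trans (ltnW ilt) n_le) (leq_trans (ltnW jlt) n_le).
  by rewrite (leq_trans kM MN) (leq_trans XM MN) (leq_trans xM MN).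
rewrite /= -/(W i j) in e1.
have e2 := @execle_push 0 false (addto st 0 (W i j))
  (state (out ++ enc_nats [:: W i j]) (u X) (u n) (u i) (u j) c9 (u (n - j.+1))) 1 isT.
apply: execle_seq e1 (execle_seq (e2 _) (execle_push (ltn0Sn 0) _) (ltnSn _)) _; last by lia.
- by rewrite /st /state; store_eq; rewrite rcons_cat cats1.
- by rewrite /state; store_eq; rewrite -cats1 -(nseqD j 1) addn1.
Qed.

Lemma write_row_run out c9 i : i < n ->
  execle write_row (state out (u X) (u n) (u i) [::] c9 [::])
    (state (out ++ enc_nats [seq W i j | j <- iota 0 n]) (u X) (u n) (u i.+1) [::] c9 [::])
    (n * (N ^ Dw + 17) + 10).
Proof.
move=> ilt.
have e1 := @movesP 6 [:: 10; 11] n (state out (u X) (u n) (u i) [::] c9 [::]) erefl erefl.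
have e2 := @movesP 11 [:: 6] n
  (regs [:: out; rev x; [::]; u k; u (size x); u X; [::]; u i; [::]; c9; u n; u n]) erefl erefl.
have e3 := @execle_count 10 Skip write_entry n
  (fun j => state (out ++ enc_nats [seq W i a | a <- iota 0 j]) (u X) (u n) (u i) (u j) c9 (u (n - j))) (N ^ Dw + 4).
have {}e3 := e3 _ (fun _ _ => erefl).
rewrite subn0 subnn in e3.
set out' := out ++ enc_nats [seq W i a | a <- iota 0 n] in e3 *.
have e4 := @clearP 8 n (state out' (u X) (u n) (u i) (u n) c9 [::]) erefl.
apply: execle_seq e1 (execle_seq (t1 := (n * 4).+1) _ (execle_seq (e3 _) (execle_seq e4 (execle_push (ltn0Sn 0) _) (ltnSn _)) (ltnSn _)) (ltnSn _)) _.
- move: e2; congr execle; rewrite /state; store_eq; by rewrite ?cats0 ?muln0 ?muln1 ?cats0.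
- move=> j jn; have := write_entry_run (out ++ enc_nats [seq W i a | a <- iota 0 j]) c9 ilt jn.
  rewrite -catA -enc_nats_cat -[[:: W i j]]/(map (W i) [:: j]) -map_cat -(iotaD 0 j 1) addn1.
  by congr execle; rewrite /state; store_eq.
- by rewrite /state; store_eq; rewrite /u -cats1 -(nseqD i 1) addn1.
- rewrite /=; lia.
Qed.

Lemma rows_run : execle (Loop 9 Skip write_row) (state (enc_nats [:: n]) (u X) (u n) [::] [::] (u n) [::])
  (state (enc_nats (n :: [seq W i j | i <- iota 0 n, j <- iota 0 n])) (u X) (u n) (u n) [::] [::] [::])
  (n * (n * (N ^ Dw + 17) + 11)).+1.
Proof.
have := @execle_count 9 Skip write_row n
  (fun i => state (enc_nats (n :: [seq W a b | a <- iota 0 i, b <- iota 0 n])) (u X) (u n) (u i) [::] (u (n - i)) [::])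
  (n * (N ^ Dw + 17) + 10).
rewrite subn0 subnn -addnA addn1; apply=> // i ilt.
have := write_row_run (enc_nats (n :: [seq W a b | a <- iota 0 i, b <- iota 0 n])) (u (n - i.+1)) ilt.
rewrite -enc_nats_cat cat_cons (_ : _ ++ _ = [seq W a b | a <- iota 0 i.+1, b <- iota 0 n]).
  by congr execle; rewrite /state; store_eq.
by rewrite -addn1 iotaD map_cat flatten_cat /= cats0.
Qed.

Lemma cleanup_run y : execle cleanup (state y (u X) (u n) (u n) [::] [::] [::])
  (io_store y) (2 * (size x + k + size x + X + n + n) + 11).
Proof.
have c i st st' : st' = setst st i [::] -> execle (clear i) st st' (size (st i) * 2).+1.
  by move=> ->; apply: clear_anyP.
have e1 := c 1 (state y (u X) (u n) (u n) [::] [::] [::])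
  (regs [:: y; [::]; [::]; u k; u (size x); u X; u n; u n]).
have e2 := c 3 (regs [:: y; [::]; [::]; u k; u (size x); u X; u n; u n])
  (regs [:: y; [::]; [::]; [::]; u (size x); u X; u n; u n]).
have e3 := c 4 (regs [:: y; [::]; [::]; [::]; u (size x); u X; u n; u n])
  (regs [:: y; [::]; [::]; [::]; [::]; u X; u n; u n]).
have e4 := c 5 (regs [:: y; [::]; [::]; [::]; [::]; u X; u n; u n])
  (regs [:: y; [::]; [::]; [::]; [::]; [::]; u n; u n]).
have e5 := c 6 (regs [:: y; [::]; [::]; [::]; [::]; [::]; u n; u n])
  (regs [:: y; [::]; [::]; [::]; [::]; [::]; [::]; u n]).
have e6 := c 7 (regs [:: y; [::]; [::]; [::]; [::]; [::]; [::]; u n]) (io_store y).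
apply: execle_seq (e1 _) (execle_seq (e2 _) (execle_seq (e3 _) (execle_seq (e4 _) (execle_seq (e5 _) (e6 _) (ltnSn _)) (ltnSn _)) (ltnSn _)) (ltnSn _)) _;
  try by rewrite /state; store_eq.
by rewrite /= size_rev /u !size_nseq -[_.+4]/n; lia.
Qed.

Lemma program_run :
  execle (program k) (io_store x)
    (io_store (enc_nats (n :: [seq W i j | i <- iota 0 n, j <- iota 0 n])))
    (M ^ (3 * (Ds + (Dn + 1) * (Dw + 1)) + 10)).
Proof.
have e2 := pushesP (nseq k 3) (regs [:: [::]; rev x; [::]; [::]; u (size x)]).
have {}e2 : execle (pushes (nseq k 3)) (regs [:: [::]; rev x; [::]; [::]; u (size x)])
    (state [::] [::] [::] [::] [::] [::] [::]) (2 * k).+1.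
  move: e2; rewrite size_nseq; congr execle; rewrite /state; store_eq;
    by rewrite count_nseq /= ?mul1n ?mul0n ?cats0.
have r3 : ready L [:: 3] [:: k] 12 9 (state [::] [::] [::] [::] [::] [::] [::]).
  by split=> //; do 12 (case=> //).
have [|b3 e3] := gsP M1 xM _ r3; first by rewrite /= kM.
rewrite /= -/s in b3 e3.
have E3 : addto (state [::] [::] [::] [::] [::] [::] [::]) 9 s = state [::] [::] [::] [::] [::] (u s) [::].
  by rewrite /state; store_eq.
rewrite E3 in e3.
have r4 : ready L [:: 3; 5] [:: k; X] 12 6 (state [::] (u X) [::] [::] [::] [::] [::]).
  by split=> //; do 12 (case=> //).
have [|b4 e4] := gnP M1 xM _ r4; first by rewrite /= kM XM.
rewrite /= -/n in b4 e4.
have E4 : addto (state [::] (u X) [::] [::] [::] [::] [::]) 6 n = state [::] (u X) (u n) [::] [::] [::] [::].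
  by rewrite /state; store_eq.
rewrite E4 in e4.
apply: execle_seq load_input_run (execle_seq e2 (execle_seq e3 (execle_seq powers_run (execle_seq e4
  (execle_seq write_size_run (execle_seq rows_run (cleanup_run _) (ltnSn _)) (ltnSn _)) (ltnSn _)) (ltnSn _)) (ltnSn _)) (ltnSn _)) _.
set E := Ds + (Dn + 1) * (Dw + 1).
have [] := poly_bound E M1.
have t1 : M ^ Ds <= M ^ E by apply: leq_exp2 => //; rewrite /E; lia.
have t2 : M ^ Dn <= M ^ E by apply: leq_exp2 => //; rewrite /E; nia.
have t3 : N <= M ^ E by apply: leq_exp2 => //; rewrite /E; nia.
have t4 : N ^ Dw <= M ^ E by rewrite /N -expnM; apply: leq_exp2 => //; rewrite /E; nia.
move: t1 t2 t3 t4; set Y := M ^ E => t1 t2 t3 t4 Y0 _ _ hY.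
have MY : M <= Y := leq_trans MN t3.
have nY : n <= Y := leq_trans n_le t3.
have sX : s < X by apply: ltn_expl.
have B3 := hY Y Y Y (leqnn _) (leqnn _) (leqnn _).
have Y1 : Y <= Y * Y by rewrite leq_pmulr.
have Y2 : Y * Y <= Y * Y * Y by rewrite leq_pmulr.
have B4 : s * (14 * X + 6) <= Y * (20 * Y) by apply: leq_mul; lia.
have B5 : n * (N ^ Dw + 17) <= Y * (18 * Y) by apply: leq_mul; lia.
have B6 : n * (n * (N ^ Dw + 17) + 11) <= Y * (Y * (18 * Y) + 11) by apply: leq_mul => //; lia.
have xY := leq_trans xM MY; have kY := leq_trans kM MY; have XY := leq_trans XM MY.
move: (s * _) B4 => p4 B4; move: (n * (_ + 11)) B6 => p6 B6.
apply: leq_trans B3; move: B4 B6 nY t1 t2 xY kY XY Y0 Y1 Y2.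
move: (M ^ Ds) (M ^ Dn) (size x) (X) (n) (Y) => q1 q2 q3 q4 q5 q6; clear; lia.
Qed.

End Program.

(** * Running times *)

Definition exponent nv k := nv %/ k + 1.
Definition game_size nv (cls : seq (seq (nat * bool))) k :=
  let X := 2 ^ exponent nv k in
  4 + 2 * nhubs k X (size cls) + nfree k X (size cls).
Definition game_of nv (cls : seq (seq (nat * bool))) k :
    'I_(game_size nv cls k) -> 'I_(game_size nv cls k) -> int :=
  let X := 2 ^ exponent nv k in let m := size cls in
  fun i j => game_weight (nhubs k X m) (slack k X m)
    (coef k X m (lit_present cls) (lit_pol cls) (lit_var cls)) i j.

Lemma nv_le_exponent nv k : 0 < k -> nv <= k * exponent nv k.
Proof. by move=> k0; rewrite /exponent addn1 mulnC ltnW // ltn_ceil. Qed.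

(** [k] enters the program only through the pushes that load register 3, and the time bound only
    through its base, so [D] can precede it. *)
Theorem reduction : exists D, forall k (M : TM), 0 < k -> exists (M' : TM) (C : nat),
  forall nv cls t2 P, is3cnf nv cls -> decides_at M (enc_game (@game_of nv cls k)) t2 P ->
  exists2 t, t <= C * (size (enc_cnf nv cls) + k + 2 ^ exponent nv k + 2) ^ D + t2 &
    decides_at M' (enc_cnf nv cls) t P.
Proof.
have [gs [Ds hs]] : polycomp (fun L vs => nth 0 L 0 %/ nth 0 vs 0 + 1).
  exact: comp_add (comp_div (comp_nth (comp_const 0)) (comp_var 0)) (comp_const 1).
have [gn [Dn hn]] : polycomp (fun L vs => code_size L (nth 0 vs 0) (nth 0 vs 1)).
  exact: comp_size (comp_var 0) (comp_var 1).
have [gw [Dw hw]] : polycomp (fun L vs =>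
    code_weight L (nth 0 vs 2) (nth 0 vs 3) (nth 0 vs 4) (nth 0 vs 0) (nth 0 vs 1)).
  exact: (comp_code_weight (comp_var 2) (comp_var 3) (comp_var 4) (comp_var 0) (comp_var 1)).
pose D := 3 * (Ds + (Dn + 1) * (Dw + 1)) + 10.
(* The factor 2 is the quadratic cost of the compilation; the summand 2 absorbs the input length
   added to the time. *)
exists (2 * (D + 2)) => k M k0.
have [M' [C hC]] := stack_program_decides (program gs gn gw k) M.
exists M', C => nv cls t2 P cnf dec.
have [t e lt] := program_run hs hn hw (cnf_nats nv cls) k.
have cap : size (cnf_nats nv cls) <= size (enc_nats (cnf_nats nv cls)) by apply: size_enc_nats.
have E := enc_gameE (fun i j => code_weightE cap cnf k0 (nv_le_exponent nv k0) (u := i) (v := j)).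
have [t' lt' d'] := hC _ _ _ _ _ e (eq_rect _ (fun y => decides_at M y t2 P) dec _ E).
exists t' => //; apply: leq_trans lt' _; rewrite leq_add2r leq_mul2l; apply/orP; right.
rewrite mulnC expnM leq_exp2r // -[enc_cnf nv cls]/(enc_nats (cnf_nats nv cls)).
move: lt; rewrite -/D -[nth 0 _ 0]/nv -/(exponent nv k).
set s := size _; set B := s + k + _ + 2 => lt.
have B1 : 1 < B by rewrite /B addn2.
have h1 : B <= B ^ D * B by rewrite leq_pmull // expn_gt0; lia.
have h2 : 2 * (B ^ D * B) <= B ^ D * B * B by rewrite mulnC leq_mul2l B1 orbT.
have h3 : B ^ D <= B ^ D * B by rewrite leq_pmulr //; lia.
have sB : s < B by rewrite /B; lia.
by rewrite expnD (expnS B 1) expn1 mulnA; lia.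
Qed.

(** The running time of the assumed algorithm refers to the exact pathwidth, while the construction
    provides an upper bound; the least width is found by excluded middle. *)
Lemma exact_pathwidth n (w : 'I_n -> 'I_n -> int) p : pw_le w p ->
  exists2 q, q <= p & is_pathwidth w q.
Proof.
elim/ltn_ind: p => p IH hp.
case: (classic (exists2 q, q < p & pw_le w q)) => [[q qp hq]|none].
  have [r rq hr] := IH q qp hq; exists r => //; exact: leq_trans rq (ltnW qp).
exists p => //; split=> // q qp hq; apply: none; by exists q.
Qed.

Lemma decides_at_iff (M : TM) x t (P Q : Prop) : (P <-> Q) -> decides_at M x t P -> decides_at M x t Q.
Proof. by move=> PQ [c [h hc]]; exists c; split=> //; rewrite hc. Qed.

Lemma size_cls_le nv cls : size cls <= size (enc_cnf nv cls).
Proof. by rewrite /enc_cnf /= size_cat size_nseq /= size_cat size_nseq; lia. Qed.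

(** The 21 is 9 for free vertices and monotonicity hubs with anchors, 6 for comparison hubs, 2 for
    clause hubs, both with anchors, and 4 for the gadget. *)
Lemma game_size_le nv cls k : 0 < k ->
  game_size nv cls k <= 21 * k * (size (enc_cnf nv cls)).+1 * 2 ^ exponent nv k.
Proof.
move=> k0; have X0 : 0 < 2 ^ exponent nv k by rewrite expn_gt0.
have := size_cls_le nv cls; rewrite /game_size /nhubs /nfree /nblocks.
move: (size (enc_cnf _ _)) (size cls) (2 ^ _) X0 => z m X X0 mz.
apply: leq_trans (_ : 21 * k * m.+1 * X <= _); last by rewrite leq_mul2r leq_mul2l ltnS mz !orbT.
have h1 : k * m <= k * m * X by rewrite leq_pmulr.
have h2 : m <= k * m by rewrite leq_pmull.
have h3 : 1 <= k * X by rewrite muln_gt0 k0.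
have -> : 21 * k * m.+1 * X = 21 * (k * m * X) + 21 * (k * X) by rewrite mulnS; lia.
have -> : 3 * m * k * X = 3 * (k * m * X) by lia.
lia.
Qed.

(** * Real estimates *)

Local Open Scope R_scope.

Lemma INR_addn a b : INR (a + b)%N = INR a + INR b.
Proof. exact: plus_INR. Qed.

Lemma INR_muln a b : INR (a * b)%N = INR a * INR b.
Proof. exact: mult_INR. Qed.

Lemma INR_expn a b : INR (a ^ b)%N = INR a ^ b.
Proof. by elim: b => [|b IH] //; rewrite expnS INR_muln IH. Qed.

Lemma INR_le a b : (a <= b)%N -> INR a <= INR b.
Proof. by move=> /ssrnat.leP; apply: le_INR. Qed.

Lemma exp_le x y : x <= y -> exp x <= exp y.
Proof. by case=> [h|->]; [left; apply: exp_increasing | right]. Qed.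

Lemma exp_INR a x : exp (INR a * x) = exp x ^ a.
Proof.
elim: a => [|a IH]; first by rewrite Rmult_0_l exp_0.
by rewrite S_INR -tech_pow_Rmult -IH -exp_plus; congr exp; ring.
Qed.

Lemma pow2_le_exp nv k : (0 < k)%N -> INR (2 ^ exponent nv k)%N <= 2 * exp (INR nv / INR k).
Proof.
move=> k0; have kp : 0 < INR k by apply: lt_0_INR; apply/ssrnat.ltP.
rewrite INR_expn /exponent addn1 -[INR 2]/2 -tech_pow_Rmult.
apply: Rmult_le_compat_l; first lra.
apply: Rle_trans (_ : exp (INR (nv %/ k)) <= _).
  rewrite -[INR _]Rmult_1_r exp_INR; apply: pow_incr.
  have := exp_ineq1_le 1; lra.
apply: exp_le; apply: (Rmult_le_reg_r (INR k)) => //.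
rewrite /Rdiv Rmult_assoc Rinv_l; last lra.
by rewrite Rmult_1_r -INR_muln; apply: INR_le; apply: leq_divM.
Qed.

(** Put [r = nv / k]. Both [X] and [n] are polynomial in [z] times [exp r], and raising [exp r] to a
    power at most [k * ln c] stays below [c ^ nv]. The 42 is 21 times the 2 in the bound on [X]; the
    5 collects [z], [X] and the 2, at 1, 2 and 2. *)
Lemma total_time (c G : R) (k D K C F z nv X n : nat) :
  1 < c -> (0 < k)%N -> INR D <= INR k * ln c -> 0 <= G <= INR k * ln c -> G <= INR K ->
  INR X <= 2 * exp (INR nv / INR k) -> (0 < n)%N -> (n <= 21 * k * z.+1 * X)%N ->
  INR C * (INR z + INR k + INR X + 2) ^ D + INR F * Rpower (INR n) G <=
  Rpower c (INR nv) * (INR (C * (k + 5) ^ D + F * (42 * k) ^ K) * INR (z.+1 ^ (D + K))).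
Proof.
move=> c1 k0 Dk [G0 Gk] GK hX n0 hn.
have kp : 1 <= INR k by rewrite -[1]/(INR 1); apply: INR_le.
have z1 : 1 <= INR z.+1 by rewrite -[1]/(INR 1); apply: INR_le.
have lc : 0 < ln c by rewrite -ln_1; apply: ln_increasing; lra.
set r := INR nv / INR k in hX *.
have nv0 := pos_INR nv.
have r0 : 0 <= r by apply: Rmult_le_pos => //; left; apply: Rinv_0_lt_compat; lra.
have rk : r * INR k = INR nv by rewrite /r /Rdiv Rmult_assoc Rinv_l ?Rmult_1_r; lra.
have E1 : 1 <= exp r by rewrite -exp_0; apply: exp_le.
have scale a : a <= INR k * ln c -> exp (a * r) <= Rpower c (INR nv).
  move=> ha; rewrite /Rpower; apply: exp_le; rewrite -rk.
  have := Rmult_le_compat_r r _ _ r0 ha; lra.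
have b1 : (INR z + INR k + INR X + 2) ^ D <= INR ((k + 5) ^ D * z.+1 ^ D)%N * Rpower c (INR nv).
  apply: Rle_trans (_ : (INR (k + 5) * INR z.+1 * exp r) ^ D <= _).
    apply: pow_incr; split.
      have := pos_INR z; have := pos_INR X; lra.
    rewrite INR_addn -[INR 5]/(1 + 1 + 1 + 1 + 1) S_INR; rewrite S_INR in z1.
    have h : 1 <= (INR z + 1) * exp r by nra.
    have h2 : INR z + 1 <= (INR z + 1) * exp r by nra.
    have h3 : exp r <= (INR z + 1) * exp r by nra.
    nra.
  rewrite Rpow_mult_distr Rpow_mult_distr INR_muln !INR_expn -exp_INR.
  apply: Rmult_le_compat_l; last exact: scale.
  by rewrite -Rpow_mult_distr; apply: pow_le; apply: Rmult_le_pos; apply: pos_INR.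
have np : 1 <= INR n by rewrite -[1]/(INR 1); apply: INR_le.
have b2 : Rpower (INR n) G <= INR ((42 * k) ^ K * z.+1 ^ K)%N * Rpower c (INR nv).
  have A1 : 1 <= INR (42 * k * z.+1)%N.
    by rewrite -[1]/(INR 1); apply: INR_le; rewrite !muln_gt0 k0.
  apply: Rle_trans (_ : Rpower (INR (42 * k * z.+1) * exp r) G <= _).
    apply: Rle_Rpower_l => //; split; first lra.
    apply: Rle_trans (INR_le hn) _; rewrite !INR_muln.
    have -> : INR 42 = 42 by rewrite /=; lra.
    have -> : INR 21 = 21 by rewrite /=; lra.
    have h : 0 <= 21 * INR k * INR z.+1 by nra.
    have := Rmult_le_compat_l _ _ _ h hX; lra.
  rewrite -Rpower_mult_distr; [|lra|exact: exp_pos].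
  rewrite -expnMn INR_expn; apply: Rmult_le_compat.
  - by left; apply: exp_pos.
  - by left; apply: exp_pos.
  - rewrite -Rpower_pow; last lra.
    by apply: Rle_Rpower.
  - by rewrite {1}/Rpower ln_exp; apply: scale.
set V := Rpower c (INR nv) in b1 b2 *.
have V0 : 0 < V by apply: exp_pos.
have zz : forall a b, (a <= b)%N -> INR (z.+1 ^ a)%N <= INR (z.+1 ^ b)%N.
  by move=> a b ab; apply: INR_le; rewrite leq_pexp2l.
have zD := zz D (D + K)%N (leq_addr _ _); have zK := zz K (D + K)%N (leq_addl _ _).
rewrite INR_addn !INR_muln in b1 b2 *.
have c1' := Rmult_le_compat_l _ _ _ (pos_INR C) b1.
have c2' := Rmult_le_compat_l _ _ _ (pos_INR F) b2.
have d1 := Rmult_le_compat_l _ _ _ (Rmult_le_pos _ _ (Rmult_le_pos _ _ (pos_INR C) (pos_INR ((k + 5) ^ D)%N)) (Rlt_le _ _ V0)) zD.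
have d2 := Rmult_le_compat_l _ _ _ (Rmult_le_pos _ _ (Rmult_le_pos _ _ (pos_INR F) (pos_INR ((42 * k) ^ K)%N)) (Rlt_le _ _ V0)) zK.
lra.
Qed.

Lemma ln_pos x : 1 < x -> 0 < ln x.
Proof. by move=> x1; rewrite -ln_1; apply: ln_increasing; lra. Qed.

Lemma INR_ge1 n : (0 < n)%N -> 1 <= INR n.
Proof. by move=> n0; rewrite -[1]/(INR 1); apply: INR_le. Qed.

Lemma budget_mono V a b a' b' : 0 <= V -> 0 <= a -> 0 <= b -> a <= a' -> b <= b' ->
  V * (a * b) <= a' * V * b'.
Proof.
move=> V0 a0 b0 aa bb; rewrite (Rmult_comm a') Rmult_assoc.
by apply: Rmult_le_compat_l => //; apply: Rmult_le_compat.
Qed.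

Lemma exists_bound (g : nat -> R) N : exists2 B, 0 <= B & forall p, (p < N)%N -> g p <= B.
Proof.
elim: N => [|N [B B0 hB]]; first by exists 0; [lra | move=> p].
exists (Rmax B (g N)); first exact: Rle_trans B0 (Rmax_l _ _).
move=> p; rewrite ltnS leq_eqVlt => /orP[/eqP ->|pN]; first exact: Rmax_r.
exact: Rle_trans (hB _ pN) (Rmax_l _ _).
Qed.

Lemma exists_nat_ge (x : R) : exists k : nat, x <= INR k.
Proof.
have [k hk] := INR_unbounded x; exists k; lra.
Qed.

(** From 3 on [ln p] is at least 1, so [p / ln p] is at most [p]; the finitely many values before
    the threshold go into [B]. *)
Lemma sublinear g d : little_o_p_over_logp g -> 0 < d ->
  exists2 B, 0 <= B & forall p, Rabs (g p) <= B + d * INR p.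
Proof.
move=> hg d0; have [N hN] := hg d d0.
have [B B0 hB] := exists_bound (fun p => Rabs (g p)) (maxn N 3).
exists B => // p; have p0 := pos_INR p; case: (ltnP p (maxn N 3)) => hp.
  have := hB p hp; nra.
rewrite geq_max in hp; case/andP: hp => /hN hp p3.
have P3 : 3 <= INR p by have := INR_le p3; rewrite /=; lra.
have l1 : 1 <= ln (INR p).
  have h : exp 1 <= INR p by have := exp_le_3; lra.
  rewrite -[1]ln_exp; case: h => [h|<-]; last by right.
  by left; apply: ln_increasing h; apply: exp_pos.
have q : INR p / ln (INR p) <= INR p.
  apply: (Rmult_le_reg_r (ln (INR p))); first lra.
  rewrite /Rdiv Rmult_assoc Rinv_l; nra.
have := Rmult_le_compat_l _ _ _ (Rlt_le _ _ d0) q; lra.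
Qed.

Local Close Scope R_scope.

Theorem theorem11 :
  ETH ->
  forall (f : nat -> nat) (g : nat -> R),
    computable f -> little_o_p_over_logp g ->
    forall M : TM,
      ~ (forall (n : nat) (w : 'I_n -> 'I_n -> int) (p : nat),
           weights_pm1 w -> is_pathwidth w p ->
           exists t : nat,
             Rle (INR t) (Rmult (INR (f p)) (Rpower (INR n) (g p)))
             /\ decides_at M (enc_game w) t (has_connected_NS w)).
Proof.
case=> c [c1 eth] f g _ hg M hM.
have lc : Rlt R0 (ln c) by apply: ln_pos.
have [D hD] := reduction.
(* The 30 is twice 15: as [6 * k + 9] is at most [15 * k], the linear part of [G] takes at most half
   of [k * ln c], leaving the other half for [B]. *)
have [B B0 hB] : exists2 B, Rle R0 B &
    forall p, Rle (Rabs (g p)) (Rplus B (Rmult (Rdiv (ln c) 30) (INR p))).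
  by apply: sublinear hg _; lra.
(* Large enough that [k * ln c] bounds both [D], the exponent of the reduction, and [2 * B]. *)
have [k0 hk0] := exists_nat_ge (Rplus (Rdiv (INR D) (ln c)) (Rplus (Rdiv (Rmult 2 B) (ln c)) 1)).
pose k := k0.+1.
have kD : Rle (Rplus (INR D) (Rplus (Rmult 2 B) (ln c))) (Rmult (INR k) (ln c)).
  have h := Rmult_le_compat_r (ln c) _ _ (Rlt_le _ _ lc) hk0.
  rewrite /k S_INR; move: h; set q := Rmult _ (ln c).
  have -> : q = Rplus (INR D) (Rplus (Rmult 2 B) (ln c)) by rewrite /q; field; lra.
  lra.
have [M' [C hC]] := hD k M isT.
pose P := 6 * k + 9.
(* The pathwidth varies with the formula but never exceeds [P], so one constant bounds [f] on all
   instances. *)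
have [F0 F00 hF] := exists_bound (fun p => INR (f p)) P.+1.
have [F F0F] := exists_nat_ge F0.
pose G := Rplus B (Rmult (Rdiv (ln c) 30) (INR P)).
have [K GK] := exists_nat_ge G.
pose A := C * (k + 5) ^ D + F * (42 * k) ^ K.
(* In [ETH] one number is both the constant factor and the degree of the polynomial; the sum
   dominates [A] and [D + K]. *)
apply: (eth M' (A + (D + K))) => nv cls cnf.
have pw : pw_le (@game_of nv cls k) P by apply: pathwidth_instance.
have [p pP hp] := exact_pathwidth pw.
have pm : weights_pm1 (@game_of nv cls k) by apply: weights_pm1_instance.
have [t2 [lt2 dec]] := hM _ _ _ pm hp.
have [t lt d] := hC nv cls t2 _ cnf dec.
exists t; split; last first.
  by apply: decides_at_iff d; apply: instance_correct (nv_le_exponent nv (ltn0Sn k0)).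
set z := size (enc_cnf nv cls) in lt *; set X := 2 ^ exponent nv k in lt.
set n := game_size nv cls k in lt2.
have n0 : 0 < n by rewrite /n /game_size.
have np : Rle 1 (INR n) by apply: INR_ge1.
have gG : Rle (g p) G.
  apply: Rle_trans (Rle_abs _) (Rle_trans _ _ _ (hB p) _).
  apply: Rplus_le_compat_l; apply: Rmult_le_compat_l; first lra.
  exact: INR_le.
have G0 : Rle R0 G.
  have := pos_INR P; rewrite /G; nra.
have Gk : Rle G (Rmult (INR k) (ln c)).
  have k1 : Rle 1 (INR k) by apply: INR_ge1.
  have PE : INR P = Rplus (Rmult 6 (INR k)) 9.
    by rewrite /P INR_addn INR_muln /=; lra.
  have := pos_INR D; rewrite /G PE; nra.
have Dk : Rle (INR D) (Rmult (INR k) (ln c)) by lra.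
have T := total_time C F c1 (ltn0Sn k0) Dk (conj G0 Gk) GK (pow2_le_exp nv (ltn0Sn k0)) n0 (game_size_le nv cls (ltn0Sn k0)).
have t2le : Rle (INR t2) (Rmult (INR F) (Rpower (INR n) G)).
  apply: Rle_trans lt2 _; apply: Rmult_le_compat.
  - exact: pos_INR.
  - by left; apply: exp_pos.
  - by apply: Rle_trans F0F; apply: hF.
  - exact: Rle_Rpower.
have h1 := INR_le lt; rewrite INR_addn INR_muln INR_expn !INR_addn -/k in h1.
apply: Rle_trans h1 _; apply: Rle_trans (Rle_trans _ _ _ _ T) _.
  by apply: Rplus_le_compat; [right | exact: t2le].
rewrite -/A -/z; apply: budget_mono.
- by left; apply: exp_pos.
- exact: pos_INR.
- exact: pos_INR.
- by apply: INR_le; apply: leq_addr.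
- by apply: INR_le; rewrite leq_pexp2l // leq_addl.
Qed.
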